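(* Let $G$ be a bounded degree graph which is quasi-isometric to a tree. Then $G$ has the vdBK property if and only if $G$ admits detours. In fact, if $G$ admits detours, then whenever $\nu,\tilde\nu$ are probability measures on $[0,\infty)$ with finite mean such that $\tilde\nu$ is strictly more variable than $\nu$, we have $$\liminf_{d(x,y)\to\infty}\frac{\mathbb{E}T(x,y)-\mathbb{E}\tilde T(x,y)}{d(x,y)}>0 .$$
   Context: **Graphs.** A graph $G=(V,E)$ is a pair of sets with a boundary map from $E$ to the two-element subsets of $V$ (parallel edges allowed, no self-loops). The ambient graph is always assumed connected, locally finite, and with $V$ countably infinite. A path is an alternating sequence of vertices and edges, starting and ending with a vertex, in which the two vertices next to an edge form its boundary; we identify a path with its set of edges, and $|\pi|$ is the number of edges appearing in $\pi$. A path is self-avoiding if it has no repeated vertices. $d$ is the graph distance and $B(x,R)=\{y\in V: d(x,y)\le R\}$. An edge-geodesic is a path of minimal length between its endpoints. Trees carry their graph metric. **Detours.** For two paths $\pi,\pi'$ with the same starting point and the same ending point and $\pi\neq\pi'$ as edge sets, $\pi'$ is an $\epsilon$-detour for $\pi$ if $|\pi'\setminus\pi|\le(1+\epsilon)|\pi\setminus\pi'|$ (set differences of edge sets). $G$ admits detours if for every $\epsilon>0$ there is some (positive integer) $C$ such that every self-avoiding path $\pi$ in $G$ of length $C$ has a self-avoiding $\epsilon$-detour. **First passage percolation.** Given a probability measure $\nu$ on $[0,\infty)$, let $(w(e))_{e\in E}$ be i.i.d. with law $\nu$, $T(\pi)=\sum_{e\in\pi}w(e)$ for a path $\pi$ without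 repeated edges, and $T(x,y)=\inf\{T(\gamma):\gamma \text{ a self-avoiding path from } x \text{ to } y\}$. $\tilde T$ is defined in the same way from $\tilde\nu$. **More variable.** $\tilde\nu$ is more variable than $\nu$ if $\int f\,d\tilde\nu\le\int f\,d\nu$ for every concave nondecreasing $f:\mathbb{R}\to\mathbb{R}$ for which both integrals converge absolutely; strictly more variable if moreover $\tilde\nu\ne\nu$. **Exponential subcriticality.** For $p\in[0,1]$, $G_p$ is the random subgraph keeping each edge independently with probability $p$. Let $\underline{p_c}$ be the supremum of $p\in[0,1]$ with $\limsup_{R\to\infty}\sup_{o\in V}\frac1R\log\mathbb{P}(G_p\text{ contains a path from }o\text{ to }B(o,R)^c)<0$, and let $\vec{\underline{p_c}}$ be the supremum of $p\in[0,1]$ with $\limsup_{R\to\infty}\sup_{o\in V}\frac1R\log\mathbb{P}(G_p\text{ contains a path from }o\text{ to }B(o,R)^c\text{ which is edge-geodesic in }G)<0$. $\nu$ is exponential-subcritical if either $\inf\operatorname{supp}\nu=0$ and $\nu(\{0\})<\underline{p_c}$, or $a:=\inf\operatorname{supp}\nu>0$ and $\nu(\{a\})<\vec{\underline{p_c}}$. **vdBK property.** $G$ has the vdBK property if for all probability measures $\nu,\tilde\nu$ on $[0,\infty)$ with finite mean such that $\nu$ is exponential-subcritical and $\tilde\nu$ is strictly more variable than $\nu$, $$\liminf_{d(x,y)\to\infty}\frac{\mathbb{E}T(x,y)-\mathbb{E}\tilde T(x,y)}{d(x,y)}>0 .$$ *)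

(* Defs.v *)
From HB Require Import structures.
From mathcomp Require Import all_boot all_order all_algebra finmap.
From mathcomp Require Import all_classical all_reals all_analysis.

Set Implicit Arguments.
Unset Strict Implicit.
Unset Printing Implicit Defensive.

Import Order.TTheory GRing.Theory Num.Theory.
Import numFieldNormedType.Exports.

Local Open Scope classical_set_scope.
Local Open Scope ring_scope.

(* Multigraphs without self-loops: [bnd e] is the pair of endpoints of [e].
   The ambient assumptions (connected, locally finite, countably infinite) are
   separate predicates, because the tree in [quasi_isometric_to_tree] need not
   satisfy the last two. *)
Record graph := Graph {
  vertex : choiceType;
  edge : choiceType;
  bnd : edge -> {fset vertex};
  card_bnd : forall e, #|` bnd e| = 2%N }.
Arguments bnd {g} e.

Section Graphs.
Variable G : graph.

(* The path [x0 e1 x1 ... en xn] is the pair of [x0] and the sequence of the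
   [(ei, xi)]. *)
Definition gpath : Type := (vertex G * seq (edge G * vertex G))%type.

Definition pstart (p : gpath) : vertex G := p.1.
Definition pverts (p : gpath) : seq (vertex G) := p.1 :: unzip2 p.2.
Definition pend (p : gpath) : vertex G := last p.1 (unzip2 p.2).
Definition pedges (p : gpath) : {fset edge G} := [fset e in unzip1 p.2]%fset.
Definition plen (p : gpath) : nat := #|` pedges p|.

Fixpoint is_walk (x : vertex G) (s : seq (edge G * vertex G)) : bool :=
  if s is (e, y) :: s' then (bnd e == [fset x; y]%fset) && is_walk y s'
  else true.

Definition is_path (p : gpath) : bool := is_walk p.1 p.2.

Definition self_avoiding (p : gpath) : bool := is_path p && uniq (pverts p).

Definition joins (x y : vertex G) (p : gpath) : Prop := pstart p = x /\ pend p = y.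

Definition connected_graph : Prop :=
  forall x y, exists p, is_path p /\ joins x y p.

Definition incident (x : vertex G) : set (edge G) := [set e | x \in bnd e].

Definition locally_finite : Prop := forall x, finite_set (incident x).

Definition bounded_degree : Prop :=
  exists D : nat, forall x, (incident x #<= `I_D)%card.

Definition countably_infinite : Prop := ([set: vertex G] #= [set: nat])%card.

Definition path_lengths (x y : vertex G) : set nat :=
  [set plen p | p in [set p | is_path p /\ joins x y p]].

(* Least path length; the default value 0 only arises between distinct
   components. *)
Definition dist (x y : vertex G) : nat :=
  xget 0%N [set n | path_lengths x y n /\ lbound (path_lengths x y) n].

Definition gball (x : vertex G) (r : nat) : set (vertex G) :=
  [set y | (dist x y <= r)%N].

Definition edge_geodesic (p : gpath) : Prop :=
  is_path p /\
  (forall q, is_path q -> joins (pstart p) (pend p) q -> (plen p <= plen q)%N).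

(* Two parallel edges form a cycle. *)
Definition is_cycle (p : gpath) : Prop :=
  [/\ is_path p, p.2 <> [::], pend p = pstart p,
      uniq (unzip1 p.2) & uniq (unzip2 p.2)].

Definition is_tree : Prop := connected_graph /\ forall p, ~ is_cycle p.

Definition is_detour (R : realType) (eps : R) (p q : gpath) : Prop :=
  [/\ is_path q,
      joins (pstart p) (pend p) q,
      pedges q <> pedges p &
      (#|` (pedges q `\` pedges p)%fset|)%:R
        <= (1 + eps) * (#|` (pedges p `\` pedges q)%fset|)%:R].

Definition admits_detours (R : realType) : Prop :=
  forall eps : R, 0 < eps -> exists C : nat, (0 < C)%N /\
    forall p, self_avoiding p -> plen p = C ->
      exists q, self_avoiding q /\ is_detour eps p q.

End Graphs.

Definition quasi_isometric (R : realType) (G H : graph) : Prop :=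
  exists (f : vertex G -> vertex H) (A B : R),
    [/\ 1 <= A, 0 <= B,
        (forall x y, A^-1 * (dist x y)%:R - B <= (dist (f x) (f y))%:R
                     <= A * (dist x y)%:R + B) &
        (forall z, exists x, (dist (f x) z)%:R <= B)].

Definition quasi_isometric_to_tree (R : realType) (G : graph) : Prop :=
  exists T : graph, is_tree T /\ quasi_isometric R G T.

Definition mutually_independent (R : realType) (I : choiceType)
    (d d' : measure_display) (Om : measurableType d) (S : measurableType d')
    (P : probability Om R) (X : I -> {RV P >-> S}) : Prop :=
  forall (J : {fset I}) (A : I -> set S),
    (forall i, i \in J -> measurable (A i)) ->
    P (\bigcap_(i in [set` J]) X i @^-1` A i)
      = (\prod_(i <- J) P (X i @^-1` A i))%E.

Definition iid (R : realType) (I : choiceType)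
    (d d' : measure_display) (Om : measurableType d) (S : measurableType d')
    (P : probability Om R) (X : I -> {RV P >-> S}) (mu : set S -> \bar R)
    : Prop :=
  mutually_independent X /\
  forall i A, measurable A -> distribution P (X i) A = mu A.

Section Percolation.
Variables (R : realType) (G : graph).

Definition escape_event (good : set (gpath G)) (op : edge G -> bool)
    (o : vertex G) (r : nat) : Prop :=
  exists p, [/\ is_path p, pstart p = o, ~ gball o r (pend p), good p &
                forall e, e \in pedges p -> op e].

(* The law of the open edges determines the probabilities below, so the choice
   of a realization of [G_p] does not matter. *)
Definition exp_decay (good : set (gpath G)) (p : R) : Prop :=
  forall (d : measure_display) (Om : measurableType d) (P : probability Om R)
    (op : edge G -> {RV P >-> bool}), iid op (bernoulli_prob p) ->
  (limn_esup (fun r : nat =>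
     ereal_sup [set (r%:R^-1)%:E *
                    lne (P [set om | escape_event good (fun e => op e om) o r])
               | o in [set: vertex G]]) < 0)%E.

Definition pc : R :=
  sup [set p : R | 0 <= p <= 1 /\ exp_decay [set: gpath G] p].

Definition pc_geo : R :=
  sup [set p : R | 0 <= p <= 1 /\ exp_decay (@edge_geodesic G) p].

Definition supp (nu : probability (measurableTypeR R) R) : set R :=
  [set x | forall U : set R, open U -> U x -> (0 < nu U)%E].

Definition exponential_subcritical
    (nu : probability (measurableTypeR R) R) : Prop :=
  (inf (supp nu) = 0 /\ (nu [set 0%R] < pc%:E)%E) \/
  (0 < inf (supp nu) /\ (nu [set inf (supp nu)] < pc_geo%:E)%E).

End Percolation.

Section Laws.
Variable R : realType.
Implicit Types nu : probability (measurableTypeR R) R.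

Definition on_nonneg nu : Prop := nu [set x : R | 0 <= x] = 1%E.

Definition finite_mean nu : Prop :=
  nu.-integrable [set: measurableTypeR R] (EFin : R -> \bar R).

Definition concave (f : R -> R) : Prop :=
  forall t x y : R, 0 <= t <= 1 ->
    t * f x + (1 - t) * f y <= f (t * x + (1 - t) * y).

Definition more_variable nu' nu : Prop :=
  forall f : R -> R, concave f -> {homo f : x y / x <= y} ->
    nu.-integrable [set: measurableTypeR R] (EFin \o f) ->
    nu'.-integrable [set: measurableTypeR R] (EFin \o f) ->
    (\int[nu']_x (f x)%:E <= \int[nu]_x (f x)%:E)%E.

Definition strictly_more_variable nu' nu : Prop :=
  more_variable nu' nu /\
  ~ (forall A : set (measurableTypeR R), measurable A -> nu' A = nu A).

End Laws.

Section FirstPassagePercolation.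
Variables (R : realType) (G : graph).

Definition path_time (w : edge G -> R) (p : gpath G) : R :=
  \sum_(e <- pedges p) w e.

(* Weights with a law on [0, +oo) are nonnegative almost surely; off that event
   the real [inf] below may be a junk value, which expectations do not see. *)
Definition passage_time (w : edge G -> R) (x y : vertex G) : R :=
  inf [set path_time w p | p in [set p | self_avoiding p /\ joins x y p]].

Definition liminf_dist (f : vertex G -> vertex G -> \bar R) : \bar R :=
  ereal_sup [set ereal_inf [set f xy.1 xy.2 |
                            xy in [set xy | (N <= dist xy.1 xy.2)%N]]
            | N in [set: nat]].

(* The laws [nu] and [nu'] determine the expectations, so the choice of
   realizations of the weights does not matter. *)
Definition liminf_gap_pos (nu nu' : probability (measurableTypeR R) R) : Prop :=
  forall (d d' : measure_display) (Om : measurableType d)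
    (Om' : measurableType d') (P : probability Om R) (P' : probability Om' R)
    (w : edge G -> {RV P >-> measurableTypeR R})
    (w' : edge G -> {RV P' >-> measurableTypeR R}),
  iid w nu -> iid w' nu' ->
  (0 < liminf_dist (fun x y =>
     ('E_P[fun om => passage_time (fun e => w e om) x y]
      - 'E_P'[fun om => passage_time (fun e => w' e om) x y])
     * ((dist x y)%:R^-1)%:E))%E.

Definition vdBK : Prop :=
  forall nu nu' : probability (measurableTypeR R) R,
    on_nonneg nu -> on_nonneg nu' -> finite_mean nu -> finite_mean nu' ->
    exponential_subcritical G nu -> strictly_more_variable nu' nu ->
    liminf_gap_pos nu nu'.

End FirstPassagePercolation.

(* Main.v *)
(* Detours imply the gap.  As a function of the weight [t] of one edge [e], the
   passage time is [T0 + min t D], where the threshold [D] only depends on the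
   other weights; so replacing [nu] by [nu'] at [e] lowers the mean by the mean
   of [phi D], where [phi s] is the difference of the truncated means
   [E (min t s)] under [nu] and [nu'].  It is nonnegative, and positive on some
   window whose ends [al < be] are charged by [nu] or [nu'].  It remains to bring
   [D] into the window with probability bounded below, using boundedly many
   edges.  In a quasi-tree every path between two vertices passes close to all
   vertices of a geodesic path between them.  Give weight [al] to a long geodesic
   segment and [be] to the other edges of a large ball: then every edge in the
   middle of the segment has threshold at least [be].  Give weight [al] also to a
   detour of the middle part, and raise the edges that it avoids one by one to
   [be]: the detour bounds the passage time, so one of these edges has threshold
   below [be] at some stage.  Between the two configurations the threshold moves
   by steps of size at most [be - al], hence visits the window.  Disjoint balls
   along a geodesic path yield a linear gain.  General laws are reduced to finite
   sums by discretizing the weights and restricting to a finite set of edges.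

   No gap without detours.  If for some [eps] and every length [C] there is a
   path of length [C] without [eps]-detours, then that path is optimal as soon as
   all weights lie in [1, 1 + eps], so the mean passage time between its ends is
   [C] times the mean weight.  Two laws on [1, 1 + eps] with the same mean then
   have no gap.  Laws on many values have atoms smaller than the threshold
   probability [pc_geo], which is positive for bounded degree, and independent
   weights are obtained from the digits of a uniform random variable. *)

From HB Require Import structures.
Require Import Defs.
From mathcomp Require Import all_boot all_order all_algebra finmap.
From mathcomp Require Import all_classical all_reals all_analysis.
From mathcomp Require Import measurable_realfun.
From mathcomp Require Import zify ring lra.

Set Implicit Arguments.
Unset Strict Implicit.
Unset Printing Implicit Defensive.

Import Order.TTheory GRing.Theory Num.Theory.
Import numFieldNormedType.Exports.

Local Open Scope classical_set_scope.
Local Open Scope ring_scope.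

(** * Walks and distances *)

(** An end of the window may be charged by only one of the two laws, so a block is passed from [nu]
    to [nu'] through their average, which charges the support of both. Support points need not be
    atoms: weights come close to [al] and [be] only up to a tolerance [rho]. The resulting error in
    the threshold is linear in the number of edges of the block and is absorbed by a strip of width
    [th] around the window. The detour quality [(be - al) / (2 * be)] makes the extra edges of the
    detour cost at most half of what raising the avoided edges yields. The margins of length [L] at
    both ends of the segment pay for connections of length [R0] and for the cheap detour edges that
    a competing path may use. Discretization spoils the sign of [phi] by an error [eta], paid at
    most a bounded number of times per edge of the finite edge set; the mesh is therefore chosen
    after that set, while the gain per block depends on neither. Thresholds are capped at a value
    [M] that bounds all discretized weights, which keeps them meaningful for edges that every path
    must use. *)

Section Walks.
Variable G : graph.
Implicit Types (x y z : vertex G) (s : seq (edge G * vertex G)) (e : edge G).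

Definition wend x s := last x (unzip2 s).

Fixpoint wrev x s : seq (edge G * vertex G) :=
  if s is (e, y) :: s' then rcons (wrev y s') (e, x) else [::].

Lemma wend_cat x s1 s2 : wend x (s1 ++ s2) = wend (wend x s1) s2.
Proof. by rewrite /wend /unzip2 map_cat last_cat. Qed.

Lemma is_walk_cat x s1 s2 :
  is_walk x (s1 ++ s2) = is_walk x s1 && is_walk (wend x s1) s2.
Proof. by elim: s1 x => [|[e y] s1 ih] x //=; rewrite ih andbA. Qed.

Lemma wend_rcons x s p : wend x (rcons s p) = p.2.
Proof. by rewrite /wend /unzip2 map_rcons last_rcons. Qed.

Lemma wend_mem x s : wend x s \in x :: unzip2 s.
Proof. exact: mem_last. Qed.

Lemma is_walk_rcons x s e y : is_walk x (rcons s (e, y)) =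
  is_walk x s && (bnd e == [fset wend x s; y]%fset).
Proof. by rewrite -cats1 is_walk_cat /= andbT. Qed.

Lemma wend_wrev x s : wend (wend x s) (wrev x s) = x.
Proof. by case: s => [|[e y] s] //=; rewrite wend_rcons. Qed.

Lemma is_walk_wrev x s : is_walk x s -> is_walk (wend x s) (wrev x s).
Proof.
elim: s x => [|[e y] s ih] x //= /andP[/eqP be /ih h].
by rewrite is_walk_rcons /wend /= in h *; rewrite h /= -/(wend _ _) wend_wrev fsetUC be.
Qed.

Lemma unzip1_wrev x s : unzip1 (wrev x s) = rev (unzip1 s).
Proof.
by elim: s x => [|[e y] s ih] x //=; rewrite /unzip1 map_rcons -/(unzip1 _) ih rev_cons.
Qed.

Lemma verts_wrev x s : wend x s :: unzip2 (wrev x s) = rev (x :: unzip2 s).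
Proof.
elim: s x => [|[e y] s ih] x //=.
by rewrite /unzip2 map_rcons -/(unzip2 _) /= rev_cons -ih.
Qed.

Lemma size_wrev x s : size (wrev x s) = size s.
Proof. by rewrite -(size_map fst) -/(unzip1 _) unzip1_wrev size_rev size_map. Qed.

Lemma bnd_mem x s e z : is_walk x s -> e \in unzip1 s -> z \in bnd e ->
  z \in x :: unzip2 s.
Proof.
elim: s x => [|[e' y] s ih] x //= /andP[/eqP be h].
rewrite inE => /orP[/eqP->|/ih]; last first.
  by move=> /(_ _ h) k /k; rewrite !inE => ->; rewrite orbT.
by rewrite be !inE => /orP[]->; rewrite ?orbT.
Qed.

Lemma uniq_walk_edges x s : is_walk x s -> uniq (x :: unzip2 s) ->
  uniq (unzip1 s).
Proof.
elim: s x => [|[e y] s ih] x // /= /andP[/eqP be h] /andP[xn u].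
apply/andP; split; last exact: ih h u.
apply: contra xn => es; apply: (bnd_mem h es).
by rewrite be !inE eqxx.
Qed.

(** If the start recurs, the closed walk before the recurrence is discarded. The conclusion
    [subseq], rather than an inclusion of supports, also controls costs counted with
    multiplicity. *)
Lemma loop_erasure x s : is_walk x s ->
  exists s', [/\ is_walk x s', wend x s' = wend x s, uniq (x :: unzip2 s')
                & subseq s' s].
Proof.
elim: {s}(size s) {-2}s x (leqnn (size s)) => [|n ih] s x.
  by rewrite leqn0 size_eq0 => /eqP-> _; exists [::].
case: s => [|[e y] s] /=; first by exists [::].
rewrite ltnS => sn /andP[/eqP be h].
have [xin|xn] := boolP (x \in y :: unzip2 s); last first.
  have [s' [w' e' u' ss]] := ih s y sn h.
  exists ((e, y) :: s'); split; rewrite /= ?be ?eqxx //.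
  by apply/andP; split => //; apply: contra xn; rewrite !inE => /orP[->//|/(mem_subseq (map_subseq snd ss)) ->]; rewrite orbT.
have [s1 [s2 [es ex]]] : exists s1 s2, s = s1 ++ s2 /\ wend y s1 = x.
  have yx : exists2 i, (i <= size s)%N & wend y (take i s) = x.
    move: xin; rewrite inE => /orP[/eqP ->|xs]; first by exists 0%N => //; rewrite take0.
    have := xs; rewrite -index_mem size_map => k.
    exists (index x (unzip2 s)).+1 => //.
    rewrite (take_nth (e, x)) // wend_rcons.
    by rewrite -(nth_map _ x) // nth_index.
  have [i _ hi] := yx.
  by exists (take i s), (drop i s); rewrite cat_take_drop.
rewrite es is_walk_cat ex in h; case/andP: h => h1 h2.
have s2n : (size s2 <= n)%N by apply: leq_trans sn; rewrite es size_cat leq_addl.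
have [s' [w' e' u' ss]] := ih s2 x s2n h2.
exists s'; split => //.
  by rewrite /wend /= -!/(wend _ _) es wend_cat ex.
change (subseq s' ((e, y) :: s)); rewrite es.
apply: subseq_trans ss _.
exact: (suffix_subseq ((e, y) :: s1) s2).
Qed.

Lemma mem_pedges x s e : (e \in pedges (x, s)) = (e \in unzip1 s).
Proof. by rewrite /pedges /= inE. Qed.

Lemma plenE x s : uniq (unzip1 s) -> plen (x, s) = size s.
Proof.
by move=> u; rewrite /plen /pedges /= card_fseq undup_id // size_map.
Qed.

Lemma plen_le_size x s : (plen (x, s) <= size s)%N.
Proof. by rewrite /plen /pedges card_fseq -(size_map fst) size_undup. Qed.

Lemma self_avoidingE x s :
  self_avoiding (x, s) = is_walk x s && uniq (x :: unzip2 s).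
Proof. by []. Qed.

Hypothesis conn : connected_graph G.

(** Connectedness makes the set of lengths nonempty, which excludes the default value in [dist]. *)
Lemma dist_spec x y : path_lengths x y (dist x y) /\
  lbound (path_lengths x y) (dist x y).
Proof.
rewrite /dist; case: xgetP => [n -> //|hn]; exfalso.
have [p [pp pxy]] := conn x y.
have ex : exists n, `[< path_lengths x y n >].
  by exists (plen p); apply/asboolP; exists p.
case: (ex_minnP ex) => n /asboolP hn1 hn2; apply: (hn n); split => // m hm.
by rewrite leEnat; apply: hn2; apply/asboolP.
Qed.

Lemma dist_le_plen x s : is_walk x s -> (dist x (wend x s) <= plen (x, s))%N.
Proof.
by move=> w; have [_] := dist_spec x (wend x s); apply; exists (x, s).
Qed.

Lemma dist_le x y s : is_walk x s -> wend x s = y -> (dist x y <= size s)%N.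
Proof. by move=> w <-; apply: leq_trans (dist_le_plen w) (plen_le_size _ _). Qed.

(** [plen] counts distinct edges and [size] counts steps; loop erasure of a minimizer makes the two
    agree. *)
Lemma dist_path x y : exists s, [/\ is_walk x s, wend x s = y,
  uniq (x :: unzip2 s) & size s = dist x y].
Proof.
have [[[x' s] [/= w [e1 e2]] e3] _] := dist_spec x y.
rewrite /pstart /= in e1; subst x'; rewrite /pend /= -/(wend _ _) in e2.
have [s' [w' e' u' ss]] := loop_erasure w.
exists s'; split => //; first by rewrite e'.
apply/eqP; rewrite eqn_leq dist_le // ?e' // andbT -e3.
rewrite -(plenE x (uniq_walk_edges w' u')) /plen fsubset_leq_card //.
apply/fsubsetP => e; rewrite !mem_pedges; exact: mem_subseq (map_subseq fst ss) _.
Qed.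

Lemma distxx x : dist x x = 0%N.
Proof. by apply/eqP; rewrite -leqn0; exact: (@dist_le x x [::]). Qed.

Lemma dist_eq0 x y : dist x y = 0%N -> x = y.
Proof.
by have [s [_ <- _ /eqP]] := dist_path x y; move=> /[swap] -> /nilP ->.
Qed.

Lemma dist_sym x y : dist x y = dist y x.
Proof.
suff h (a b : vertex G) : (dist a b <= dist b a)%N by apply/eqP; rewrite eqn_leq !h.
have [s [w e _ <-]] := dist_path b a; rewrite -(size_wrev b).
by apply: dist_le; rewrite -e; [exact: is_walk_wrev|exact: wend_wrev].
Qed.

Lemma dist_triangle y x z : (dist x z <= dist x y + dist y z)%N.
Proof.
have [s [w e _ <-]] := dist_path x y; have [t [v f _ <-]] := dist_path y z.
by rewrite -size_cat; apply: dist_le; rewrite ?is_walk_cat ?w ?e ?wend_cat ?e.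
Qed.

Lemma dist_edge x y e : bnd e = [fset x; y]%fset -> (dist x y <= 1)%N.
Proof.
by move=> be; apply: (@dist_le x y [:: (e, y)]); rewrite //= be eqxx.
Qed.

Lemma bnd2 e : exists x y, bnd e = [fset x; y]%fset.
Proof.
have : #|` bnd e| == 2%N by rewrite card_bnd.
move=> /eqP h; have /fset0Pn[x xe] : bnd e != fset0 by rewrite -cardfs_gt0 h.
have : #|` (bnd e `\ x)%fset| == 1%N.
  by move: (cardfsD1 x (bnd e)); rewrite h xe /= add1n => -[<-].
by move=> /cardfs1P[y ey]; exists x, y; rewrite -(fsetD1K xe) ey.
Qed.

End Walks.

(** * Bottlenecks in quasi-trees *)

Section Hitting.
Variable G : graph.
Implicit Types (x y z : vertex G) (s : seq (edge G * vertex G)) (e : edge G).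

Lemma split_at x s z : z \in x :: unzip2 s ->
  exists s1 s2, s = s1 ++ s2 /\ wend x s1 = z.
Proof.
elim: s x => [|[e y] s ih] x; first by rewrite inE => /eqP ->; exists [::], [::].
rewrite inE => /orP[/eqP ->|/ih [s1 [s2 [-> h]]]]; first by exists [::], ((e, y) :: s).
by exists ((e, y) :: s1), s2.
Qed.

Lemma first_hit (P : pred (vertex G)) x s : has P (x :: unzip2 s) ->
  exists s1 s2, [/\ s = s1 ++ s2, P (wend x s1) &
    forall v, v \in belast x (unzip2 s1) -> ~~ P v].
Proof.
elim: s x => [|[e y] s ih] x.
  by rewrite /= orbF => h; exists [::], [::].
have [Px _|Px] := boolP (P x); first by exists [::], ((e, y) :: s).
rewrite /= (negPf Px) /= => /ih[s1 [s2 [-> h1 h2]]].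
exists ((e, y) :: s1), s2; split => // v.
by rewrite /= inE => /orP[/eqP ->//|]; exact: h2.
Qed.

Lemma last_hit (P : pred (vertex G)) x s : has P (x :: unzip2 s) ->
  exists s1 s2, [/\ s = s1 ++ s2, P (wend x s1) &
    forall v, v \in unzip2 s2 -> ~~ P v].
Proof.
elim: s x => [|[e y] s ih] x.
  by rewrite /= orbF => h; exists [::], [::].
have [/ih[s1 [s2 [-> h1 h2]]] _|hn] := boolP (has P (y :: unzip2 s)).
  by exists ((e, y) :: s1), s2.
rewrite [has _ _]/= -/(has P (y :: unzip2 s)) (negPf hn) orbF => h.
by exists [::], ((e, y) :: s); split => // v vs; move/hasPn: hn; apply.
Qed.

Lemma verts_cat x s1 s2 :
  x :: unzip2 (s1 ++ s2) = belast x (unzip2 s1) ++ wend x s1 :: unzip2 s2.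
Proof.
by rewrite /unzip2 map_cat -cat_cons -!/(unzip2 _) lastI cat_rcons.
Qed.

Lemma wrev_verts x s : unzip2 (wrev x s) = rev (belast x (unzip2 s)).
Proof.
have := verts_wrev x s; rewrite [x :: _]lastI rev_rcons => -[].
by [].
Qed.

End Hitting.

(** * Separating vertices and medians in trees *)

Section Tree.
Variable T : graph.
Hypothesis tree : is_tree T.
Implicit Types (a b c d x y z : vertex T) (s t : seq (edge T * vertex T)).

(** Let [A] and [B] be the vertices of [s] before and after [c]. If [t] avoided [c], some walk from
    [A] to [B] would avoid [c]; a shortest one, [q], meets [s] only at its two ends and forms a
    cycle with the arc of [s] between them. *)
Lemma tree_visit x s t c : is_walk x s -> uniq (x :: unzip2 s) ->
  c \in x :: unzip2 s -> is_walk x t -> wend x t = wend x s ->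
  c \in x :: unzip2 t.
Proof.
have [conn acyc] := tree.
move=> ws us cs wt et; apply/negPn/negP => ct.
have [s1 [s2 [es ec]]] := split_at cs.
rewrite es is_walk_cat ec in ws; case/andP: ws => w1 w2.
rewrite es verts_cat ec in us; move: us; rewrite cat_uniq => /and3P[u1 u12 u2].
set A := belast x (unzip2 s1); set B := unzip2 s2.
have AB v : v \in A -> v \in c :: B -> False.
  by move=> vA vB; move/hasPn: u12 => /(_ v vB); rewrite /mem /= vA.
pose good n := `[< exists a q, [/\ a \in A, is_walk a q, wend a q \in B,
  c \notin a :: unzip2 q & size q = n] >].
have xA : x \in A.
  rewrite /A; case: (s1) ec => [|[e y] s1'] /=; last by rewrite mem_head.
  by rewrite /wend /= => xc; rewrite -xc mem_head in ct.
have eB : wend x t \in B.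
  rewrite et es wend_cat ec; have := wend_mem c s2; rewrite inE => /orP[/eqP h|//].
  by case/negP: ct; rewrite -h -{1}ec -wend_cat -es -et wend_mem.
have ex : exists n, good n by exists (size t); apply/asboolP; exists x, t.
case: (ex_minnP ex) => n /asboolP[a [q0 [aA wq0 bB0 cq0 sq0]]] qmin.
have [q [wq eq uq sq]] := loop_erasure wq0.
have cq : c \notin a :: unzip2 q.
  apply: contra cq0; rewrite !inE => /orP[->//|h].
  by rewrite (mem_subseq (map_subseq snd sq)) ?orbT.
have sqn : (size q <= n)%N by rewrite -sq0 size_subseq.
set b := wend a q; have bB : b \in B by rewrite /b eq.
have qint v : v \in a :: unzip2 q -> (v \in A -> v = a) /\ (v \in B -> v = b).
  move=> vq; have [q1 [q2 [eq12 ev]]] := split_at vq.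
  move: (wq); rewrite eq12 is_walk_cat ev => /andP[wq1 wq2].
  have cqq : c \notin belast a (unzip2 q1) ++ v :: unzip2 q2.
    by rewrite -ev -verts_cat -eq12.
  split=> [vA|vB].
    have /qmin : good (size q2).
      apply/asboolP; exists v, q2; split => //.
        by rewrite -ev -wend_cat -eq12.
      by apply: contra cqq; rewrite mem_cat => ->; rewrite orbT.
    move/(leq_trans sqn); rewrite eq12 size_cat -{2}[size q2]add0n leq_add2r leqn0.
    by move=> /nilP q10; rewrite -ev q10.
  have /qmin : good (size q1).
    apply/asboolP; exists a, q1; split; rewrite ?ev //.
    apply: contra cqq; rewrite lastI mem_rcons mem_cat -/(wend _ _) ev !inE.
    by case/orP => ->; rewrite ?orbT.
  move/(leq_trans sqn); rewrite eq12 size_cat -{2}[size q1]addn0 leq_add2l leqn0.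
  by move=> /nilP q20; rewrite /b eq12 q20 cats0 ev.
have [s1a [s1b [e1 ea]]] : exists s1a s1b, s1 = s1a ++ s1b /\ wend x s1a = a.
  by apply: split_at; rewrite lastI mem_rcons inE aA orbT.
have [s2a [s2b [e2 eb]]] : exists s2a s2b, s2 = s2a ++ s2b /\ wend c s2a = b.
  by apply: split_at; rewrite inE bB orbT.
have ec' : wend a s1b = c by rewrite -ea -wend_cat -e1.
have ac : a != c by apply/eqP => ac; apply: (AB c); rewrite -?ac // ac mem_head.
have w1b : is_walk a s1b by move: w1; rewrite e1 is_walk_cat ea => /andP[].
have w2a : is_walk c s2a by move: w2; rewrite e2 is_walk_cat => /andP[].
have u1' : uniq (a :: unzip2 s1b).
  have : uniq (x :: unzip2 s1).
    rewrite lastI -/(wend _ _) ec rcons_uniq u1 andbT.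
    by apply/negP => cA; apply: (AB c) => //; rewrite mem_head.
  by rewrite e1 verts_cat cat_uniq ea => /and3P[].
have u2' : uniq (c :: unzip2 s2a).
  move: u2; rewrite e2 verts_cat cat_uniq eb => /and3P[ub /hasPn/= h _].
  by rewrite -[_ && _]/(uniq (c :: _)) lastI rcons_uniq ub andbT -/(wend _ _) eb h // mem_head.
have sub1 v : v \in a :: unzip2 s1b -> v = c \/ v \in A.
  move=> h; have : v \in x :: unzip2 s1.
    by rewrite e1 verts_cat mem_cat ea h orbT.
  rewrite lastI mem_rcons -/(wend _ _) ec inE => /orP[/eqP ->|]; first by left.
  by right.
have sub2 v : v \in unzip2 s2a -> v \in B.
  by rewrite /B e2 /unzip2 map_cat mem_cat => ->.
apply: (acyc (a, s1b ++ s2a ++ wrev a q)).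
have un2 : uniq (a :: unzip2 (s1b ++ s2a)).
  rewrite verts_cat ec' cat_uniq u2' andbT.
  move: u1'; rewrite lastI rcons_uniq -/(wend _ _) ec' => /andP[cn ->] /=.
  rewrite negb_or cn /=; apply/hasPn => v /sub2 vB; apply/negP => /= vb.
  have [|vc|vA] := sub1 v.
  - by rewrite lastI mem_rcons inE vb orbT.
  - by rewrite -vc vb in cn.
  - by apply: (AB v vA); rewrite inE vB orbT.
have wP : is_walk a (s1b ++ s2a) by rewrite is_walk_cat w1b ec' w2a.
have eP : wend a (s1b ++ s2a) = b by rewrite wend_cat ec' eb.
have b_s1 : b \notin a :: unzip2 s1b.
  apply/negP => /sub1[bc|bA]; last by apply: (AB b bA); rewrite inE bB orbT.
  by move: cq; rewrite -bc wend_mem.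
have a_s2 : a \notin c :: unzip2 s2a.
  by apply/negP; rewrite inE (negPf ac) => /sub2 aB; apply: (AB a aA); rewrite inE aB orbT.
split => /=.
- by rewrite /is_path /= catA is_walk_cat wP eP is_walk_wrev.
- by case: (s1b) ec' => [|//] /= h; rewrite /wend /= in h; rewrite h eqxx in ac.
- by rewrite /pend /pstart /= -/(wend _ _) catA wend_cat eP wend_wrev.
- rewrite catA /unzip1 map_cat -!/(unzip1 _) cat_uniq (uniq_walk_edges wP un2) /=.
  rewrite unzip1_wrev rev_uniq (uniq_walk_edges wq uq) andbT.
  (* An edge common to [q] and the arc would have [a] and [b] as its ends, but neither half of the
     arc, before or after [c], contains both contacts. *)
  apply/hasPn => e; rewrite mem_rev => eq'; apply/negP => /= eP'.
  have bd v : v \in bnd e -> v \in [fset a; b]%fset.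
    move=> ve; have vq := bnd_mem wq eq' ve; have [va vb] := qint v vq.
    have := bnd_mem wP eP' ve; rewrite verts_cat ec' mem_cat => /orP[h|].
      have [|vc|/va ->] := sub1 v; last by rewrite !inE eqxx.
        by rewrite lastI mem_rcons inE h orbT.
      by rewrite -vc vq in cq.
    rewrite inE => /orP[/eqP vc|/sub2/vb ->]; last by rewrite !inE eqxx orbT.
    by rewrite -vc vq in cq.
  have bdE : bnd e = [fset a; b]%fset.
    apply/eqP; rewrite eqEfcard; apply/andP; split; first exact/fsubsetP.
    by rewrite card_bnd cardfs2; case: (a != b).
  move: eP'; rewrite /unzip1 map_cat mem_cat -!/(unzip1 _) => /orP[h|h].
    by case/negP: b_s1; apply: (bnd_mem w1b h); rewrite bdE !inE eqxx orbT.
  by case/negP: a_s2; apply: (bnd_mem w2a h); rewrite bdE !inE eqxx.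
- rewrite catA /unzip2 map_cat -!/(unzip2 _) cat_uniq wrev_verts rev_uniq.
  move: (un2) => /= /andP[aP ->] /=.
  have -> : uniq (belast a (unzip2 q)).
    by move: uq; rewrite lastI rcons_uniq => /andP[].
  rewrite andbT; apply/hasPn => v; rewrite mem_rev => vq; apply/negP => /= vP.
  have vq' : v \in a :: unzip2 q by rewrite lastI mem_rcons inE vq orbT.
  have [va vb] := qint v vq'.
  have vna : v <> a by move=> h; rewrite -h vP in aP.
  have vnb : v <> b.
    by move: uq; rewrite lastI rcons_uniq -/(wend _ _) -/b => /andP[+ _] h; rewrite -h vq.
  have : v \in a :: unzip2 (s1b ++ s2a) by rewrite inE vP orbT.
  rewrite verts_cat ec' mem_cat => /orP[h|].
    have [|vc|/va //] := sub1 v.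
      by rewrite lastI mem_rcons inE h orbT.
    by rewrite -vc vq' in cq.
  rewrite inE => /orP[/eqP vc|/sub2/vb //].
  by rewrite -vc vq' in cq.
Qed.

(** [c] is the vertex where a simple path from [d] to [a] first meets the simple path from [a] to
    [b]. The concatenations through [c] are simple, so [tree_visit] applies to each pair of ends. *)
Lemma tree_median a b d : exists c,
  [/\ forall s, is_walk a s -> wend a s = b -> c \in a :: unzip2 s,
      forall s, is_walk a s -> wend a s = d -> c \in a :: unzip2 s &
      forall s, is_walk d s -> wend d s = b -> c \in d :: unzip2 s].
Proof.
have [conn _] := tree.
have [P [wP eP uP _]] := dist_path conn a b.
have [Q [wQ eQ uQ _]] := dist_path conn d a.
have hq : has (mem (a :: unzip2 P)) (d :: unzip2 Q).
  by apply/hasP; exists a; [rewrite -{1}eQ wend_mem|exact: mem_head].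
have [Q1 [Q2 [eQ12 cP Q1n]]] := first_hit hq.
set c := wend d Q1 in cP; rewrite /= in cP.
have wQ1 : is_walk d Q1 by move: wQ; rewrite eQ12 is_walk_cat => /andP[].
have uQ1 : uniq (d :: unzip2 Q1).
  move: uQ; rewrite eQ12 verts_cat cat_uniq => /and3P[ub /hasPn h _].
  by rewrite lastI rcons_uniq ub andbT h // mem_head.
have uQ1b : uniq (belast d (unzip2 Q1)).
  by move: uQ1; rewrite lastI rcons_uniq => /andP[].
have [P1 [P2 [eP12 ec]]] := split_at cP.
have wP1 : is_walk a P1 /\ is_walk c P2.
  by move: wP; rewrite eP12 is_walk_cat ec => /andP.
exists c; split => s ws es.
- by apply: tree_visit wP uP cP ws _; rewrite es eP.
- suff h : c \in wend a s :: unzip2 (wrev a s).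
    by move: h; rewrite verts_wrev mem_rev.
  apply: (@tree_visit _ (Q1 ++ wrev a P1)).
  + by rewrite es is_walk_cat wQ1 -/c -ec is_walk_wrev //; case: wP1.
  + rewrite es verts_cat -/c -{1}ec verts_wrev cat_uniq uQ1b rev_uniq /=.
    rewrite eP12 verts_cat cat_uniq in uP; case/and3P: uP => u1 u2 _.
    apply/andP; split.
      apply/hasPn => v; rewrite mem_rev => vP; apply/negP => /= /Q1n /negP; apply => /=.
      rewrite eP12 verts_cat mem_cat.
      by move: vP; rewrite lastI mem_rcons inE -/(wend _ _) => /orP[/eqP ->|->//]; rewrite mem_head orbT.
    by rewrite -[_ && _]/(uniq (a :: _)) lastI rcons_uniq u1 andbT; move/hasPn: u2; apply; rewrite mem_head.
  + by rewrite es verts_cat -/c mem_cat mem_head orbT.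
  + exact: is_walk_wrev.
  + by rewrite wend_wrev es wend_cat -/c -{1}ec wend_wrev.
- apply: (@tree_visit _ (Q1 ++ P2)) => //.
  + by rewrite is_walk_cat wQ1 -/c; case: wP1.
  + rewrite verts_cat -/c cat_uniq uQ1b.
    rewrite eP12 verts_cat cat_uniq ec in uP; case/and3P: uP => u1 u2 ->.
    rewrite andbT; apply/hasPn => v vP; apply/negP => /= /Q1n /negP; apply => /=.
    by rewrite eP12 verts_cat mem_cat ec vP orbT.
  + by rewrite verts_cat -/c mem_cat mem_head orbT.
  + by rewrite es wend_cat -/c -ec -wend_cat -eP12 eP.
Qed.

End Tree.

(** * Transfer of the separation property along a quasi-isometry *)

Section Bottleneck.
Variables (G T : graph).
Hypotheses (conn : connected_graph G) (tree : is_tree T).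

Lemma geodesic_between (x y v : vertex G) s : is_walk x s -> wend x s = y ->
  size s = dist x y -> v \in x :: unzip2 s ->
  (dist x v + dist v y = dist x y)%N.
Proof.
move=> w e sz /split_at[s1 [s2 [es ev]]].
move: w; rewrite es is_walk_cat ev => /andP[w1 w2].
have h1 := dist_le conn w1 ev.
have h2 : (dist v y <= size s2)%N.
  by apply: dist_le => //; rewrite -ev -wend_cat -es.
have := dist_triangle conn v x y.
by move: sz; rewrite es size_cat; lia.
Qed.

Lemma coarse_walk (f : vertex G -> vertex T) (K : nat) x s :
  (forall u v, (dist u v <= 1)%N -> (dist (f u) (f v) <= K)%N) ->
  is_walk x s -> exists t, [/\ is_walk (f x) t, wend (f x) t = f (wend x s) &
    forall c, c \in f x :: unzip2 t ->
      exists2 v, v \in x :: unzip2 s & (dist (f v) c <= K)%N].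
Proof.
have [connT _] := tree.
move=> fK; elim: s x => [|[e y] s ih] x /=.
  move=> _; exists [::]; split => // c; rewrite inE => /eqP ->.
  by exists x; rewrite ?mem_head // distxx.
move=> /andP[/eqP be /ih[t [wt et ht]]].
have [u [wu eu _ su]] := dist_path connT (f x) (f y).
exists (u ++ t); split.
- by rewrite is_walk_cat wu eu.
- by rewrite wend_cat eu et.
move=> c; rewrite verts_cat mem_cat => /orP[cu|]; last first.
  by rewrite eu => /ht[v vs hv]; exists v => //; rewrite inE vs orbT.
exists x; first exact: mem_head.
have cu' : c \in f x :: unzip2 u by rewrite lastI mem_rcons inE cu orbT.
have /split_at[u1 [u2 [eu12 ec]]] := cu'.
have w1 : is_walk (f x) u1 by move: wu; rewrite eu12 is_walk_cat => /andP[].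
apply: leq_trans (dist_le connT w1 ec) _.
apply: (@leq_trans (size u)); first by rewrite eu12 size_cat leq_addr.
by rewrite su; apply: fK; apply: dist_edge be.
Qed.

End Bottleneck.

(** Let [c] be the median of the images of [x], [y], [z]. The images of the given walk and of
    geodesics from [x] to [z] and from [z] to [y] all come near [c], at vertices [v], [z1], [z2]. As
    [z] lies between [z1] and [z2] on a geodesic, [z1] and [z2] being close makes [z1] close to [z];
    hence [v] is close to [z]. *)
Lemma bottleneck (R : realType) (G : graph) : connected_graph G ->
  quasi_isometric_to_tree R G ->
  exists R0 : nat, forall x z y : vertex G,
    (dist x z + dist z y = dist x y)%N ->
    forall s, is_walk x s -> wend x s = y ->
    exists2 v, v \in x :: unzip2 s & (dist z v <= R0)%N.
Proof.
move=> conn [T [tree [f [A [B [A1 B0 fAB _]]]]]].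
have [connT _] := tree.
have [K [K1 K2]] : exists K : nat,
    (forall u v, (dist (f u) (f v) <= K * dist u v + K)%N) /\
    (forall u v, (dist u v <= K * dist (f u) (f v) + K)%N).
  (* One integer above [A + A * B] serves in both directions: the lower estimate, solved for
     [dist u v], has additive constant [A * B]. *)
  pose K := (Num.truncn (A + A * B)).+1; exists K.
  have KA : A + A * B < K%:R by apply: truncnS_gt.
  have A0 : 0 < A by apply: lt_le_trans A1.
  split => u v; have /andP[h1 h2] := fAB u v; rewrite -(ler_nat R) natrD natrM.
    have d0 : 0 <= (dist u v)%:R :> R by exact: ler0n.
    have AB0 : 0 <= A * B by rewrite mulr_ge0 // ltW.
    have BAB : B <= A * B by rewrite ler_peMl.
    have : A * (dist u v)%:R <= K%:R * (dist u v)%:R by rewrite ler_wpM2r //; lra.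
    by lra.
  have d0 : 0 <= (dist (f u) (f v))%:R :> R by exact: ler0n.
  have : (dist u v)%:R <= A * ((dist (f u) (f v))%:R + B).
    by rewrite -ler_pdivrMl //; lra.
  have AB0 : 0 <= A * B by rewrite mulr_ge0 // ltW.
  have : A * (dist (f u) (f v))%:R <= K%:R * (dist (f u) (f v))%:R.
    by rewrite ler_wpM2r //; lra.
  move=> h3 h4; rewrite mulrDr in h4; apply: (le_trans h4).
  by apply: lerD => //; lra.
have adj u v : (dist u v <= 1)%N -> (dist (f u) (f v) <= 2 * K)%N.
  by have := K1 u v; nia.
exists (K * (5 * K + K * (4 * K * K + K)) + K)%N => x z y hz s ws es.
have [c [cxy cxz czy]] := tree_median tree (f x) (f y) (f z).
have find p q t : is_walk p t -> wend p t = q ->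
    (forall s, is_walk (f p) s -> wend (f p) s = f q -> c \in f p :: unzip2 s) ->
    exists2 v, v \in p :: unzip2 t & (dist (f v) c <= 2 * K)%N.
  move=> wt et h; have [t' [wt' et' ht']] := coarse_walk conn tree adj wt.
  by apply: ht'; apply: h => //; rewrite et' et.
have [s1 [w1 e1 _ sz1]] := dist_path conn x z.
have [s2 [w2 e2 _ sz2]] := dist_path conn z y.
have [v vs hv] := find _ _ _ ws es cxy.
have [z1 z1s hz1] := find _ _ _ w1 e1 cxz.
have [z2 z2s hz2] := find _ _ _ w2 e2 czy.
exists v => //.
have g1 := geodesic_between conn w1 e1 sz1 z1s.
have g2 := geodesic_between conn w2 e2 sz2 z2s.
have t1 := dist_triangle conn z1 x y; have t2 := dist_triangle conn z2 z1 y.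
have k12 := K2 z1 z2; have k3 := K1 z1 z; have k4 := K2 z v.
have t3 := dist_triangle connT c (f z1) (f z2).
have t4 := dist_triangle connT (f z1) (f z) (f v).
have t5 := dist_triangle connT c (f z1) (f v).
rewrite (dist_sym connT c (f z2)) in t3; rewrite (dist_sym connT c (f v)) in t5.
rewrite (dist_sym connT (f z) (f z1)) in t4.
have h : (dist z1 z <= 4 * K * K + K)%N.
  have : (dist (f z1) (f z2) <= 4 * K)%N by lia.
  by nia.
have h3 : (dist (f z1) (f z) <= K * (4 * K * K + K) + K)%N by nia.
have h4 : (dist (f z) (f v) <= 5 * K + K * (4 * K * K + K))%N by lia.
by nia.
Qed.

(** * Passage times and thresholds *)

Lemma ler_sum_uniq (R : realType) (I : eqType) (f : I -> R) (l l' : seq I) :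
  (forall i, 0 <= f i) -> uniq l -> {subset l <= l'} ->
  \sum_(i <- l) f i <= \sum_(i <- l') f i.
Proof.
move=> f0; elim: l l' => [|i l ih] l' /=; first by rewrite big_nil sumr_ge0.
move=> /andP[il ul] sub; have il' : i \in l' by apply: sub; rewrite mem_head.
rewrite (perm_big _ (perm_to_rem il')) !big_cons lerD2l; apply: ih => // j jl.
have : j \in l' by apply: sub; rewrite inE jl orbT.
rewrite (perm_mem (perm_to_rem il')) inE => /orP[/eqP ji|//].
by rewrite -ji jl in il.
Qed.

Section PassageTimes.
Variables (R : realType) (G : graph).
Implicit Types (x y z : vertex G) (s : seq (edge G * vertex G)) (e f : edge G).
Implicit Types (w : edge G -> R) (A : set (edge G)).

(** Edges count with multiplicity here, unlike in [path_time]; this makes the cost additive under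
    concatenation, and the two agree on simple walks. *)
Definition cost w s : R := \sum_(p <- s) w p.1.

Lemma cost_cat w s1 s2 : cost w (s1 ++ s2) = cost w s1 + cost w s2.
Proof. by rewrite /cost big_cat. Qed.

Lemma costE w s : cost w s = \sum_(e <- unzip1 s) w e.
Proof. by rewrite /cost big_map. Qed.

Lemma cost_ge0 w s : (forall e, 0 <= w e) -> 0 <= cost w s.
Proof. by move=> w0; rewrite /cost sumr_ge0. Qed.

Lemma cost_subseq w s' s : (forall e, 0 <= w e) -> subseq s' s ->
  cost w s' <= cost w s.
Proof.
move=> w0; elim: s s' => [|p s ih] [|p' s'] //=.
  by rewrite {1}/cost big_nil cost_ge0.
case: eqP => [->|_] /ih h; first by rewrite /cost !big_cons lerD2l.
by apply: (le_trans h); rewrite /cost [leRHS]big_cons lerDr.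
Qed.

Lemma path_time_cost w x s : uniq (unzip1 s) -> path_time w (x, s) = cost w s.
Proof.
move=> u; rewrite /path_time costE; apply: perm_big.
apply: uniq_perm => // e; exact: mem_pedges.
Qed.

Definition walk_in A x y s : Prop :=
  [/\ is_walk x s, wend x s = y & forall e, e \in unzip1 s -> A e].

Definition simple_in A x y s : Prop := walk_in A x y s /\ uniq (x :: unzip2 s).

(** Restricting to the edges of [A] turns the passage time into a function of finitely many weights
    when [A] is finite. *)
Definition passage_in A w x y : R := inf [set cost w s | s in simple_in A x y].

Lemma passage_inT w x y : passage_time w x y = passage_in setT w x y.
Proof.
rewrite /passage_time /passage_in; congr inf; apply/seteqP; split=> r /=.
  move=> [[x' s] [/andP[/= ws us] [e1 e2]] <-]; rewrite /pstart /= in e1; subst x'.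
  by exists s; rewrite ?path_time_cost //; exact: uniq_walk_edges us.
move=> [s [[ws es _] us] <-]; exists (x, s).
  by split; [rewrite self_avoidingE ws|].
by rewrite path_time_cost //; exact: uniq_walk_edges us.
Qed.

Lemma walk_in_simple A x y s : walk_in A x y s ->
  exists2 s', simple_in A x y s' & subseq s' s.
Proof.
move=> [w e a]; have [s' [w' e' u' ss]] := loop_erasure w.
exists s' => //; split => //; split => //; first by rewrite e'.
by move=> f /(mem_subseq (map_subseq fst ss)); exact: a.
Qed.

Lemma passage_in_le A w x y s : (forall e, 0 <= w e) -> walk_in A x y s ->
  passage_in A w x y <= cost w s.
Proof.
move=> w0 /walk_in_simple[s' ss' sub].
apply: le_trans (cost_subseq w0 sub); apply: ge_inf; last by exists s'.
by exists 0 => _ [t _ <-]; exact: cost_ge0.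
Qed.

Lemma passage_in_ge A w x y s0 c : walk_in A x y s0 ->
  (forall s, simple_in A x y s -> c <= cost w s) -> c <= passage_in A w x y.
Proof.
move=> /walk_in_simple[s1 ss1 _] h; apply: lb_le_inf; first by exists (cost w s1), s1.
by move=> _ [s hs <-]; exact: h.
Qed.

Lemma passage_in_ge0 A w x y s0 : (forall e, 0 <= w e) -> walk_in A x y s0 ->
  0 <= passage_in A w x y.
Proof. by move=> w0 h; apply: (passage_in_ge h) => s _; exact: cost_ge0. Qed.

Lemma passage_in_comp A w w' x y s0 c : (forall e, 0 <= w' e) ->
  walk_in A x y s0 ->
  (forall s, simple_in A x y s -> exists2 s', walk_in A x y s' &
     cost w' s' <= cost w s + c) ->
  passage_in A w' x y <= passage_in A w x y + c.
Proof.
move=> w0 h0 h; rewrite -lerBlDr; apply: (passage_in_ge h0) => s /h[s' h1 h2].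
by rewrite lerBlDr; apply: le_trans h2; exact: passage_in_le.
Qed.

Lemma simple_uniq_edges A x y s : simple_in A x y s -> uniq (unzip1 s).
Proof. by move=> [[w _ _] u]; exact: uniq_walk_edges u. Qed.

Lemma passage_in_lip A w w' x y s0 (l : seq (edge G)) :
  (forall e, 0 <= w' e) -> walk_in A x y s0 ->
  (forall e, A e -> e \in l \/ w e = w' e) ->
  passage_in A w' x y <= passage_in A w x y + \sum_(e <- l) `|w' e - w e|.
Proof.
move=> w0 h0 hl; apply: (passage_in_comp w0 h0) => s ss; exists s; first by case: ss.
rewrite -lerBlDl !costE -sumrB.
apply: (@le_trans _ _ (\sum_(e <- [seq e <- unzip1 s | e \in l]) `|w' e - w e|)).
  rewrite big_filter [leRHS]big_mkcond /= big_seq [leRHS]big_seq; apply: ler_sum => e es.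
  case: ifPn => el; first exact: ler_norm.
  have [[_ _ /(_ e es)/hl[eil|->]] _] := ss; first by rewrite eil in el.
  by rewrite subrr.
apply: ler_sum_uniq => [//||e]; first by rewrite filter_uniq // (simple_uniq_edges ss).
by rewrite mem_filter => /andP[].
Qed.

Lemma passage_in_mono A w w' x y s0 : (forall e, 0 <= w e) ->
  (forall e, A e -> w e <= w' e) -> walk_in A x y s0 ->
  passage_in A w x y <= passage_in A w' x y.
Proof.
move=> w0 ww' h0; rewrite -[leRHS]addr0; apply: (passage_in_comp w0 h0) => s [wk _].
exists s => //; rewrite addr0 !costE big_seq [leRHS]big_seq; apply: ler_sum => e es.
by apply: ww'; case: wk => _ _; apply.
Qed.

Definition upd w e (t : R) : edge G -> R := fun f => if f == e then t else w f.

Lemma upd_ge0 w e t : (forall f, 0 <= w f) -> 0 <= t -> forall f, 0 <= upd w e t f.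
Proof. by move=> w0 t0 f; rewrite /upd; case: ifP. Qed.

Lemma updE w e t : upd w e t e = t.
Proof. by rewrite /upd eqxx. Qed.

Lemma upd_neq w e t f : f != e -> upd w e t f = w f.
Proof. by rewrite /upd => /negPf ->. Qed.

Lemma updC w e f t u : e != f -> upd (upd w e t) f u = upd (upd w f u) e t.
Proof.
move=> ef; apply/funext => g; rewrite /upd; case: eqP => // ->.
by rewrite eq_sym (negPf ef).
Qed.

Lemma upd_upd w e t u : upd (upd w e t) e u = upd w e u.
Proof. by apply/funext => g; rewrite /upd; case: eqP. Qed.

Lemma upd_id w e : upd w e (w e) = w.
Proof. by apply/funext => g; rewrite /upd; case: eqP => // ->. Qed.

Lemma cost_upd_notin w e t s : e \notin unzip1 s -> cost (upd w e t) s = cost w s.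
Proof.
move=> es; rewrite !costE big_seq [RHS]big_seq; apply: eq_bigr => f fs.
by apply: upd_neq; apply: contraNneq es => <-.
Qed.

Lemma cost_upd_in w e t u s : uniq (unzip1 s) -> e \in unzip1 s ->
  cost (upd w e t) s = cost (upd w e u) s + (t - u).
Proof.
move=> us es; rewrite !costE !(perm_big _ (perm_to_rem es)) !big_cons !updE.
suff -> : \sum_(j <- rem e (unzip1 s)) upd w e t j =
  \sum_(j <- rem e (unzip1 s)) upd w e u j.
  by rewrite addrAC [u + (t - u)]addrC subrK.
rewrite big_seq [RHS]big_seq; apply: eq_bigr => f.
by rewrite mem_rem_uniq // inE => /andP[fe _]; rewrite !upd_neq.
Qed.

(** A simple walk uses [e] at most once: its cost is either independent of [t] or affine in [t] with
    slope 1. The second term is the passage time at weight [M] instead of an infimum over walks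
    avoiding [e], because no such walk need exist; since [t <= M], the minimum is the same. *)
Lemma passage_in_upd A w x y s0 e t M : (forall f, 0 <= w f) ->
  walk_in A x y s0 -> 0 <= t <= M ->
  passage_in A (upd w e t) x y =
  Num.min (passage_in A (upd w e 0) x y + t) (passage_in A (upd w e M) x y).
Proof.
move=> w0 h0 /andP[t0 tM].
have M0 : 0 <= M by apply: le_trans tM.
apply/eqP; rewrite eq_le; apply/andP; split.
  rewrite le_min; apply/andP; split.
    apply: (passage_in_comp (upd_ge0 e w0 t0) h0) => s ss; exists s; first by case: ss.
    have [es|es] := boolP (e \in unzip1 s).
      by rewrite (cost_upd_in _ t 0 (simple_uniq_edges ss) es) subr0.
    by rewrite !cost_upd_notin // lerDl.
  apply: (passage_in_mono (upd_ge0 e w0 t0) _ h0) => f _.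
  by rewrite /upd; case: ifP.
apply: (passage_in_ge h0) => s ss.
have [es|es] := boolP (e \in unzip1 s).
  rewrite ge_min; apply/orP; left.
  rewrite (cost_upd_in _ t 0 (simple_uniq_edges ss) es) subr0 lerD2r.
  by apply: passage_in_le; [exact: upd_ge0|case: ss].
rewrite ge_min; apply/orP; right; rewrite cost_upd_notin //.
rewrite -(cost_upd_notin w M es).
by apply: passage_in_le; [exact: upd_ge0|case: ss].
Qed.

(* The threshold of [e]: the weight of [e] above which no optimal path uses [e],
   capped at [M]. *)
Definition threshold A x y M w e : R :=
  passage_in A (upd w e M) x y - passage_in A (upd w e 0) x y.

Lemma passage_in_threshold A w x y s0 e t M : (forall f, 0 <= w f) ->
  walk_in A x y s0 -> 0 <= t <= M ->
  passage_in A (upd w e t) x y =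
  passage_in A (upd w e 0) x y + Num.min t (threshold A x y M w e).
Proof.
move=> w0 h0 tM; rewrite (passage_in_upd e w0 h0 tM) /threshold addr_minr.
by rewrite [X in _ = Num.min _ X]addrC subrK.
Qed.

Lemma threshold_upd_self A x y M w e t :
  threshold A x y M (upd w e t) e = threshold A x y M w e.
Proof. by rewrite /threshold !upd_upd. Qed.

Lemma threshold_ge0 A x y M w e s0 : (forall f, 0 <= w f) -> 0 <= M ->
  walk_in A x y s0 -> 0 <= threshold A x y M w e.
Proof.
move=> w0 M0 h0; rewrite subr_ge0; apply: (passage_in_mono _ _ h0).
  exact: upd_ge0.
by move=> f _; rewrite /upd; case: ifP.
Qed.

(** Each of the two passage times in the threshold is Lipschitz, hence the factor 2. The weight of
    [e] is overwritten in both, so it may differ freely. *)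
Lemma threshold_lip A x y M w w' e s0 (l : seq (edge G)) :
  (forall f, 0 <= w f) -> (forall f, 0 <= w' f) -> 0 <= M ->
  walk_in A x y s0 -> (forall f, A f -> f = e \/ f \in l \/ w f = w' f) ->
  `|threshold A x y M w' e - threshold A x y M w e|
    <= 2 * \sum_(f <- l) `|w' f - w f|.
Proof.
move=> w0 w'0 M0 h0 hl.
have aux v v' t : (forall f, 0 <= v f) -> (forall f, 0 <= v' f) -> 0 <= t ->
    (forall f, A f -> f = e \/ f \in l \/ v f = v' f) ->
    passage_in A (upd v' e t) x y <= passage_in A (upd v e t) x y
      + \sum_(f <- l) `|v' f - v f|.
  move=> v0 v'0 t0 hv.
  apply: le_trans (passage_in_lip (w := upd v e t) (upd_ge0 e v'0 t0) h0 (l := l) _) _.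
    move=> f /hv[->|[->|hf]]; [by right; rewrite !updE|by left|right].
    by rewrite /upd hf; case: ifP.
  rewrite lerD2l; apply: ler_sum => f _; rewrite /upd; case: ifP => // _.
  by rewrite subrr normr0.
have hl' f : A f -> f = e \/ f \in l \/ w' f = w f.
  by move=> /hl[|[|]] h; [left|right; left|right; right].
have a1 := aux _ _ M w0 w'0 M0 hl; have a2 := aux _ _ M w'0 w0 M0 hl'.
have a3 := aux _ _ 0 w0 w'0 (lexx _) hl; have a4 := aux _ _ 0 w'0 w0 (lexx _) hl'.
have es : \sum_(f <- l) `|w f - w' f| = \sum_(f <- l) `|w' f - w f|.
  by apply: eq_bigr => f _; rewrite distrC.
rewrite es in a2 a4; rewrite /threshold ler_norml; apply/andP; split; lra.
Qed.

(* Raising one weight raises both passage times in the threshold by at most the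
   same amount, so no factor 2 is lost here. *)
Lemma threshold_lip1 A x y M w e f t u s0 : (forall g, 0 <= w g) -> 0 <= M ->
  0 <= t -> t <= u -> walk_in A x y s0 ->
  `|threshold A x y M (upd w f u) e - threshold A x y M (upd w f t) e| <= u - t.
Proof.
move=> w0 M0 t0 tu h0; have [<-|fe] := eqVneq f e.
  by rewrite !threshold_upd_self subrr normr0 subr_ge0.
have u0 : 0 <= u by exact: le_trans tu.
have aux v : (forall g, 0 <= v g) ->
    passage_in A (upd v f t) x y <= passage_in A (upd v f u) x y
      <= passage_in A (upd v f t) x y + (u - t).
  move=> v0.
  have tuu : 0 <= t <= u by rewrite t0.
  rewrite (passage_in_upd f v0 h0 tuu).
  have uuu : 0 <= u <= u by rewrite u0 lexx.
  set p0 := passage_in A (upd v f 0) x y; set pu := passage_in A (upd v f u) x y.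
  have pu0 : pu <= p0 + u by rewrite /pu (passage_in_upd f v0 h0 uuu) ge_min lexx.
  by rewrite ge_min lexx orbT /= addr_minl le_min; apply/andP; split; lra.
have := aux _ (upd_ge0 e w0 M0); have := aux _ (upd_ge0 e w0 (lexx 0)).
rewrite /threshold ![upd (upd w f _) e _]updC // ler_norml.
by move=> /andP[? ?] /andP[? ?]; apply/andP; split; lra.
Qed.

End PassageTimes.

(** * A configuration with its threshold in a window *)

(** The section contexts below are large; hypotheses other than facts on natural numbers of the
    listed shapes are cleared before [lia] runs. *)
Ltac nlia :=
  repeat match goal with H : ?P |- _ =>
    lazymatch P with
    | nat => fail
    | is_true (leq _ _) => fail
    | is_true (andb (leq _ _) (leq _ _)) => fail
    | is_true (negb (@eq_op _ _ _)) => fail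
    | is_true (negb (leq _ _)) => fail
    | is_true (andb (leq _ _) (leq _ _)) -> is_true (leq _ _) => fail
    | @eq nat _ _ => fail
    | or (is_true (leq _ _)) (is_true (leq _ _)) => fail
    | _ => clear H
    end
  end; lia.

Section Potential.
Variables (R : realType) (G : graph).

(** The increments of [u] telescope along the walk. The edges of [Q] may violate the bound by [k],
    each time they are used. *)
Lemma potential_le (u : vertex G -> R) (w : edge G -> R) (k : R) (Q : seq (edge G))
    x s : is_walk x s ->
  (forall f v v', f \in unzip1 s -> bnd f = [fset v; v']%fset ->
    u v' - u v <= w f + k * (f \in Q)%:R) ->
  u (wend x s) - u x <= cost w s + k * (count (mem Q) (unzip1 s))%:R.
Proof.
elim: s x => [|[e y] s ih] x /=; first by rewrite /cost big_nil subrr mulr0 addr0.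
move=> /andP[/eqP be ws] h.
have h1 := h e x y (mem_head _ _) be.
have := ih y ws (fun f v v' fs => h f v v' (mem_behead (s := e :: unzip1 s) fs)).
rewrite /wend /= -/(wend y s) {2}/cost big_cons /= -/(cost w s) natrD mulrDr.
set q := k * _ in h1; set q' := k * (count _ _)%:R.
rewrite -/q; move: h1; move: (u (wend y s)) (u y) (u x) (cost w s) => a b c d; lra.
Qed.

End Potential.

(** * Rerouting paths along the ridge of one block *)

Section Block.
Variables (R : realType) (G : graph).
Hypothesis conn : connected_graph G.
Variable R0 : nat.
Hypothesis HB : forall x z y : vertex G, (dist x z + dist z y = dist x y)%N ->
  forall s, is_walk x s -> wend x s = y ->
  exists2 v, v \in x :: unzip2 s & (dist z v <= R0)%N.
Variables (x y : vertex G) (A : set (edge G)).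
Variables (r : nat -> vertex G) (re : nat -> edge G) (n L L' : nat).
Hypothesis hre : forall j, (j < n)%N -> bnd (re j) = [fset r j; r j.+1]%fset.
Hypothesis hgeo : (dist x (r 0) + n + dist (r n) y = dist x y)%N.
Variable Lam : {fset edge G}.
Hypothesis hLam : forall f, reflect (exists2 v, v \in bnd f & (dist (r 0) v <= L')%N)
  (f \in Lam).
Hypothesis LamA : forall f, f \in Lam -> A f.
Hypotheses (hL : (2 * R0 < L)%N) (hn : (2 * L < n)%N) (hL' : (2 * n + R0 < L')%N).

Definition rseg i m : seq (edge G * vertex G) :=
  [seq (re k, r k.+1) | k <- iota i m].

Lemma rseg_walk i m : (i + m <= n)%N -> is_walk (r i) (rseg i m).
Proof.
elim: m i => [|m ih] i //= h; rewrite hre; last by nlia.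
by rewrite eqxx ih //; nlia.
Qed.

Lemma rseg_end i m : wend (r i) (rseg i m) = r (i + m)%N.
Proof.
elim: m i => [|m ih] i /=; first by rewrite addn0.
by rewrite /wend /= -/(wend _ _) ih addSnnS.
Qed.

Lemma rseg_edges i m : unzip1 (rseg i m) = [seq re k | k <- iota i m].
Proof. by rewrite /unzip1 /rseg -map_comp. Qed.

Lemma size_rseg i m : size (rseg i m) = m.
Proof. by rewrite size_map size_iota. Qed.

Lemma rdist_le i j : (i <= j <= n)%N -> (dist (r i) (r j) <= j - i)%N.
Proof.
move=> /andP[ij jn]; rewrite -[(j - i)%N](size_rseg i).
by apply: dist_le; [exact: conn|apply: rseg_walk; nlia|rewrite rseg_end subnKC].
Qed.

Lemma rgeo i j : (i <= j <= n)%N -> [/\ dist (r i) (r j) = (j - i)%N,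
  dist x (r j) = (dist x (r 0) + j)%N & dist (r j) y = (n - j + dist (r n) y)%N].
Proof.
move=> /andP[ij jn].
have h0i := @rdist_le 0 i; have hij := @rdist_le i j; have hjn := @rdist_le j n.
have h0j := @rdist_le 0 j.
have t1 := dist_triangle conn (r i) x y; have t2 := dist_triangle conn (r j) (r i) y.
have t3 := dist_triangle conn (r 0) x (r i); have t4 := dist_triangle conn (r n) (r j) y.
have t5 := dist_triangle conn (r 0) x (r j); have t6 := dist_triangle conn (r j) x y.
by split; nlia.
Qed.

Lemma rdist i j : (i <= j <= n)%N -> dist (r i) (r j) = (j - i)%N.
Proof. by case/rgeo. Qed.

Lemma r_inj i j : (i <= n)%N -> (j <= n)%N -> r i = r j -> i = j.
Proof.
move=> hi hj e; have := distxx conn (r i).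
case: (leqP i j) => ij.
  by rewrite {2}e rdist ?ij //; nlia.
by rewrite {1}e rdist ?(ltnW ij) //; nlia.
Qed.

Lemma edge_ends (f : edge G) (v v' : vertex G) : bnd f = [fset v; v']%fset ->
  v \in bnd f /\ v' \in bnd f /\ (dist v v' <= 1)%N /\ (dist v' v <= 1)%N.
Proof.
move=> bf; have h := dist_edge conn bf; rewrite (dist_sym conn v') bf !inE !eqxx orbT.
by [].
Qed.

Lemma notLam f v : f \notin Lam -> v \in bnd f -> (L' < dist (r 0) v)%N.
Proof. by move=> /hLam h vf; rewrite ltnNge; apply/negP => k; apply: h; exists v. Qed.

Variables (al be : R).
Hypotheses (al0 : 0 <= al) (albe : al < be).
Let be0 : 0 < be. Proof. by apply: le_lt_trans albe. Qed.

(** The cap makes this potential constant along edges outside [Lam], whose weights are only known to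
    be nonnegative. *)
Definition trunc_dist (o v : vertex G) : R := (minn (dist o v) n)%:R.

Lemma trunc_dist_edge o f v v' : bnd f = [fset v; v']%fset ->
  trunc_dist o v' - trunc_dist o v <= 1.
Proof.
move=> bf; have [_ [_ [h _]]] := edge_ends bf; rewrite /trunc_dist lerBlDr.
rewrite -[1]/(1%:R) -natrD ler_nat; have := dist_triangle conn v o v'; nlia.
Qed.

Lemma trunc_dist_far o f v v' : (dist (r 0) o <= n + R0)%N ->
  f \notin Lam -> bnd f = [fset v; v']%fset -> trunc_dist o v' = trunc_dist o v.
Proof.
move=> ho fL bf; have [h1 [h2 _]] := edge_ends bf.
have := notLam fL h1; have := notLam fL h2.
have := dist_triangle conn o (r 0) v; have := dist_triangle conn o (r 0) v'.
by move=> *; rewrite /trunc_dist !(minn_idPr _) //; nlia.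
Qed.

Section Weights.
Variable w : edge G -> R.
Hypothesis w0 : forall f, 0 <= w f.

Lemma cost_far (m : R) (Q : seq (edge G)) (o : vertex G) s : 0 <= m ->
  is_walk o s -> (dist (r 0) o <= n + R0)%N ->
  (forall f, f \in unzip1 s -> f \in Lam -> (f \in Q) || (m <= w f)) ->
  m * trunc_dist o (wend o s) <= cost w s + m * (count (mem Q) (unzip1 s))%:R.
Proof.
move=> m0 ws ho h.
have -> : m * trunc_dist o (wend o s) =
    m * trunc_dist o (wend o s) - m * trunc_dist o o.
  by rewrite /trunc_dist (distxx conn) min0n mulr0 subr0.
apply: (@potential_le R G (fun v => m * trunc_dist o v)) => // f v v' fs bf.
rewrite -mulrBr; have [fL|fL] := boolP (f \in Lam); last first.
  by rewrite (trunc_dist_far ho fL bf) subrr mulr0 addr_ge0 // mulr_ge0.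
have le1 := trunc_dist_edge o bf.
have h1 : m * (trunc_dist o v' - trunc_dist o v) <= m.
  by rewrite -[leRHS]mulr1 ler_wpM2l.
apply: (le_trans h1); have /orP[->|mw] := h f fs fL.
  by rewrite mulr1 lerDr.
by apply: (le_trans mw); rewrite lerDl mulr_ge0.
Qed.

Variables (Q : seq (edge G)) (K : nat).
Hypotheses (wLam : forall f, f \in Lam -> al <= w f <= be)
  (wre : forall j, (j < n)%N -> w (re j) = al)
  (wbe : forall f, f \in Lam -> (forall j, (j < n)%N -> f != re j) ->
     (f \in Q) || (w f == be))
  (hKL : be * (4 * R0 + K + 1)%:R <= (be - al) * L%:R).

Lemma cost_geodesic (o v : vertex G) : (dist (r 0) o <= n + R0)%N ->
  (dist o v <= R0)%N ->
  exists s, [/\ is_walk o s, wend o s = v, forall f, f \in unzip1 s -> f \in Lam,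
    cost w s <= be * R0%:R &
    forall z, z \in o :: unzip2 s -> (dist o z <= R0)%N /\ (dist v z <= R0)%N].
Proof.
move=> ho ov; have [s [ws es us sz]] := dist_path conn o v.
have hz z : z \in o :: unzip2 s -> (dist o z <= R0)%N /\ (dist v z <= R0)%N.
  by move=> /(geodesic_between conn ws es sz); rewrite (dist_sym conn v z); nlia.
have sL f : f \in unzip1 s -> f \in Lam.
  move=> fs; have [a [b bf]] := bnd2 f; have [af _] := edge_ends bf.
  apply/hLam; exists a => //; have [h _] := hz a (bnd_mem ws fs af).
  by have := dist_triangle conn o (r 0) a; nlia.
exists s; split => //.
rewrite costE (@le_trans _ _ (\sum_(f <- unzip1 s) be)) //.
  rewrite big_seq [leRHS]big_seq; apply: ler_sum => f /sL/wLam/andP[] //.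
rewrite big_const_seq count_predT iter_addr_0 size_map sz.
by rewrite -[leLHS]mulr_natr ler_wpM2l ?ler_nat // ltW.
Qed.

Definition on_ridge : pred (vertex G) := fun v => has (fun j => r j == v) (iota 0 n.+1).

Lemma on_ridgeP v : reflect (exists2 j, (j <= n)%N & v = r j) (on_ridge v).
Proof.
apply: (iffP hasP) => [[j]|[j jn ->]]; last by exists j; rewrite // mem_iota; nlia.
by rewrite mem_iota => jn /eqP <-; exists j => //; nlia.
Qed.

(** A ridge edge has two distinct ridge vertices as its ends, so a walk with at most one ridge
    vertex contains no ridge edge. *)
Lemma off_ridge_edge a s f : is_walk a s -> f \in unzip1 s ->
  (forall v, v \in a :: unzip2 s -> on_ridge v -> forall v', v' \in a :: unzip2 s ->
     on_ridge v' -> v = v') -> forall j, (j < n)%N -> f != re j.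
Proof.
move=> ws fs h j jn; apply/eqP => fj.
have [v0 [v1 _]] := edge_ends (hre jn); rewrite -fj in v0 v1.
have m0 := bnd_mem ws fs v0; have m1 := bnd_mem ws fs v1.
have o0 : on_ridge (r j) by apply/on_ridgeP; exists j; rewrite // ltnW.
have o1 : on_ridge (r j.+1) by apply/on_ridgeP; exists j.+1.
have := h _ m0 o0 _ m1 o1.
by move=> /(r_inj (ltnW jn) jn)/eqP; rewrite (ltn_eqF (ltnSn j)).
Qed.

(** The middle of [s] can be replaced by a stretch of the ridge that covers its whole central part,
    with a saving of at least [g]. As [s1] and [s3] avoid the central ridge edges, later changes to
    those edges only affect the stretch. *)
Definition reroute (s : seq (edge G * vertex G)) (g : R) : Prop :=
  exists p q s1 s3, [/\ (p <= L)%N, (n - L <= q <= n)%N,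
    walk_in A x (r p) s1 /\ walk_in A (r q) y s3,
    (forall k, (L <= k < n - L)%N -> re k \notin unzip1 s1 /\ re k \notin unzip1 s3) &
    cost w s1 + al * (q%:R - p%:R) + cost w s3 + g <= cost w s].

(* By the bottleneck property [s] comes close to both ends of the ridge [r], and
   does not use its middle edges before or after doing so.  A middle part that
   leaves the ridge pays [be] per step there, which exceeds the cost of going
   to the ridge and following it. *)
Lemma surgery s g : simple_in A x y s -> (count (mem Q) (unzip1 s) <= K)%N ->
  0 <= g -> g <= be - al ->
  (forall p q b, (p <= L)%N -> (n - L <= q <= n)%N -> is_walk (r p) b ->
     wend (r p) b = r q -> {subset unzip1 b <= unzip1 s} ->
     al * (q%:R - p%:R) + g <= cost w b) ->
  reroute s g.
Proof.
move=> [[ws es sA] us] sK g0 gba hmid; set goal := reroute s g.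
have n0 : (0 <= n <= n)%N by rewrite leqnn.
have [d0n hxn hny] := rgeo n0; have [_ hx0 h0y] := @rgeo 0 0 isT.
(* [s] is cut into [a], [b], [c]: [a] stops at the first vertex within [R0] of [r 0], and [c] starts
   at the last vertex of the remainder within [R0] of [r n]. *)
have [a [b' [eab sR aR]]] : exists s1 s2, [/\ s = s1 ++ s2,
    (dist (r 0) (wend x s1) <= R0)%N &
    forall v, v \in belast x (unzip2 s1) -> ~~ (dist (r 0) v <= R0)%N].
  apply: (@first_hit G (fun v => (dist (r 0) v <= R0)%N)); apply/hasP.
  by have [|v vs hv] := @HB x (r 0) y _ s ws es; [nlia|exists v].
set si := wend x a in sR.
move: (ws); rewrite eab is_walk_cat -/si => /andP[wa wb'].
have eb' : wend si b' = y by rewrite -es eab wend_cat.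
have [b [c [ebc tR cR]]] : exists s1 s2, [/\ b' = s1 ++ s2,
    (dist (r n) (wend si s1) <= R0)%N &
    forall v, v \in unzip2 s2 -> ~~ (dist (r n) v <= R0)%N].
  apply: (@last_hit G (fun v => (dist (r n) v <= R0)%N)); apply/hasP.
  (* The remainder is prolonged backwards to [r 0] by a short geodesic, so that the bottleneck
     property applies between [r 0] and [y]; the vertex it yields near [r n] is too far from [r 0]
     to lie on the geodesic. *)
  have [g1 [wg1 eg1 _ sg1]] := dist_path conn (r 0) si.
  have wgb : is_walk (r 0) (g1 ++ b') by rewrite is_walk_cat wg1 eg1.
  have egb : wend (r 0) (g1 ++ b') = y by rewrite wend_cat eg1.
  have [|v vs hv] := @HB (r 0) (r n) y _ (g1 ++ b') wgb egb; first by nlia.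
  exists v => //; move: vs; rewrite verts_cat eg1 mem_cat => /orP[vg|//].
  have := geodesic_between conn wg1 eg1 sg1 _ => /(_ v).
  rewrite lastI mem_rcons inE vg orbT => /(_ isT).
  by have := dist_triangle conn v (r 0) (r n); rewrite (dist_sym conn v); nlia.
set t := wend si b in tR.
move: (wb'); rewrite ebc is_walk_cat -/t => /andP[wb wc].
have ec : wend t c = y by rewrite -eb' ebc wend_cat.
have es3 : unzip1 s = unzip1 a ++ unzip1 b ++ unzip1 c.
  by rewrite eab ebc /unzip1 !map_cat.
have aA f : f \in unzip1 a -> A f by move=> fa; apply: sA; rewrite es3 mem_cat fa.
have cA f : f \in unzip1 c -> A f.
  by move=> fa; apply: sA; rewrite es3 !mem_cat fa !orbT.
have costs : cost w s = cost w a + cost w b + cost w c.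
  by rewrite eab ebc !cost_cat addrA.
(* A visit of [a] to [r k] would be preceded by one near [r 0], whereas [a] comes near [r 0] only at
   its end. *)
have a_re k : (L <= k < n - L)%N -> re k \notin unzip1 a.
  move=> hk; apply/negP => ka; have kn : (k < n)%N by nlia.
  have [h1 _] := edge_ends (hre kn).
  have [a1 [a2 [ea ek]]] := split_at (bnd_mem wa ka h1).
  have wa1 : is_walk x a1 by move: wa; rewrite ea is_walk_cat => /andP[].
  have k0 : (0 <= k <= n)%N by nlia.
  have [dk hxk _] := rgeo k0.
  have [|v] := @HB x (r 0) (r k) _ a1 wa1 ek; first by nlia.
  rewrite lastI mem_rcons inE -/(wend _ _) ek => /orP[/eqP ->|vb] hv; first by nlia.
  have := aR v; rewrite ea /unzip2 map_cat belast_cat mem_cat vb => /(_ isT).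
  by rewrite hv.
have c_re k : (L <= k < n - L)%N -> re k \notin unzip1 c.
  move=> hk; apply/negP => ka; have kn : (k < n)%N by nlia.
  have [h1 _] := edge_ends (hre kn).
  have kk : (k <= n <= n)%N by nlia.
  have [dk _ hny'] := rgeo kk; have k0 : (k <= k <= n)%N by nlia.
  have [_ _ hky] := rgeo k0.
  have [c1 [c2 [ecc ek]]] := split_at (bnd_mem wc ka h1).
  have wc2 : is_walk (r k) c2 by move: wc; rewrite ecc is_walk_cat ek => /andP[].
  have ec2 : wend (r k) c2 = y by rewrite -ek -wend_cat -ecc.
  have [|v] := @HB (r k) (r n) y _ c2 wc2 ec2; first by nlia.
  rewrite inE => /orP[/eqP ->|vb] hv.
    by move: hv; rewrite (dist_sym conn); nlia.
  by have := cR v; rewrite ecc /unzip2 map_cat mem_cat vb orbT hv => /(_ isT).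
have si_n : (dist (r 0) si <= n + R0)%N by nlia.
have rn_n : (dist (r 0) (r n) <= n + R0)%N by nlia.
(* An expensive [b] is replaced by the whole ridge with a geodesic connector of cost at most
   [be * R0] at each end. *)
have cand1 : al * n%:R + be * (2 * R0)%:R + g <= cost w b -> reroute s g.
  move=> hb.
  have [|s1 [w1 e1 L1 c1 z1]] := @cost_geodesic si (r 0) si_n.
    by rewrite (dist_sym conn).
  have [|s3 [w3 e3 L3 c3 z3]] := @cost_geodesic (r n) t rn_n; first by [].
  exists 0%N, n, (a ++ s1), (s3 ++ c); split => //; first by nlia.
  - split; split; rewrite ?is_walk_cat ?wa ?w3 ?e3 ?wend_cat -/si ?w1 ?e1 ?e3 //.
      by move=> f; rewrite /unzip1 map_cat mem_cat => /orP[/aA|/L1/LamA].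
    by move=> f; rewrite /unzip1 map_cat mem_cat => /orP[/L3/LamA|/cA].
  - move=> k hk; have kn : (k < n)%N by nlia.
    have [h1 _] := edge_ends (hre kn).
    split; rewrite /unzip1 map_cat mem_cat negb_or ?a_re ?c_re ?andbT //=.
      apply/negP => /(bnd_mem w1)/(_ h1)/z1[_]; rewrite rdist; nlia.
    apply/negP => /(bnd_mem w3)/(_ h1)/z3[]; rewrite (dist_sym conn) rdist; nlia.
  rewrite !cost_cat costs subr0; move: hb; rewrite natrM; lra.
have gbe : g <= be by apply: (le_trans gba); rewrite gerBl.
have cQ (s1 : seq (edge G * vertex G)) : (exists s2 s3, unzip1 s = s2 ++ unzip1 s1 ++ s3) ->
    (count (mem Q) (unzip1 s1))%:R <= K%:R :> R.
  by move=> [s2 [s3' e]]; rewrite ler_nat (leq_trans _ sK) // e !count_cat; nlia.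
have slack (m : nat) : (L <= m)%N ->
    be * (4 * R0 + K + 1)%:R <= (be - al) * m%:R.
  move=> Lm; apply: (le_trans hKL); rewrite ler_wpM2l ?ler_nat //.
  by rewrite subr_ge0 ltW.
have st_n : (n - 2 * R0 <= dist si t)%N.
  have := dist_triangle conn si (r 0) t; have := dist_triangle conn t (r 0) (r n).
  by rewrite (dist_sym conn t (r n)); nlia.
have [touch|notouch] := boolP (has on_ridge (si :: unzip2 b)); last first.
  (* [b] avoids the ridge and pays [be] per unit of distance, except on at most [K] edges. In
     [4 * R0 + K + 1], the connectors take [2 * R0], the distance from [si] to [t] may fall short of
     [n] by [2 * R0], and the last unit pays for [g]. *)
  apply: cand1.
  have := @cost_far be Q si b (ltW be0) wb si_n.
  have hQ f : f \in unzip1 b -> f \in Lam -> (f \in Q) || (be <= w f).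
    move=> fb fL; have := wbe fL; case: (f \in Q) => //= h.
    rewrite (eqP (h _)) //; apply: off_ridge_edge wb fb _ => v vb vr.
    by move/hasPn: notouch => /(_ v vb); rewrite vr.
  move=> /(_ hQ); rewrite -/t.
  have h1 : (n - 2 * R0)%:R <= trunc_dist si t by rewrite ler_nat; nlia.
  have h2 : (count (mem Q) (unzip1 b))%:R <= K%:R :> R.
    by apply: cQ; exists (unzip1 a), (unzip1 c).
  have h3 := slack n; move: h3; have -> : (L <= n)%N by nlia.
  move=> /(_ isT); move: h1; rewrite natrB; last by nlia.
  rewrite !(natrM, natrD) => h1 h3 h4.
  have h5 := ler_wpM2l (ltW be0) h1; have h6 := ler_wpM2l (ltW be0) h2.
  rewrite !(mulrDr, mulrBr, mulrDl, mulrBl) in h3 h5 *; rewrite !mulr1 in h3 *; lra.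
have [b1 [b23 [eb1 b1r b1n]]] := first_hit touch.
have /on_ridgeP[p pn ep] := b1r.
move: (wb); rewrite eb1 is_walk_cat ep => /andP[wb1 wb23].
have eb23 : wend (r p) b23 = t by rewrite -ep -wend_cat -eb1.
have touch2 : has on_ridge (r p :: unzip2 b23).
  by apply/hasP; exists (r p); rewrite ?mem_head //; apply/on_ridgeP; exists p.
have [b2 [b3 [eb2 b2r b3n]]] := last_hit touch2.
have /on_ridgeP[q qn eq] := b2r.
move: (wb23); rewrite eb2 is_walk_cat eq => /andP[wb2 wb3].
have eb3 : wend (r q) b3 = t by rewrite -eq -wend_cat -eb2.
have e123 : unzip1 s = unzip1 a ++ unzip1 b1 ++ unzip1 b2 ++ unzip1 b3 ++ unzip1 c.
  by rewrite es3 eb1 eb2 /unzip1 !map_cat !catA.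
have b1_re f : f \in unzip1 b1 -> forall j, (j < n)%N -> f != re j.
  move=> fb; apply: off_ridge_edge wb1 fb _ => v + vr v' + v'r.
  rewrite !lastI !mem_rcons !inE => /orP[/eqP->|/b1n]; last by rewrite vr.
  by move=> /orP[/eqP->//|/b1n]; rewrite v'r.
have b3_re f : f \in unzip1 b3 -> forall j, (j < n)%N -> f != re j.
  move=> fb; apply: off_ridge_edge wb3 fb _ => v + vr v' + v'r.
  rewrite !inE => /orP[/eqP->|/b3n]; last by rewrite vr.
  by move=> /orP[/eqP->//|/b3n]; rewrite v'r.
have costb : cost w b = cost w b1 + cost w b2 + cost w b3.
  by rewrite eb1 eb2 !cost_cat addrA.
have farQ (b0 : seq (edge G * vertex G)) : (forall f, f \in unzip1 b0 -> forall j, (j < n)%N -> f != re j) ->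
    forall f, f \in unzip1 b0 -> f \in Lam -> (f \in Q) || (be <= w f).
  move=> h f fb fL; have := wbe fL; case: (f \in Q) => //= h'.
  by rewrite (eqP (h' _)) //; exact: h.
have farA (b0 : seq (edge G * vertex G)) : forall f, f \in unzip1 b0 -> f \in Lam -> (f \in [::]) || (al <= w f).
  by move=> f _ /wLam /andP[].
have count0 (l : seq (edge G)) : count (mem [::]) l = 0%N.
  by apply/eqP; rewrite -leqn0 leqNgt -has_count; apply/hasPn.
have p0 : (0 <= p <= n)%N by []. have [d0p _ _] := rgeo p0.
have q0 : (0 <= q <= n)%N by []. have [d0q _ _] := rgeo q0.
have pp : (p <= n <= n)%N by rewrite pn leqnn. have [dpn _ _] := rgeo pp.
have qq : (q <= n <= n)%N by rewrite qn leqnn. have [dqn _ _] := rgeo qq.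
have rp_n : (dist (r 0) (r p) <= n + R0)%N by nlia.
have rq_n : (dist (r 0) (r q) <= n + R0)%N by nlia.
have [pL|pL] := leqP p L; last first.
  (* [b] reaches the ridge only beyond position [L]: its approach pays [be] instead of [al] for more
     than [L - R0] units, and the rest pays at least [al] per unit. *)
  apply: cand1.
  have H1 := @cost_far be Q si b1 (ltW be0) wb1 si_n (farQ _ b1_re).
  have H2 := @cost_far al [::] (r p) b23 al0 wb23 rp_n (farA _).
  rewrite count0 mulr0 addr0 eb23 in H2; rewrite ep in H1.
  have h1 : (p - R0)%:R <= trunc_dist si (r p).
    rewrite ler_nat; have := dist_triangle conn si (r 0) (r p); nlia.
  have h2 : (count (mem Q) (unzip1 b1))%:R <= K%:R :> R.
    by apply: cQ; exists (unzip1 a), (unzip1 b2 ++ unzip1 b3 ++ unzip1 c).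
  have h7 : n%:R - p%:R - R0%:R <= trunc_dist (r p) t.
    rewrite -natrB // lerBlDr -natrD ler_nat.
    have := dist_triangle conn t (r p) (r n).
    by rewrite (dist_sym conn t (r n)); nlia.
  have h3 := slack p (ltnW pL); move: h1; rewrite natrB; last by nlia.
  move: h3; rewrite !(natrM, natrD) => h3 h1.
  have h5 := ler_wpM2l (ltW be0) h1; have h6 := ler_wpM2l (ltW be0) h2.
  have h8 := ler_wpM2l al0 h7.
  have h9 : al * R0%:R <= be * R0%:R by rewrite ler_wpM2r // ltW.
  have h10 : cost w b = cost w b1 + cost w b23 by rewrite eb1 cost_cat.
  rewrite h10; rewrite !(mulrDr, mulrBr, mulrDl, mulrBl) in h3 h5 h8 *.
  rewrite !mulr1 in h3 *; lra.
have [qL|qL] := ltnP q (n - L).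
  (* The same estimate at the other end, where [b] leaves the ridge before position [n - L]. *)
  apply: cand1.
  have H1 := @cost_far be Q (r q) b3 (ltW be0) wb3 rq_n (farQ _ b3_re).
  have wb12 : is_walk si (b1 ++ b2) by rewrite is_walk_cat wb1 ep wb2.
  have H2 := @cost_far al [::] si _ al0 wb12 si_n (farA _).
  rewrite count0 mulr0 addr0 wend_cat ep eq in H2; rewrite eb3 in H1.
  have h1 : n%:R - q%:R - R0%:R <= trunc_dist (r q) t.
    rewrite -natrB // lerBlDr -natrD ler_nat.
    have := dist_triangle conn t (r q) (r n).
    by rewrite (dist_sym conn t (r n)); nlia.
  have h2 : (count (mem Q) (unzip1 b3))%:R <= K%:R :> R.
    by apply: cQ; exists (unzip1 a ++ unzip1 b1 ++ unzip1 b2), (unzip1 c); rewrite e123 !catA.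
  have h7 : q%:R - R0%:R <= trunc_dist si (r q).
    rewrite lerBlDr -natrD ler_nat.
    have := dist_triangle conn si (r 0) (r q); nlia.
  have h3 : be * (4 * R0 + K + 1)%:R <= (be - al) * (n - q)%:R by apply: slack; nlia.
  move: h3; rewrite natrB // !(natrM, natrD) => h3.
  have h5 := ler_wpM2l (ltW be0) h1; have h6 := ler_wpM2l (ltW be0) h2.
  have h8 := ler_wpM2l al0 h7.
  have h9 : al * R0%:R <= be * R0%:R by rewrite ler_wpM2r // ltW.
  have h10 : cost w b = cost w (b1 ++ b2) + cost w b3 by rewrite costb cost_cat.
  rewrite h10; rewrite !(mulrDr, mulrBr, mulrDl, mulrBl) in h3 h5 h8 *.
  rewrite !mulr1 in h3 *; lra.
(* Both contacts lie in the margins, so only the part between them is replaced, and the saving comes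
   from the hypothesis on such parts. *)
rewrite /goal; exists p, q, (a ++ b1), (b3 ++ c); split => //; first by rewrite qL.
- split; split; rewrite ?is_walk_cat ?wa ?wb3 ?eb3 ?wend_cat -/si ?wb1 ?ep ?eb3 //.
    move=> f; rewrite /unzip1 map_cat mem_cat => /orP[/aA//|fb].
    by apply: sA; rewrite e123 !mem_cat -/(unzip1 b1) fb orbT.
  move=> f; rewrite /unzip1 map_cat mem_cat => /orP[fb|/cA//].
  by apply: sA; rewrite e123 !mem_cat -/(unzip1 b3) fb !orbT.
- move=> k hk; have kn : (k < n)%N by nlia.
  split; rewrite /unzip1 map_cat mem_cat negb_or ?a_re ?c_re ?andbT //=.
    by apply/negP => /b1_re/(_ k kn); rewrite eqxx.
  by apply/negP => /b3_re/(_ k kn); rewrite eqxx.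
have := hmid p q b2 pL _ wb2 eq; rewrite qL qn => /(_ isT) hm.
have hh : {subset unzip1 b2 <= unzip1 s}.
  by move=> f fb; rewrite e123 !mem_cat fb !orbT.
move: (hm hh); rewrite !cost_cat costs costb; lra.
Qed.

End Weights.

Variable s0 : seq (edge G * vertex G).
Hypothesis hs0 : walk_in A x y s0.

Lemma rseg_Lam j : (j < n)%N -> re j \in Lam.
Proof.
move=> jn; have [h _] := edge_ends (hre jn); apply/hLam; exists (r j) => //.
by rewrite rdist; nlia.
Qed.

Lemma re_inj i j : (i < n)%N -> (j < n)%N -> re i = re j -> i = j.
Proof.
move=> hi hj e.
have [ei [ei' _]] := edge_ends (hre hi); rewrite e hre // !inE in ei ei'.
have c a b : (a <= n)%N -> (b <= n)%N -> (r a == r b) = (a == b).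
  by move=> ha hb; apply/eqP/eqP => [/r_inj->//|->].
by move: ei ei'; rewrite !c; nlia.
Qed.

Lemma rseg_in i m : (i + m <= n)%N -> forall f, f \in unzip1 (rseg i m) -> A f.
Proof.
move=> h f; rewrite rseg_edges => /mapP[j]; rewrite mem_iota => hj ->.
by apply/LamA/rseg_Lam; nlia.
Qed.

Lemma cost_rseg (w : edge G -> R) i m : (forall j, (i <= j < i + m)%N -> w (re j) = al) ->
  cost w (rseg i m) = al * m%:R.
Proof.
move=> h; rewrite /cost big_map big_seq (eq_bigr (fun=> al)).
  by rewrite -big_seq big_const_seq count_predT iter_addr_0 size_iota mulr_natr.
by move=> j; rewrite mem_iota => /h.
Qed.

Lemma rseg_uniq i m : (i + m <= n)%N -> uniq (unzip1 (rseg i m)).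
Proof.
move=> h; rewrite rseg_edges map_inj_in_uniq ?iota_uniq // => j k.
by rewrite !mem_iota => hj hk; apply: re_inj; nlia.
Qed.

(** A path that avoids [e] is rerouted through [e] with a saving of [be - al]; lowering the weight
    of [e] from [al] to 0 saves another [al]. A path that uses [e] drops by [M], which is at least
    [be]. *)
Lemma ridge_threshold (w : edge G -> R) M i0 : (forall f, 0 <= w f) ->
  (forall f, f \in Lam -> al <= w f <= be) ->
  (forall j, (j < n)%N -> w (re j) = al) ->
  (forall f, f \in Lam -> (forall j, (j < n)%N -> f != re j) -> w f = be) ->
  be * (4 * R0 + 1)%:R <= (be - al) * L%:R -> be <= M ->
  (L <= i0 < n - L)%N -> be <= threshold A x y M w (re i0).
Proof.
move=> w0 wLam wre wbe hKL beM hi0; set e := re i0.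
have i0n : (i0 < n)%N by nlia.
have wi0 : w e = al by exact: wre.
rewrite /threshold lerBrDr; apply: (passage_in_ge hs0) => s ss.
have [es|es] := boolP (e \in unzip1 s).
  rewrite (cost_upd_in w M 0 (simple_uniq_edges ss) es) subr0 addrC lerD //.
  by apply: (passage_in_le (upd_ge0 e w0 (lexx _))); case: ss.
rewrite cost_upd_notin //.
have count0 (l : seq (edge G)) : (count (mem [::]) l <= 0)%N.
  by rewrite leqNgt -has_count; apply/hasPn.
have gba : 0 <= be - al by rewrite subr_ge0 ltW.
have wbe' f : f \in Lam -> (forall j, (j < n)%N -> f != re j) ->
    (f \in [::]) || (w f == be).
  by move=> fL fre; apply/orP; right; apply/eqP; exact: wbe.
have hKL' : be * (4 * R0 + 0 + 1)%:R <= (be - al) * L%:R by rewrite addn0.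
have [|p [q [s1 [s3 [pL hq [w1 w3] sre hc]]]]] :=
    surgery w0 wLam wbe' hKL' ss (count0 _) gba (lexx _).
  move=> p q b pL hq wb eb sub.
  (* Indicator of the ridge vertices beyond [e]. Other ridge edges do not change it, and an edge of
     [Lam] off the ridge has weight [be], which pays both one unit of distance at rate [al] and a
     jump of [be - al]. *)
  pose right v := has (fun j => r j == v) (iota i0.+1 (n - i0)).
  have rightE j : (j <= n)%N -> right (r j) = (i0 < j)%N.
    move=> jn; apply/hasP/idP => [[k]|h].
      by rewrite mem_iota => hk /eqP/r_inj; nlia.
    by exists j; rewrite ?mem_iota //; nlia.
  have right_le v : right v -> (dist (r 0) v <= n)%N.
    by move=> /hasP[k]; rewrite mem_iota => hk /eqP <-; rewrite rdist; nlia.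
  (* The jump of [u] across [e] is only available to paths using [e]. *)
  pose u v := al * trunc_dist (r 0) v + (be - al) * (right v)%:R.
  suff : u (wend (r p) b) - u (r p) <= cost w b.
    rewrite eb /u !rightE; [|nlia..].
    rewrite (_ : (i0 < p)%N = false); last by nlia.
    rewrite (_ : (i0 < q)%N = true); last by nlia.
    rewrite /trunc_dist !rdist ?subn0; [|nlia..].
    rewrite !(minn_idPl _); [|nlia..].
    by rewrite mulr1 mulr0 addr0 mulrBr; lra.
  have := @potential_le R G u w 0 [::] (r p) b wb; rewrite mul0r addr0.
  apply => f v v' fb bf; rewrite mul0r addr0 /u.
  have fe : f != e by apply: contra es => /eqP <-; exact: sub.
  have [v1 [v2 _]] := edge_ends bf.
  have [fL|fL] := boolP (f \in Lam); last first.
    have f0 : (dist (r 0) (r 0) <= n + R0)%N by rewrite distxx.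
    rewrite (trunc_dist_far f0 fL bf).
    have h1 := notLam fL v1; have h2 := notLam fL v2.
    have -> : right v = false by apply/negP => /right_le; nlia.
    have -> : right v' = false by apply/negP => /right_le; nlia.
    by rewrite subrr.
  have h1 : al * trunc_dist (r 0) v' - al * trunc_dist (r 0) v <= al.
    rewrite -mulrBr -[leRHS]mulr1 ler_wpM2l //; exact: trunc_dist_edge bf.
  have [/hasP[j]|] := boolP (has (fun j => f == re j) (iota 0 n)).
    rewrite mem_iota add0n => jn /eqP fj.
    have ji : j != i0 by apply: contra fe => /eqP ji; rewrite fj ji.
    rewrite fj wre //.
    suff -> : right v = right v' by lra.
    have rr : right (r j) = right (r j.+1) by rewrite !rightE; nlia.
    rewrite fj hre // !inE in v1 v2.
    by case/orP: v1 => /eqP ->; case/orP: v2 => /eqP ->; rewrite ?rr.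
  move=> /hasPn fre; rewrite wbe // => [|j jn]; last by apply: fre; rewrite mem_iota.
  have : (be - al) * (right v')%:R <= be - al.
    by rewrite -[leRHS]mulr1 ler_wpM2l // lern1; case: (right v').
  have : 0 <= (be - al) * (right v)%:R by rewrite mulr_ge0.
  lra.
have [e1 e3] : e \notin unzip1 s1 /\ e \notin unzip1 s3 by exact: sre.
pose t := s1 ++ rseg p (q - p) ++ s3.
have wt : walk_in A x y t.
  have [w1' e1' A1] := w1; have [w3' e3' A3] := w3.
  have pq : (p + (q - p) = q)%N by nlia.
  split; rewrite /t.
  - by rewrite !is_walk_cat w1' e1' rseg_end pq rseg_walk ?w3' //; nlia.
  - by rewrite !wend_cat e1' rseg_end pq.
  - move=> f; rewrite /unzip1 !map_cat !mem_cat => /or3P[/A1|h|/A3] //.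
    by apply: (rseg_in _ h); nlia.
have ct : cost (upd w e 0) t + al = cost w t.
  rewrite /t !cost_cat !(cost_upd_notin w 0 e1) !(cost_upd_notin w 0 e3).
  have er : e \in unzip1 (rseg p (q - p)) by rewrite rseg_edges map_f // mem_iota; nlia.
  have ur : uniq (unzip1 (rseg p (q - p))) by apply: rseg_uniq; nlia.
  have := cost_upd_in w 0 (w e) ur er; rewrite upd_id wi0; lra.
have := passage_in_le (upd_ge0 e w0 (lexx 0)) wt.
have cr : cost w (rseg p (q - p)) = al * (q - p)%:R.
  by apply: cost_rseg => j hj; apply: wre; nlia.
move: ct; rewrite {2}/t !cost_cat cr natrB; last by nlia.
rewrite mulrBr in hc *; lra.
Qed.

(** A competing path is first rerouted without loss along the ridge ([g = 0]), then its central
    stretch is replaced by [s']. The raised edges lie in that stretch and not on [s'], so the new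
    walk does not notice them. As the path is simple, it uses at most [size s'] of the cheap edges
    of [s']. *)
Lemma detour_passage (w : edge G -> R) s' (E : seq (edge G)) : (forall f, 0 <= w f) ->
  (forall f, f \in Lam -> al <= w f <= be) ->
  (forall j, (j < n)%N -> w (re j) = al) ->
  (forall f, f \in Lam -> (forall j, (j < n)%N -> f != re j) ->
     (f \in unzip1 s') || (w f == be)) ->
  be * (4 * R0 + size s' + 1)%:R <= (be - al) * L%:R ->
  is_walk (r L) s' -> wend (r L) s' = r (n - L) ->
  (forall f, f \in unzip1 s' -> [/\ f \in Lam, w f = al & f \notin E]) ->
  (forall f, f \in E -> exists2 j, (L <= j < n - L)%N & f = re j) ->
  passage_in A (fun f => if f \in E then be else w f) x y <=
  passage_in A w x y + al * ((size s')%:R - (n - L - L)%:R).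
Proof.
move=> w0 wLam wre wbe hKL ws' es' hs' hE.
apply: (passage_in_comp _ hs0) => [f|s ss]; first by case: ifP => // _; exact: ltW.
have sQ : (count (mem (unzip1 s')) (unzip1 s) <= size s')%N.
  rewrite -(size_map fst s') -size_filter; apply: uniq_leq_size.
    by rewrite filter_uniq // (simple_uniq_edges ss).
  by move=> f; rewrite mem_filter => /andP[].
have gba : 0 <= be - al by rewrite subr_ge0 ltW.
have [|p [q [s1 [s3 [pL hq [w1 w3] sre hc]]]]] :=
    surgery w0 wLam wbe hKL ss sQ (lexx 0) gba.
  move=> p q b pL hq wb eb sub.
  have count0 (l : seq (edge G)) : count (mem [::]) l = 0%N.
    by apply/eqP; rewrite -leqn0 leqNgt -has_count; apply/hasPn.
  have hp : (dist (r 0) (r p) <= n + R0)%N by rewrite rdist; nlia.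
  have := @cost_far w w0 al [::] (r p) b al0 wb hp.
  rewrite eb count0 mulr0 !addr0 /trunc_dist rdist; last by nlia.
  rewrite (minn_idPl _); last by nlia.
  rewrite natrB; last by nlia.
  by apply => f _ /wLam /andP[].
pose t := s1 ++ rseg p (L - p) ++ s' ++ rseg (n - L) (q - (n - L)) ++ s3.
have [w1' e1' A1] := w1; have [w3' e3' A3] := w3.
have pq : (p + (L - p) = L)%N by nlia.
have pq' : (n - L + (q - (n - L)) = q)%N by nlia.
exists t.
  split; rewrite /t.
  - by rewrite !is_walk_cat w1' e1' rseg_end pq ws' es' rseg_end pq' w3' !rseg_walk //; nlia.
  - by rewrite !wend_cat e1' rseg_end pq es' rseg_end pq'.
  - move=> f; rewrite /unzip1 !map_cat !mem_cat -!/(unzip1 _).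
    case/orP=> [/A1//|/orP[h|/orP[/hs'[/LamA]//|/orP[h|/A3//]]]].
      by apply: (rseg_in _ h); nlia.
    by apply: (rseg_in _ h); nlia.
set wk := fun f => _.
have same s4 : (forall f, f \in E -> f \notin unzip1 s4) -> cost wk s4 = cost w s4.
  move=> h; rewrite !costE big_seq [RHS]big_seq; apply: eq_bigr => f fs.
  by rewrite /wk; case: ifP => // /h; rewrite fs.
have E1 : cost wk s1 = cost w s1 by apply: same => f /hE[j hj ->]; have [] := sre j hj.
have E3 : cost wk s3 = cost w s3 by apply: same => f /hE[j hj ->]; have [] := sre j hj.
have E' : cost wk s' = al * (size s')%:R.
  rewrite same; last by move=> f fE; apply/negP => /hs'[_ _]; rewrite fE.
  rewrite costE big_seq (eq_bigr (fun=> al)) => [|f /hs'[]//].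
  by rewrite -big_seq big_const_seq count_predT iter_addr_0 size_map mulr_natr.
have Er i m : (i + m <= n)%N -> ((i + m <= L)%N \/ (n - L <= i)%N) ->
    cost wk (rseg i m) = al * m%:R.
  move=> im him; rewrite same.
    by apply: cost_rseg => j hj; apply: wre; nlia.
  move=> f /hE[j hj ->]; rewrite rseg_edges; apply/mapP => -[k]; rewrite mem_iota => hk.
  by move=> /re_inj; nlia.
rewrite /t !cost_cat E1 E3 E' !Er; [|nlia..].
rewrite !natrB; [|nlia..].
by move: hc; rewrite !(mulrBr, mulrDr); lra.
Qed.

Section Configurations.
Variables (wout : edge G -> R) (M : R).
Hypotheses (wout0 : forall f, 0 <= wout f) (beM : be <= M).

Definition conf (c : edge G -> R) : edge G -> R :=
  fun f => if f \in Lam then c f else wout f.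

Definition two_valued (c : edge G -> R) := forall f, c f = al \/ c f = be.

Lemma conf_ge0 c : two_valued c -> forall f, 0 <= conf c f.
Proof.
move=> hc f; rewrite /conf; case: ifP => // _.
by case: (hc f) => -> //; exact: ltW.
Qed.

Lemma conf_upd c f t : f \in Lam -> conf (upd c f t) = upd (conf c) f t.
Proof.
move=> fL; apply/funext => g; rewrite /conf /upd; case: eqP => [->|//].
by rewrite fL.
Qed.

Lemma upd_two_valued c f t : two_valued c -> t = al \/ t = be ->
  two_valued (upd c f t).
Proof. by move=> hc ht g; rewrite /upd; case: ifP. Qed.

(** While the threshold of the next edge is at least [be], raising that edge increases the passage
    time by exactly [be - al]; otherwise the current configuration witnesses the first
    alternative. *)
Lemma raise_edges (E : seq (edge G)) c : uniq E -> two_valued c ->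
  (forall f, f \in E -> f \in Lam /\ c f = al) ->
  (exists e c', [/\ e \in E, two_valued c' &
     threshold A x y M (conf c') e < be]) \/
  passage_in A (conf (fun f => if f \in E then be else c f)) x y =
  passage_in A (conf c) x y + (be - al) * (size E)%:R.
Proof.
elim: E c => [|e E ih] c /=.
  by move=> _ _ _; right; rewrite mulr0 addr0.
move=> /andP[eE uE] hc hE; have [eL cal] := hE e (mem_head _ _).
have [lt|ge] := ltP (threshold A x y M (conf c) e) be.
  by left; exists e, c; rewrite mem_head.
have hc' : two_valued (upd c e be) by apply: upd_two_valued; auto.
have [|[e' [c' [h1 h2 h3]]]|hh] := ih (upd c e be) uE hc' _.
- move=> f fE; have [fL fal] := hE f (mem_behead (s := e :: E) fE); split => //.
  by rewrite upd_neq //; apply: contraNneq eE => <-.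
- by left; exists e', c'; rewrite inE h1 orbT.
right.
have -> : (fun f => if f \in e :: E then be else c f) =
          (fun f => if f \in E then be else upd c e be f).
  apply/funext => f; rewrite inE /upd; case: (f == e) => //=.
  by case: (f \in E).
have alM : 0 <= al <= M by rewrite al0 (le_trans (ltW albe)).
have beM' : 0 <= be <= M by rewrite ltW.
rewrite hh conf_upd // (passage_in_threshold e (conf_ge0 hc) hs0 beM').
have := passage_in_threshold e (conf_ge0 hc) hs0 alM.
have -> : upd (conf c) e al = conf c.
  by have := upd_id (conf c) e; rewrite {2}/conf eL cal.
move=> ->; rewrite (min_idPl ge) (min_idPl (le_trans (ltW albe) ge)).
rewrite -natr1; lra.
Qed.

(* One raised weight moves the threshold by at most [be - al], so the threshold
   cannot jump over the window. *)
Lemma crossing (th : R) e (l : seq (edge G)) c c' : 0 <= th -> th <= be - al ->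
  two_valued c -> two_valued c' ->
  (forall f, f \in Lam -> f \notin l -> c f = c' f) -> {subset l <= Lam} ->
  threshold A x y M (conf c) e < be ->
  be <= threshold A x y M (conf c') e ->
  exists c'', two_valued c'' /\ al + th <= threshold A x y M (conf c'') e <= be + th.
Proof.
move=> th0 thb; elim: l c => [|f l ih] c hc hc' cc' lL h1 h2.
  have e' : conf c = conf c'.
    by apply/funext => g; rewrite /conf; case: ifP => // gL; apply: cc'.
  by move: h1; rewrite e' ltNge h2.
have [hh|hh] := leP (al + th) (threshold A x y M (conf c) e).
  by exists c; split => //; rewrite hh (le_trans (ltW h1)) // lerDl.
have fL : f \in Lam by apply: lL; rewrite mem_head.
have hc1 : two_valued (upd c f (c' f)) by apply: upd_two_valued.
have step : `|threshold A x y M (conf (upd c f (c' f))) e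
              - threshold A x y M (conf c) e| <= be - al.
  rewrite conf_upd //.
  have M0 : 0 <= M by apply: le_trans beM; exact: ltW.
  have k := threshold_lip1 e f (conf_ge0 hc) M0 al0 (ltW albe) hs0.
  have cf : conf c f = c f by rewrite /conf fL.
  have := upd_id (conf c) f; rewrite cf => uf; rewrite -{2}uf.
  case: (hc f) => ->; case: (hc' f) => ->; rewrite ?subrr ?normr0 ?subr_ge0 ?(ltW albe) //.
  by rewrite distrC.
move: step; rewrite ler_norml => /andP[_ step].
have [h3|h3] := leP be (threshold A x y M (conf (upd c f (c' f))) e).
  by exists (upd c f (c' f)); split => //; apply/andP; split; lra.
apply: (ih _ hc1 hc' _ _ h3 h2) => [g gL gl|g gl].
  rewrite /upd; case: eqP => [->//|/eqP gf]; apply: cc' => //.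
  by rewrite inE negb_or gf.
by apply: lL; rewrite inE gl orbT.
Qed.

(* If all thresholds stayed above [be] while the middle ridge edges outside the
   detour [s'] are raised to [be], the passage time would increase by more than
   the cost of the detour. *)
Lemma block_configuration (th : R) s' : 0 <= th -> th <= be - al ->
  be * (4 * R0 + size s' + 1)%:R <= (be - al) * L%:R ->
  is_walk (r L) s' -> wend (r L) s' = r (n - L) ->
  {subset unzip1 s' <= Lam} ->
  al * ((size s')%:R - (n - L - L)%:R) < (be - al) *
    (size [seq f <- unzip1 (rseg L (n - L - L)) | f \notin unzip1 s'])%:R ->
  exists e c, [/\ e \in Lam, two_valued c &
    al + th <= threshold A x y M (conf c) e <= be + th].
Proof.
move=> th0 thb hKL ws' es' sL hlt.
pose ridge f := has (fun j => f == re j) (iota 0 n).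
have ridgeP f : reflect (exists2 j, (j < n)%N & f = re j) (ridge f).
  apply: (iffP hasP) => [[j]|[j jn ->]]; last by exists j; rewrite ?mem_iota ?eqxx.
  by rewrite mem_iota => jn /eqP ->; exists j.
(* [c1] is the configuration in which central ridge edges have large thresholds; [c0] lowers the
   edges of the detour as well. *)
pose c1 f := if ridge f then al else be.
pose c0 f := if ridge f || (f \in unzip1 s') then al else be.
have hc1 : two_valued c1 by move=> f; rewrite /c1; case: ifP; auto.
have hc0 : two_valued c0 by move=> f; rewrite /c0; case: ifP; auto.
have range c f : two_valued c -> f \in Lam -> al <= conf c f <= be.
  by move=> hc fL; rewrite /conf fL; case: (hc f) => ->; rewrite ?lexx (ltW albe).
set E := [seq f <- _ | _] in hlt.
have hE f : f \in E -> exists2 j, (L <= j < n - L)%N & f = re j.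
  rewrite mem_filter rseg_edges => /andP[_ /mapP[j]]; rewrite mem_iota => hj ->.
  by exists j => //; nlia.
have uE : uniq E by rewrite filter_uniq // rseg_uniq; nlia.
have [|[e [c [eE hc hlt1]]]|heq] := @raise_edges E c0 uE hc0.
- move=> f /hE[j hj ->]; split; first by apply: rseg_Lam; nlia.
  by rewrite /c0; have -> : ridge (re j) by apply/ridgeP; exists j => //; nlia.
- have [j hj ej] := hE _ eE.
  have eL : e \in Lam by rewrite ej rseg_Lam //; nlia.
  have h2 : be <= threshold A x y M (conf c1) e.
    rewrite ej; apply: ridge_threshold => //.
    + exact: conf_ge0.
    + by move=> f; exact: range.
    + move=> i hi; rewrite /conf rseg_Lam //.
      by rewrite /c1; have -> : ridge (re i) by apply/ridgeP; exists i.
    + move=> f fL fre; rewrite /conf fL /c1; case: ridgeP => // -[i hi fi].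
      by have := fre i hi; rewrite fi eqxx.
    + apply: le_trans hKL; rewrite ler_wpM2l ?(ltW be0) // ler_nat; nlia.
  have [//|//|c'' [hc'' hth]] := crossing th0 thb hc hc1 (l := enum_fset Lam) _ _ hlt1 h2.
    by move=> f fL; rewrite fL.
  by exists e, c''.
exfalso.
have : passage_in A (conf (fun f => if f \in E then be else c0 f)) x y <=
    passage_in A (conf c0) x y + al * ((size s')%:R - (n - L - L)%:R).
  have -> : conf (fun f => if f \in E then be else c0 f) =
            (fun f => if f \in E then be else conf c0 f).
    apply/funext => f; rewrite /conf; case: ifPn => // fL; case: ifPn => // /hE[j hj fj].
    by move: fL; rewrite fj rseg_Lam //; nlia.
  apply: detour_passage => //.
  - exact: conf_ge0.
  - by move=> f; exact: range.
  - move=> i hi; rewrite /conf rseg_Lam //.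
    by rewrite /c0; have -> : ridge (re i) by apply/ridgeP; exists i.
  - move=> f fL fre; rewrite /conf fL /c0; case: (f \in unzip1 s') => //=.
    rewrite orbF; case: ridgeP => [[i hi fi]|_]; last by rewrite eqxx.
    by have := fre i hi; rewrite fi eqxx.
  - move=> f fs; split; [exact: sL|by rewrite /conf sL // /c0 fs orbT|].
    by rewrite mem_filter fs.
by rewrite heq lerD2l leNgt hlt.
Qed.

End Configurations.

End Block.

(** * Resampling finitely many edges *)

Section FiniteExpectation.
Variables (R : realType) (G : graph) (k : nat) (val : 'I_k -> R).
Hypothesis val0 : forall i, 0 <= val i.
Implicit Types (w c : edge G -> R) (e f : edge G) (l : seq (edge G)).
Implicit Types (p q : 'I_k -> R) (F H : (edge G -> R) -> R).

Definition is_law p := (forall i, 0 <= p i) /\ \sum_i p i = 1.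

Lemma is_law_mean p (a : R) : is_law p -> \sum_i p i * a = a.
Proof. by move=> [_ p1]; rewrite -mulr_suml p1 mul1r. Qed.

Definition nonneg w := forall e, 0 <= w e.

(** Mean of [F] when the edges of [l] carry independent weights with law [p] and the other weights
    are read from [w]. As a nested finite sum it can be conditioned on any set of weights by mere
    rearrangement. *)
Fixpoint EE p l F w : R :=
  if l is e :: l' then \sum_i p i * EE p l' F (upd w e (val i)) else F w.

Lemma nonneg_upd w e i : nonneg w -> nonneg (upd w e (val i)).
Proof. by move=> w0; exact: upd_ge0. Qed.

Lemma EE_le p l F H w : is_law p -> nonneg w ->
  (forall w', nonneg w' -> F w' <= H w') -> EE p l F w <= EE p l H w.
Proof.
move=> [p0 _] + FH; elim: l w => [|e l ih] w w0 /=; first exact: FH.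
by apply: ler_sum => i _; rewrite ler_wpM2l // ih //; exact: nonneg_upd.
Qed.

Lemma EE_addr p l F (a : R) w : is_law p ->
  EE p l (fun w => F w + a) w = EE p l F w + a.
Proof.
move=> [p0 p1]; elim: l w => [//|e l ih] w /=.
under eq_bigr do rewrite ih mulrDr.
by rewrite big_split /= -mulr_suml p1 mul1r.
Qed.

Lemma EE_upd p l F w e (t : R) : e \notin l ->
  EE p l F (upd w e t) = EE p l (fun w => F (upd w e t)) w.
Proof.
elim: l w => [//|f l ih] w /=; rewrite inE negb_or => /andP[ef el].
by apply: eq_bigr => i _; rewrite updC // ih.
Qed.

Lemma EE_sum p q l (F : 'I_k -> (edge G -> R) -> R) w :
  EE p l (fun w => \sum_i q i * F i w) w = \sum_i q i * EE p l (F i) w.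
Proof.
elim: l w => [//|f l ih] w /=.
under eq_bigr do rewrite ih mulr_sumr.
rewrite exchange_big /=; apply: eq_bigr => i _; rewrite mulr_sumr.
by apply: eq_bigr => j _; rewrite mulrCA.
Qed.

Lemma EE_cat p l l' F w : EE p (l ++ l') F w = EE p l (EE p l' F) w.
Proof. by elim: l w => [//|e l ih] w /=; apply: eq_bigr => i _; rewrite ih. Qed.

Lemma EE_cons p q e l F w : e \notin l ->
  \sum_i q i * EE p l F (upd w e (val i)) =
  EE p l (fun w => \sum_i q i * F (upd w e (val i))) w.
Proof.
by move=> el; rewrite EE_sum; apply: eq_bigr => i _; rewrite EE_upd.
Qed.

(** Fubini for disjoint sets of edges; the two laws may differ, so blocks can be switched in any
    order. *)
Lemma EE_comm p q l l' F w : ~~ has (mem l) l' ->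
  EE p l (EE q l' F) w = EE q l' (EE p l F) w.
Proof.
elim: l w => [//|e l ih] w /= ll'.
have el' : e \notin l'.
  by apply: contra ll' => h; apply/hasP; exists e; rewrite //= mem_head.
rewrite -EE_cons //; apply: eq_bigr => i _; rewrite ih //.
by apply: contra ll' => /hasP[f fl' /= fl]; apply/hasP; exists f; rewrite //= inE fl orbT.
Qed.

Lemma EE_front p e l F w : uniq l -> e \in l ->
  EE p l F w = EE p (e :: rem e l) F w.
Proof.
move=> ul /splitPr el; case: el ul => l1 l2 ul.
have [el1 e12] : e \notin l1 /\ rem e (l1 ++ e :: l2) = l1 ++ l2.
  move: ul; rewrite cat_uniq => /and3P[_ /hasPn/= h _].
  have el1 : e \notin l1 by apply: h; rewrite mem_head.
  split => //; elim: l1 el1 {h} => [|f l1 ih] /=; first by rewrite eqxx.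
  by rewrite inE negb_or eq_sym => /andP[/negPf -> /ih ->].
rewrite e12; transitivity (EE p l1 (EE p [:: e] (EE p l2 F)) w).
  by rewrite EE_cat.
rewrite EE_comm /= ?orbF //.
by apply: eq_bigr => i _; rewrite EE_cat.
Qed.

(** Only the event that every weight of [l] is within [rho] of [c] is kept; by independence its mass
    is at least [kap ^+ size l], and [H >= 0] bounds the rest. *)
Lemma EE_ge p l H w c (rho del kap : R) : is_law p -> nonneg w -> uniq l ->
  (forall w', nonneg w' -> 0 <= H w') -> 0 <= del -> 0 <= kap ->
  (forall f, f \in l -> kap <= \sum_(i | `|val i - c f| <= rho) p i) ->
  (forall w', nonneg w' -> (forall f, f \in l -> `|w' f - c f| <= rho) ->
     (forall f, f \notin l -> w' f = w f) -> del <= H w') ->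
  del * kap ^+ size l <= EE p l H w.
Proof.
move=> lp + + H0 del0 kap0; have [p0 p1] := lp.
elim: l w => [|e l ih] w w0 /=.
  by move=> _ _ h; rewrite expr0 mulr1; apply: h.
move=> /andP[el ul] hk h.
rewrite exprS mulrCA (bigID (fun i => `|val i - c e| <= rho)) /=.
rewrite -[leLHS]addr0; apply: lerD; last first.
  apply: sumr_ge0 => i _; rewrite mulr_ge0 //.
  have := EE_le l lp (nonneg_upd e i w0) H0; apply: le_trans.
  elim: (l) (upd _ _ _) => [//|f l' ih'] w' /=.
  by rewrite sumr_ge0 // => j _; rewrite mulr_ge0.
apply: (@le_trans _ _ ((\sum_(i | `|val i - c e| <= rho) p i) * (del * kap ^+ size l))).
  by rewrite ler_wpM2r ?hk ?mem_head // mulr_ge0 // exprn_ge0.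
rewrite mulr_suml; apply: ler_sum => i near_i; rewrite ler_wpM2l //.
apply: ih => //; first exact: nonneg_upd.
  by move=> f fl; apply: hk; rewrite inE fl orbT.
move=> w' w'0 hl hnl; apply: h => // f; rewrite inE.
  move=> /orP[/eqP ->|]; last exact: hl.
  by rewrite hnl // updE.
rewrite negb_or => /andP[fe fl]; rewrite hnl // upd_neq //.
Qed.

Section Gain.
Variables (p q : 'I_k -> R) (F : (edge G -> R) -> R)
  (D : (edge G -> R) -> edge G -> R) (eta : R).
Hypotheses (lp : is_law p) (lq : is_law q).
Hypotheses (D0 : forall w e, nonneg w -> 0 <= D w e)
  (FD : forall w e i, nonneg w ->
     F (upd w e (val i)) = F (upd w e 0) + Num.min (val i) (D w e)).

Definition law_gap (a b : 'I_k -> R) (s : R) : R :=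
  \sum_i (a i - b i) * Num.min (val i) s.

(** The part of [F] that does not depend on the weight of [e] cancels because both laws have mass
    1. *)
Lemma one_edge_gain (a b : 'I_k -> R) w e : is_law a -> is_law b -> nonneg w ->
  \sum_i a i * F (upd w e (val i)) =
  \sum_i b i * F (upd w e (val i)) + law_gap a b (D w e).
Proof.
move=> [_ a1] [_ b1] w0.
have h (c : 'I_k -> R) : \sum_i c i = 1 -> \sum_i c i * F (upd w e (val i)) =
    F (upd w e 0) + \sum_i c i * Num.min (val i) (D w e).
  move=> c1; under eq_bigr do rewrite FD // mulrDr.
  by rewrite big_split /= -mulr_suml c1 mul1r.
rewrite !h // /law_gap; under [X in _ = _ + X]eq_bigr do rewrite mulrBl.
by rewrite sumrB; lra.
Qed.

(** Replacement of one law by the other edge by edge, each exchange losing at most [et]. *)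
Lemma EE_weak (a b : 'I_k -> R) l w (et : R) : is_law a -> is_law b ->
  (forall s, 0 <= s -> - et <= law_gap a b s) -> nonneg w -> uniq l ->
  EE b l F w <= EE a l F w + et * (size l)%:R.
Proof.
move=> la lb hab; elim: l w => [|e l ih] w w0 /=; first by rewrite mulr0 addr0.
move=> /andP[el ul]; rewrite -natr1 mulrDr mulr1.
have [a0 a1] := la; have [b0 b1] := lb.
have h1 : \sum_i a i * EE b l F (upd w e (val i)) <=
    \sum_i a i * EE a l F (upd w e (val i)) + et * (size l)%:R.
  rewrite -(is_law_mean (et * (size l)%:R) la) -big_split /=.
  apply: ler_sum => i _; rewrite -mulrDr; apply: ler_wpM2l => //.
  by apply: ih => //; exact: nonneg_upd.
have h2 : \sum_i b i * EE b l F (upd w e (val i)) <=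
    \sum_i a i * EE b l F (upd w e (val i)) + et.
  rewrite !EE_cons // -EE_addr //; apply: EE_le => // w' w'0.
  by rewrite (one_edge_gain e la lb w'0); have := hab _ (D0 e w'0); lra.
lra.
Qed.

Definition half_law : 'I_k -> R := fun i => (p i + q i) / 2.

Lemma half_law_is_law : is_law half_law.
Proof.
have [p0 p1] := lp; have [q0 q1] := lq; split.
  by move=> i; rewrite divr_ge0 // addr_ge0.
by rewrite /half_law -mulr_suml big_split /= p1 q1; lra.
Qed.

Lemma law_gap_half s : law_gap p half_law s = law_gap p q s / 2 /\
  law_gap half_law q s = law_gap p q s / 2.
Proof.
by split; rewrite /law_gap mulr_suml; apply: eq_bigr => i _; rewrite /half_law; lra.
Qed.

Hypothesis gap_ge : forall s, 0 <= s -> - eta <= law_gap p q s.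

(* Passing from [p] to [q] through their mean makes every weight of the block
   see the atoms of both laws when the special edge [e] is resampled. *)
Lemma EE_block_gain e l w c (rho del kap : R) : nonneg w -> uniq (e :: l) ->
  0 <= eta -> 0 <= del -> 0 <= kap ->
  (forall f, f \in l -> kap <= \sum_(i | `|val i - c f| <= rho) half_law i) ->
  (forall w', nonneg w' -> (forall f, f \in l -> `|w' f - c f| <= rho) ->
     (forall f, f \notin l -> w' f = w f) -> del <= law_gap p q (D w' e)) ->
  EE q (e :: l) F w + del / 2 * kap ^+ size l <=
  EE p (e :: l) F w + eta * (size l).+1%:R.
Proof.
move=> w0 /[dup] uel /= /andP[el ul] eta0 del0 kap0 hk hd.
have lh := half_law_is_law; have [p0 p1] := lp.
have g1 s : 0 <= s -> - (eta / 2) <= law_gap p half_law s.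
  by move=> /gap_ge; have [-> _] := law_gap_half s; lra.
have g2 s : 0 <= s -> - (eta / 2) <= law_gap half_law q s.
  by move=> /gap_ge; have [_ ->] := law_gap_half s; lra.
(* Three exchanges are chained: [q] to the half law everywhere ([h2]), the half law to [p] at [e],
   where the gain occurs ([h3]), and the half law to [p] on [l] ([h1]). *)
have h1 : \sum_i p i * EE half_law l F (upd w e (val i)) <=
    \sum_i p i * EE p l F (upd w e (val i)) + eta / 2 * (size l)%:R.
  rewrite -(is_law_mean (eta / 2 * (size l)%:R) lp) -big_split /=.
  apply: ler_sum => i _; rewrite -mulrDr; apply: ler_wpM2l => //.
  by apply: EE_weak => //; exact: nonneg_upd.
have h2 := @EE_weak _ _ (e :: l) w _ lh lq g2 w0 uel.
have h3 : EE half_law (e :: l) F w + (del / 2 * kap ^+ size l - eta / 2) <=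
    \sum_i p i * EE half_law l F (upd w e (val i)).
  rewrite /= !EE_cons //.
  (* The summand [eta / 2] makes the integrand nonnegative, as [EE_ge] requires. *)
  have : del / 2 * kap ^+ size l <= EE half_law l (fun w' =>
      (\sum_i p i * F (upd w' e (val i)) - \sum_i half_law i * F (upd w' e (val i)))
      + eta / 2) w.
    apply: (EE_ge lh w0 ul (c := c) (rho := rho)) => //; last 1 first.
    - move=> w' w'0 hc hw; rewrite (one_edge_gain e lp lh w'0) [_ + law_gap _ _ _]addrC addrK.
      by have [-> _] := law_gap_half (D w' e); have := hd w' w'0 hc hw; lra.
    - move=> w' w'0; rewrite (one_edge_gain e lp lh w'0) [_ + law_gap _ _ _]addrC addrK.
      by have := g1 _ (D0 e w'0); lra.
    - by rewrite divr_ge0.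
  rewrite EE_addr // => h4.
  have h5 : EE half_law l (fun w' => \sum_i p i * F (upd w' e (val i))
        - \sum_i half_law i * F (upd w' e (val i))) w =
      EE half_law l (fun w' => \sum_i p i * F (upd w' e (val i))) w -
      EE half_law l (fun w' => \sum_i half_law i * F (upd w' e (val i))) w.
    elim: (l) w {w0 h1 h2 h4 hd} => [//|f l' ih] w /=.
    by rewrite -sumrB; apply: eq_bigr => i _; rewrite ih mulrBr.
  rewrite h5 in h4; lra.
rewrite /= in h2 h3 *; rewrite -[(size l).+1%:R]natr1 in h2 *; lra.
Qed.

Lemma EE_blocks (bs : seq (seq (edge G))) (rest : seq (edge G)) (g : R) w :
  nonneg w -> uniq (flatten bs ++ rest) ->
  (forall b, b \in bs -> forall w', nonneg w' -> EE q b F w' + g <= EE p b F w') ->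
  EE q (flatten bs ++ rest) F w + g * (size bs)%:R <=
  EE p (flatten bs ++ rest) F w + eta * (size rest)%:R.
Proof.
elim: bs w => [|b bs ih] w w0 /= u hb.
  by rewrite mulr0 addr0; apply: EE_weak.
rewrite -catA in u *; set l := flatten bs ++ rest in u ih *.
have /and3P[ub bl ul] : [&& uniq b, ~~ has (mem b) l & uniq l] by rewrite -cat_uniq.
rewrite !EE_cat -natr1 mulrDr mulr1 addrA.
have hbs b' : b' \in bs -> forall w', nonneg w' -> EE q b' F w' + g <= EE p b' F w'.
  by move=> b'bs; apply: hb; rewrite inE b'bs orbT.
have h1 : EE q l (EE q b F) w + g <= EE q l (EE p b F) w.
  by rewrite -EE_addr //; apply: EE_le => // w' w'0; apply: hb; rewrite ?mem_head.
have h2 : EE p b (EE q l F) w + g * (size bs)%:R <= EE p b (EE p l F) w + eta * (size rest)%:R.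
  by rewrite -!EE_addr //; apply: EE_le => // w' w'0; apply: ih.
rewrite EE_comm // in h2; rewrite [EE q b _ w]EE_comm //; lra.
Qed.

End Gain.

End FiniteExpectation.

(** * Choice of the window *)

Section GapWindow.
Variables (R : realType) (tau tau' psi psi' : R -> R).
Hypotheses (psiE : forall s t, s <= t ->
    (t - s) * tau t <= psi t - psi s <= (t - s) * tau s)
  (psiE' : forall s t, s <= t ->
    (t - s) * tau' t <= psi' t - psi' s <= (t - s) * tau' s).
Hypotheses (tau01 : forall s, 0 <= tau s <= 1) (tau01' : forall s, 0 <= tau' s <= 1).
Hypotheses (tauN : forall s t, s <= t -> tau t <= tau s)
  (tauN' : forall s t, s <= t -> tau' t <= tau' s).

Let phi s := psi s - psi' s.
Let sg s := tau s + tau' s.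

(** Both truncated means have slopes between 0 and 1, so their difference has slopes between -1 and
    1. *)
Lemma gap_lip s t : `|phi t - phi s| <= `|t - s|.
Proof.
wlog st : s t / s <= t => [h|].
  by case: (leP s t) => [/h//|/ltW/h]; rewrite distrC [leRHS]distrC.
have d0 : 0 <= t - s by rewrite subr_ge0.
have /andP[a1 a2] := psiE st; have /andP[b1 b2] := psiE' st.
have mul01 (u : R) : 0 <= u <= 1 -> 0 <= (t - s) * u <= t - s.
  by move=> /andP[u0 u1]; rewrite mulr_ge0 // ler_piMr.
have := mul01 _ (tau01 s); have := mul01 _ (tau01 t).
have := mul01 _ (tau01' s); have := mul01 _ (tau01' t).
move: a1 a2 b1 b2; rewrite /phi (ger0_norm d0).
set u1 := _ * tau t; set u2 := _ * tau s; set u3 := _ * tau' t; set u4 := _ * tau' s.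
by move=> *; rewrite ler_norml; apply/andP; split; lra.
Qed.

(** If the sum of the two tails does not drop from [s] to [t], neither tail does: both truncated
    means are affine there. *)
Lemma gap_affine s t a b : sg s <= sg t -> s <= a -> a <= b -> b <= t ->
  phi b - phi a = (b - a) * (tau s - tau' s).
Proof.
move=> hst sa ab bt.
have mono u : s <= u -> u <= t -> tau u = tau s /\ tau' u = tau' s.
  move=> su ut; have := tauN su; have := tauN' su; have := tauN ut; have := tauN' ut.
  by move: hst; rewrite /sg => *; split; lra.
have [a1 a2] := mono a sa (le_trans ab bt).
have [b1 b2] := mono b (le_trans sa ab) bt.
have /andP[c1 c2] := psiE ab; have /andP[d1 d2] := psiE' ab.
rewrite b1 a1 in c1 c2; rewrite b2 a2 in d1 d2.
rewrite mulrBr /phi; lra.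
Qed.

Hypotheses (phi0 : forall s, 0 <= phi s) (phiN : forall s, s <= 0 -> phi s = 0).
Variables (B s0 : R).
Hypotheses (phiB : forall s, phi s <= B) (s0P : 0 < phi s0).

(** For tails, the difference of the two sides is the mass that the two laws together give to the
    interval from [x - rho] to [x + rho]. *)
Definition support_point x := forall rho, 0 < rho -> sg (x + rho) < sg (x - rho).

Lemma sg_mono s t : s <= t -> sg t <= sg s.
Proof. by move=> st; rewrite /sg lerD // ?tauN ?tauN'. Qed.

(** [al] is the last zero of [phi] up to [s0]. Without mass near [al], the function [phi] would be
    affine there; being nonnegative and zero at [al], it would vanish on both sides, against the
    choice of [al]. *)
Lemma left_support_point : exists al, [/\ 0 <= al < s0, phi al = 0,
  forall s, al < s -> s <= s0 -> 0 < phi s & support_point al].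
Proof.
pose S := [set s | s <= s0 /\ phi s = 0].
have s00 : 0 < s0.
  by rewrite ltNge; apply/negP => /phiN h; move: s0P; rewrite h ltxx.
have S0 : S 0 by split; [exact: ltW|exact: phiN].
have hS : has_sup S by split; [exists 0|exists s0 => s []].
set al := sup S.
have al0 : 0 <= al by apply: sup_upper_bound.
have als : al <= s0 by apply: sup_le_ub; [exists 0|move=> s []].
have phial : phi al = 0.
  apply/eqP; rewrite eq_le phi0 andbT leNgt; apply/negP => h.
  have [s [ss ps] hs] := sup_adherent h hS.
  have sal : s <= al by apply: sup_upper_bound.
  have := gap_lip s al; rewrite ps subr0 (ger0_norm (phi0 _)) ger0_norm ?subr_ge0 //.
  by rewrite -/al in hs; lra.
have als' : al < s0.
  by rewrite lt_neqAle als andbT; apply: contraTneq s0P => <-; rewrite phial ltxx.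
have pos s : al < s -> s <= s0 -> 0 < phi s.
  move=> als2 ss; rewrite lt_neqAle phi0 andbT; apply: contraTneq als2 => h.
  by rewrite -leNgt; apply: sup_upper_bound => //; split.
exists al; split => //; first by rewrite al0.
move=> rho rho0; rewrite ltNge; apply/negP => h.
have m0 : 0 < Num.min rho (s0 - al) by rewrite lt_min rho0 subr_gt0.
have m1 : Num.min rho (s0 - al) <= rho by rewrite ge_min lexx.
have m2 : Num.min rho (s0 - al) <= s0 - al by rewrite ge_min lexx orbT.
set m := Num.min _ _ in m0 m1 m2.
have lr : al - rho <= al by lra.
have rr : al <= al + rho by lra.
have mr : al <= al + m by lra.
have mr' : al + m <= al + rho by lra.
have h1 := gap_affine h (lexx _) lr rr; have h2 := gap_affine h lr rr (lexx _).
have h3 := gap_affine h lr mr mr'; rewrite phial in h1 h2 h3.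
set k := tau _ - tau' _ in h1 h2 h3.
have g1 := phi0 (al - rho); have g2 := phi0 (al + rho).
have e1 : (al - (al - rho)) * k = rho * k by rewrite opprB addrC subrK.
have e2 : (al + rho - al) * k = rho * k by rewrite addrAC subrr add0r.
rewrite e1 in h1; rewrite e2 in h2.
have k0 : k = 0.
  have : rho * k = 0 by lra.
  by move=> /eqP; rewrite mulf_eq0 (gt_eqF rho0) => /eqP.
have als2 : al < al + m by lra.
have als3 : al + m <= s0 by lra.
by have := pos (al + m) als2 als3; rewrite k0 mulr0 in h3; lra.
Qed.

(** If some mass lies between [al] and [s0], the last such position serves. Otherwise [phi] rises
    with a positive slope up to [s0] and keeps rising until the next mass, which exists because
    [phi] is bounded. *)
Lemma right_support_point al : al < s0 -> phi al = 0 ->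
  (forall s, al < s -> s <= s0 -> 0 < phi s) ->
  exists be, [/\ al < be, forall s, al < s -> s <= be -> 0 < phi s &
    support_point be].
Proof.
move=> als phial pos.
have [[s1 [als1 s1s0 hs1]]|flat] := pselect (exists s, [/\ al < s, s <= s0 & sg s0 < sg s]).
  pose S := [set s | s <= s0 /\ sg s0 < sg s].
  have hS : has_sup S by split; [exists s1|exists s0 => s []].
  have s1be : s1 <= sup S by apply: sup_upper_bound.
  have bes : sup S <= s0 by apply: sup_le_ub; [exists s1|move=> s []].
  exists (sup S); split; first exact: lt_le_trans s1be.
    by move=> s h1 h2; apply: pos => //; exact: le_trans bes.
  move=> rho rho0; have [s [_ hs2] hs] := sup_adherent rho0 hS.
  apply: (@le_lt_trans _ _ (sg s0)); last first.
    by apply: (lt_le_trans hs2); apply: sg_mono; exact: ltW.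
  have [h|h] := leP s0 (sup S + rho); first exact: sg_mono.
  rewrite leNgt; apply/negP => h2.
  have : sup S + rho <= sup S by apply: sup_upper_bound => //; split => //; exact: ltW.
  lra.
have sgc s : al < s -> s <= s0 -> sg s <= sg s0.
  by move=> h1 h2; rewrite leNgt; apply/negP => h3; apply: flat; exists s.
pose k := tau s0 - tau' s0.
(* By the Lipschitz bound [phi s1] is at most [phi s0 / 2], so [phi] increases from [s1] to [s0] and
   the slope [k] is positive. *)
pose s1 := al + Num.min (s0 - al) (phi s0) / 2.
have m0 : 0 < Num.min (s0 - al) (phi s0) by rewrite lt_min subr_gt0 als.
have m1 : Num.min (s0 - al) (phi s0) <= s0 - al by rewrite ge_min lexx.
have m2 : Num.min (s0 - al) (phi s0) <= phi s0 by rewrite ge_min lexx orbT.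
have als1 : al < s1 by rewrite /s1; lra.
have s1s0 : s1 < s0 by rewrite /s1; lra.
have k0 : 0 < k.
  have hk : tau s1 - tau' s1 = k.
    have h1 := sgc s1 als1 (ltW s1s0); have h2 := tauN (ltW s1s0).
    by have h3 := tauN' (ltW s1s0); rewrite /sg in h1; rewrite /k; lra.
  have := gap_affine (sgc s1 als1 (ltW s1s0)) (lexx _) (ltW s1s0) (lexx _).
  rewrite hk => h1.
  have := gap_lip al s1; rewrite phial subr0 (ger0_norm (phi0 _)) ger0_norm; last by lra.
  move=> h2; rewrite -(@pmulr_rgt0 _ (s0 - s1)) ?subr_gt0 // -h1.
  by rewrite /s1 in h2; lra.
pose S := [set s | s0 <= s /\ sg s0 <= sg s].
have aff s : S s -> phi s = phi s0 + (s - s0) * k.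
  move=> [h1 h2]; have := gap_affine h2 (lexx _) h1 (lexx _); rewrite -/k; lra.
have Sub : ubound S (s0 + B / k).
  move=> s Ss; rewrite -lerBlDl ler_pdivlMr //.
  by have := aff s Ss; have := phiB s; lra.
have hS : has_sup S by split; [exists s0|exists (s0 + B / k)].
have s0be : s0 <= sup S by apply: sup_upper_bound.
have Sdown s : s0 <= s -> s < sup S -> S s.
  move=> h1 h2; split => //.
  have h3 : 0 < sup S - s by rewrite subr_gt0.
  have [t [t1 t2] ht] := sup_adherent h3 hS.
  by apply: (le_trans t2); apply: sg_mono; rewrite subKr in ht; exact: ltW.
have Spos s : S s -> phi s0 <= phi s.
  by move=> Ss; rewrite (aff _ Ss) lerDl mulr_ge0 ?(ltW k0) // subr_ge0; case: Ss.
exists (sup S); split; first exact: lt_le_trans s0be.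
  move=> s h1 h2; have [h3|h3] := leP s s0; first exact: pos.
  have [h4|h4] := ltP s (sup S).
    by apply: (lt_le_trans s0P); apply: Spos; apply: Sdown => //; exact: ltW.
  have -> : s = sup S by apply/eqP; rewrite eq_le h2.
  have h5 : 0 < phi s0 / 2 by lra.
  have [t St ht] := sup_adherent h5 hS.
  have tS : t <= sup S by apply: sup_upper_bound.
  have := gap_lip t (sup S); rewrite [X in _ <= X]ger0_norm ?subr_ge0 //.
  by have := Spos t St; rewrite ler_norml => ? /andP[? ?]; lra.
move=> rho rho0; apply: (@lt_le_trans _ _ (sg s0)).
  rewrite ltNge; apply/negP => h.
  have : sup S + rho <= sup S by apply: sup_upper_bound => //; split => //; lra.
  lra.
have [h|h] := leP s0 (sup S - rho); last by apply: sg_mono; exact: ltW.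
by have [] : S (sup S - rho) by apply: Sdown => //; lra.
Qed.

Lemma gap_continuous : continuous phi.
Proof.
move=> s; apply/cvgrPdist_lt => eps eps0; near=> t.
apply: le_lt_trans (gap_lip t s) _.
by near: t; apply: cvgr_dist_lt.
Unshelve. all: by end_near. Qed.

Lemma gap_window : exists al be th del, [/\ 0 <= al < be, 0 < th <= be - al, 0 < del,
  support_point al /\ support_point be &
  forall s, al + th / 2 <= s <= be + 2 * th -> del <= phi s].
Proof.
have [al [/andP[al0 als] phial pos al_supp]] := left_support_point.
have [be [albe pos' be_supp]] := right_support_point als phial pos.
have pb : 0 < phi be by apply: pos'.
(* To the right of [be], the Lipschitz bound keeps [phi] above [phi be / 2] up to [be + 2 * th];
   between [al + th / 2] and [be], compactness gives a positive minimum. *)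
pose th := Num.min (be - al) (phi be / 4).
have th0 : 0 < th by rewrite lt_min subr_gt0 albe; lra.
have th1 : th <= be - al by rewrite ge_min lexx.
have th2 : th <= phi be / 4 by rewrite ge_min lexx orbT.
have ab : al + th / 2 <= be by lra.
have [c cab hc] := EVT_min ab (continuous_subspaceT gap_continuous).
rewrite in_itv /= in cab; case/andP: cab => c1 c2.
have pc : 0 < phi c by apply: pos' => //; lra.
exists al, be, th, (Num.min (phi c) (phi be / 2)); split => //.
- by rewrite al0.
- by rewrite th0.
- by rewrite lt_min pc; lra.
move=> s /andP[s1 s2]; rewrite ge_min; have [h|h] := leP s be.
  by apply/orP; left; apply: hc; rewrite in_itv /= s1.
apply/orP; right.
have := gap_lip be s; rewrite [X in _ <= X]gtr0_norm ?subr_gt0 //.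
by rewrite ler_norml => /andP[? ?]; lra.
Qed.

End GapWindow.

(** * Truncated means *)

Section OneLaw.
Variables (R : realType) (nu : probability (measurableTypeR R) R).

Definition tail (s : R) : R := fine (nu `]s, +oo[%classic).

Lemma tailE s : (tail s)%:E = nu `]s, +oo[%classic.
Proof. by rewrite /tail fineK // fin_num_measure. Qed.

Lemma tail01 s : 0 <= tail s <= 1.
Proof. by rewrite -!lee_fin tailE measure_ge0 probability_le1. Qed.

Lemma tailN s t : s <= t -> tail t <= tail s.
Proof.
move=> st; rewrite -lee_fin !tailE le_measure ?inE //.
by move=> x /=; rewrite !in_itv /= !andbT; exact: le_lt_trans.
Qed.

Hypotheses (fm : finite_mean nu) (nn : on_nonneg nu).

Definition trunc_mean (s : R) : R := \int[nu]_t (Num.min t s).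

Lemma neg_null : nu [set x : R | x < 0] = 0%E.
Proof.
have -> : [set x : R | x < 0] = ~` [set x : R | 0 <= x].
  by apply/seteqP; split=> x /=; [move=> h /(lt_le_trans h); rewrite ltxx|move/negP; rewrite -ltNge].
rewrite probability_setC.
  by rewrite nn subee.
rewrite (_ : [set _ | _] = `[0, +oo[%classic); first exact: measurable_itv.
by apply/seteqP; split=> x /=; rewrite in_itv /= andbT.
Qed.

Lemma neg_measurable : measurable ([set x : R | x < 0] : set (measurableTypeR R)).
Proof.
rewrite (_ : [set _ | _] = `]-oo, 0[%classic); first exact: measurable_itv.
by apply/seteqP; split=> x /=; rewrite in_itv.
Qed.

Lemma nonneg_ae (Q : R -> Prop) : (forall t, 0 <= t -> Q t) -> {ae nu, forall t, Q t}.
Proof.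
move=> h; exists [set x : R | x < 0]; split.
- exact: neg_measurable.
- exact: neg_null.
by move=> t /= hq; rewrite ltNge; apply/negP => /h.
Qed.

Lemma integrable_min s :
  nu.-integrable [set: measurableTypeR R] (EFin \o (fun t : R => Num.min t s)).
Proof.
have i1 : nu.-integrable [set: measurableTypeR R] (EFin \o (fun t : R => `|t| + `|s|)).
  rewrite (_ : _ \o _ = (fun t : R => `|t|%:E + (`|s|)%:E)%E) //.
  apply: integrableD => //.
    exact: (@integrable_norm _ _ _ nu _ (fun t : R => t)).
  exact: finite_measure_integrable_cst.
apply: le_integrable i1 => //.
  by apply/measurable_EFinP; apply: measurable_minr.
move=> t _ /=; rewrite lee_fin (ger0_norm (_ : 0 <= `|t| + `|s|)) ?addr_ge0 //.
by rewrite /Num.min; case: ifP => _; rewrite ?lerDl ?lerDr.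
Qed.

Lemma Rintegral_indic_tail s c : \int[nu]_t (c * \1_(`]s, +oo[%classic) t) = c * tail s.
Proof.
rewrite RintegralZl //; last exact: integrable_indic.
by rewrite /Rintegral integral_indic // setIT.
Qed.

(** The increment of the truncation is [t - s] above [t], 0 below [s], and in between lies between
    these two; integration gives both bounds. *)
Lemma trunc_meanE (s t : R) : s <= t ->
  (t - s) * tail t <= trunc_mean t - trunc_mean s <= (t - s) * tail s.
Proof.
move=> st; rewrite /trunc_mean -RintegralB //; try exact: integrable_min.
have iB : nu.-integrable [set: measurableTypeR R]
    (EFin \o (fun x : R => Num.min x t - Num.min x s)).
  rewrite (_ : _ \o _ = (fun x : R => (Num.min x t)%:E - (Num.min x s)%:E)%E) //.
  by apply: integrableB => //; exact: integrable_min.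
have iI u c : nu.-integrable [set: measurableTypeR R]
    (EFin \o (fun x : R => c * \1_(`]u, +oo[%classic) x)).
  rewrite (_ : _ \o _ = (fun x : R => c%:E * (\1_(`]u, +oo[%classic) x)%:E)%E) //.
  by apply: integrableZl => //; exact: integrable_indic.
rewrite -!Rintegral_indic_tail; apply/andP; split; apply: le_Rintegral => // x _.
  rewrite indicE; have [xt|xt] := ltP t x.
    rewrite mem_set /=; last by rewrite in_itv /= xt.
    by rewrite mulr1 (min_idPr (le_trans st (ltW xt))).
  rewrite memNset /=; last by rewrite in_itv /= andbT; apply/negP; rewrite -leNgt.
  by rewrite mulr0 subr_ge0 ge_min lexx.
rewrite indicE; have [xs|xs] := ltP s x.
  rewrite mem_set /=; last by rewrite in_itv /= xs.
  by rewrite mulr1 lerB // ge_min lexx orbT.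
rewrite memNset /=; last by rewrite in_itv /= andbT; apply/negP; rewrite -leNgt.
by rewrite mulr0 (min_idPl (le_trans xs st)) subrr.
Qed.

Lemma trunc_mean_neg (s : R) : s <= 0 -> trunc_mean s = s.
Proof.
move=> s0; rewrite /trunc_mean /Rintegral.
rewrite (ae_eq_integral (cst s%:E)) //.
- rewrite integral_cst //; transitivity (fine (s%:E * 1)%E); last by rewrite mule1.
  by congr (fine (_ * _)%E); exact: probability_setT.
- by apply: measurable_int; exact: integrable_min.
- by apply: nonneg_ae => t t0 _; rewrite (min_idPr (le_trans s0 t0)).
Qed.

Lemma trunc_mean_mono s t : s <= t -> trunc_mean s <= trunc_mean t.
Proof.
move=> st; have /andP[h _] := trunc_meanE st; rewrite -subr_ge0.
by apply: le_trans h; rewrite mulr_ge0 ?subr_ge0 //; have /andP[] := tail01 t.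
Qed.

Lemma trunc_mean_ge0 s : 0 <= s -> 0 <= trunc_mean s.
Proof. by move=> /trunc_mean_mono; rewrite (trunc_mean_neg (lexx 0)). Qed.

Lemma trunc_mean_le s : trunc_mean s <= \int[nu]_t `|t|.
Proof.
apply: le_Rintegral => //.
- exact: integrable_min.
- exact: (@integrable_norm _ _ _ nu _ (fun t : R => t)).
- by move=> t _; rewrite ge_min ler_norm.
Qed.

End OneLaw.

Section TwoLaws.
Variables (R : realType) (nu nu' : probability (measurableTypeR R) R).

Lemma tail_determines : tail nu =1 tail nu' ->
  forall A : set (measurableTypeR R), measurable A -> nu A = nu' A.
Proof.
move=> h; have ht s : nu `]s, +oo[%classic = nu' `]s, +oo[%classic.
  by rewrite -!tailE h.
pose g (n : nat) : set (measurableTypeR R) := `](- n.+1%:R)%R, n.+1%:R]%classic.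
move=> A mA; apply: (@measure_unique _ R (measurableTypeR R) (@ocitv R) g) => //.
- exact: ocitvI.
- move=> n; apply/ocitvP; right; exists (- n.+1%:R, n.+1%:R) => //=.
  by have := ltr0Sn R n; lra.
- apply/seteqP; split => // x _ /=; exists (Num.truncn `|x|) => //=.
  have : `|x| < (Num.truncn `|x|).+1%:R by exact: truncnS_gt.
  by rewrite /g /= in_itv /= ltr_norml => /andP[-> /ltW ->].
- move=> C /ocitvP[->|[[a b] /= ab ->]]; first by rewrite !measure0.
  have hE (m : probability (measurableTypeR R) R) :
      (m `]a, +oo[%classic = m `]a, b]%classic + m `]b, +oo[%classic)%E.
    rewrite -measureU //.
      congr (m _); apply/seteqP; split=> x /=; rewrite !in_itv /= !andbT.
        by move=> ax; case: (leP x b) => xb; [left; rewrite ax|right].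
      by case=> [/andP[]//|]; exact: lt_trans.
    apply/seteqP; split => // x /=; rewrite !in_itv /= andbT => -[/andP[_ xb]].
    by move=> /(le_lt_trans xb); rewrite ltxx.
  have := hE nu; rewrite ht hE ht => /eqP.
  by rewrite eq_sym; move/eqP/(congr1 (fun z => z - nu' `]b, +oo[%classic)%E);
    rewrite !addeK // fin_num_measure.
- by move=> n; rewrite ltey_eq fin_num_measure //; exact: measurable_itv.
Qed.

Hypotheses (fm : finite_mean nu) (nn : on_nonneg nu).
Hypotheses (fm' : finite_mean nu') (nn' : on_nonneg nu').

(** Right continuity of the tail, by continuity of the measure along the rays starting at
    [s + n.+1%:R^-1]. *)
Lemma tail_rc (m : probability (measurableTypeR R) R) (s c : R) :
  (forall t, s < t -> tail m t <= c) -> tail m s <= c.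
Proof.
move=> h; rewrite -lee_fin tailE.
pose F (n : nat) : set (measurableTypeR R) := `](s + n.+1%:R^-1), +oo[%classic.
have mF n : measurable (F n) by exact: measurable_itv.
have eF : `]s, +oo[%classic = \bigcup_n F n.
  apply/seteqP; split=> x /=; rewrite !in_itv /= andbT.
    move=> sx; exists (Num.truncn (x - s)^-1) => //=; rewrite /F /= in_itv /= andbT.
    rewrite -ltrBrDl -[ltRHS]invrK ltf_pV2 ?posrE ?invr_gt0 ?subr_gt0 //.
    exact: truncnS_gt.
  move=> [n _]; rewrite /F /= in_itv /= andbT; apply: lt_trans.
  by rewrite ltrDl invr_gt0.
have ndF : nondecreasing_seq F.
  move=> n k nk; apply/subsetPset => x; rewrite /F /= !in_itv /= !andbT.
  by apply: le_lt_trans; rewrite lerD2l lef_pV2 ?posrE // ler_nat.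
have := nondecreasing_cvg_mu (mu := m) mF _ ndF; rewrite -eF => /(_ (measurable_itv _)) hc.
apply: (cvge_to_le hc); near=> n => /=.
by rewrite -tailE lee_fin; apply: h; rewrite ltrDl invr_gt0.
Unshelve. all: by end_near. Qed.

(** Truncation at [s] is concave and nondecreasing, which gives the sign. If the gap vanished
    identically, the slope bounds would squeeze the tails of the two laws together up to right
    continuity, and equal tails mean equal laws. *)
Lemma gap_pos_exists : strictly_more_variable nu' nu ->
  (forall s, 0 <= trunc_mean nu s - trunc_mean nu' s) /\
  exists s, 0 < trunc_mean nu s - trunc_mean nu' s.
Proof.
move=> [mv neq].
have ge0 s : 0 <= trunc_mean nu s - trunc_mean nu' s.
  rewrite subr_ge0 /trunc_mean /Rintegral fine_le //.
  - by apply: integrable_fin_num => //; exact: integrable_min.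
  - by apply: integrable_fin_num => //; exact: integrable_min.
  apply: (mv (fun t => Num.min t s)); try exact: integrable_min.
    move=> t x y /andP[t0 t1]; rewrite le_min.
    have t1' : 0 <= 1 - t by rewrite subr_ge0.
    have h a b : Num.min a s <= b -> t * Num.min a s <= t * b by move=> ?; rewrite ler_wpM2l.
    have x1 : Num.min x s <= x /\ Num.min x s <= s by rewrite !ge_min !lexx orbT.
    have y1 : Num.min y s <= y /\ Num.min y s <= s by rewrite !ge_min !lexx orbT.
    move: x1 y1 => [x1 x2] [y1 y2]; apply/andP; split.
      by rewrite lerD // ler_wpM2l.
    rewrite [leRHS](_ : s = t * s + (1 - t) * s).
      by rewrite lerD // ler_wpM2l.
    by rewrite -mulrDl addrC subrK mul1r.
  by move=> x y xy; rewrite le_min !ge_min xy /= lexx orbT.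
split => //; apply: contrapT => h; apply: neq.
have eq s : trunc_mean nu s = trunc_mean nu' s.
  apply/eqP; rewrite -subr_eq0 eq_le ge0 andbT leNgt; apply/negP => hs.
  by apply: h; exists s.
have le_tail (m m' : probability (measurableTypeR R) R) : finite_mean m -> finite_mean m' ->
    trunc_mean m =1 trunc_mean m' -> forall s, tail m s <= tail m' s.
  move=> f f' e s; apply: tail_rc => t st.
  have /andP[h1 _] := trunc_meanE f (ltW st).
  have /andP[_ h2] := trunc_meanE f' (ltW st).
  rewrite !e in h1; have := le_trans h1 h2.
  by rewrite ler_pM2l // subr_gt0.
move=> A mA; apply/esym; apply: tail_determines => // s.
apply/eqP; rewrite eq_le !le_tail //; exact: fsym eq.
Qed.

End TwoLaws.

(** * Discretized laws *)

Section Grid.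
Variables (R : realType) (m : nat).

Let M : nat := m.+1.

(** The grid has mesh [1 / M] and largest value [M], so one parameter controls both rounding and
    truncation. *)
Definition grid := (M * M).+1.

Definition gidx (t : R) : 'I_grid := inord (minn (Num.truncn (M%:R * t)) (M * M)).

Definition gval (i : 'I_grid) : R := i%:R / M%:R.

Definition disc (t : R) : R := gval (gidx t).

Let M0 : 0 < M%:R :> R. Proof. exact: ltr0Sn. Qed.

Lemma gidxE t : gidx t = minn (Num.truncn (M%:R * t)) (M * M) :> nat.
Proof. by rewrite /gidx inordK // /grid ltnS geq_minr. Qed.

Lemma gval_ge0 i : 0 <= gval i. Proof. by rewrite divr_ge0. Qed.

Lemma gval_le i : gval i <= M%:R.
Proof. by rewrite ler_pdivrMr // -natrM ler_nat -ltnS. Qed.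

Lemma disc_ge0 t : 0 <= disc t. Proof. exact: gval_ge0. Qed.

Lemma disc_le t : 0 <= t -> disc t <= t.
Proof.
move=> t0; rewrite /disc /gval ler_pdivrMr // gidxE.
apply: (@le_trans _ _ (Num.truncn (M%:R * t))%:R); first by rewrite ler_nat geq_minl.
by rewrite mulrC Num.Theory.truncn_le mulr_ge0.
Qed.

Lemma disc_neg t : t < 0 -> disc t = 0.
Proof.
move=> t0; rewrite /disc /gval gidxE (_ : Num.truncn _ = 0%N) ?min0n ?mul0r //.
apply/eqP; rewrite -leqn0 truncn_le_nat.
by apply: lt_trans ltr01; rewrite pmulr_rlt0.
Qed.

Lemma disc_close t : 0 <= t <= M%:R -> t - disc t <= M%:R^-1.
Proof.
move=> /andP[t0 tM]; have tM0 : 0 <= M%:R * t by rewrite mulr_ge0.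
rewrite /disc /gval gidxE (minn_idPl _); last first.
  rewrite -(ler_nat R) natrM; apply: (@le_trans _ _ (M%:R * t)).
    by rewrite Num.Theory.truncn_le.
  by rewrite ler_wpM2l.
rewrite lerBlDr -[X in X + _]mul1r -mulrDl ler_pdivlMr // [t * _]mulrC nat1r; apply/ltW.
exact: truncnS_gt.
Qed.

Lemma disc_err_le t : `|t - disc t| <= `|t|.
Proof.
have [t0|t0] := leP 0 t; last by rewrite disc_neg // subr0.
rewrite ger0_norm ?subr_ge0 ?disc_le // (ger0_norm t0) gerBl; exact: disc_ge0.
Qed.

Lemma gidx_measurable i :
  measurable (gidx @^-1` [set i] : set (measurableTypeR R)).
Proof.
pose B j := [set t : measurableTypeR R | (gidx t <= j)%N].
have mB j : measurable (B j).
  have [h|h] := leqP (M * M) j.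
    rewrite (_ : B j = setT) //; apply/seteqP; split => // t _.
    by rewrite /B /=; apply: leq_trans h; rewrite gidxE geq_minr.
  rewrite (_ : B j = `]-oo, (j.+1%:R / M%:R)[%classic); first exact: measurable_itv.
  by apply/seteqP; split => t; rewrite /B /= gidxE in_itv /= geq_min [(M * M <= j)%N]leqNgt h orbF truncn_le_nat ltr_pdivlMr // [t * _]mulrC.
have [i0|i0] := posnP i.
  rewrite (_ : _ @^-1` _ = B 0%N) //; apply/seteqP; split => t; rewrite /B /=.
    by move=> ->; rewrite i0.
  by rewrite leqn0 => /eqP h; apply: val_inj; rewrite /= h i0.
rewrite (_ : _ @^-1` _ = B i `\` B i.-1); first exact: measurableD.
apply/seteqP; split => t; rewrite /B /=.
  by move=> ->; split => //; rewrite -ltnS prednK // ltnn.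
by move=> [h1 /negP]; rewrite -ltnNge prednK // => h2; apply: val_inj; apply/eqP; rewrite eqn_leq h1.
Qed.

Lemma gidx_sum (H : 'I_grid -> R) t :
  H (gidx t) = \sum_i H i * \1_(gidx @^-1` [set i]) t.
Proof.
rewrite (bigD1 (gidx t)) //= indicE mem_set // mulr1 big1 ?addr0 // => i it.
by rewrite indicE memNset ?mulr0 //= => h; rewrite h eqxx in it.
Qed.

Variable nu : probability (measurableTypeR R) R.

Definition glaw (i : 'I_grid) : R := fine (nu (gidx @^-1` [set i])).

Lemma gidx_integrable (H : 'I_grid -> R) :
  nu.-integrable [set: measurableTypeR R] (EFin \o (fun t : R => H (gidx t))).
Proof.
rewrite (_ : _ \o _ = (fun t : R =>
    \sum_(i < grid) (H i)%:E * (\1_(gidx @^-1` [set i]) t)%:E)%E); last first.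
  by apply/funext => t /=; rewrite gidx_sum -sumEFin.
apply: integrable_sum => // i _; apply: integrableZl => //.
by apply: integrable_indic; exact: gidx_measurable.
Qed.

Lemma Rintegral_gidx (H : 'I_grid -> R) :
  \int[nu]_t H (gidx t) = \sum_i glaw i * H i.
Proof.
rewrite /Rintegral (eq_integral (fun t : measurableTypeR R =>
    \sum_(i < grid) (H i)%:E * (\1_(gidx @^-1` [set i]) t)%:E)%E); last first.
  by move=> t _; rewrite gidx_sum -sumEFin.
have mi i : measurable (gidx @^-1` [set i] : set (measurableTypeR R)).
  exact: gidx_measurable.
rewrite integral_sum //; last first.
  by move=> i; apply: integrableZl => //; exact: integrable_indic.
have hi i : (\int[nu]_t ((H i)%:E * (\1_(gidx @^-1` [set i]) t)%:E) = (glaw i * H i)%:E)%E.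
  rewrite integralZl //; last exact: integrable_indic.
  by rewrite integral_indic // setIT mulrC EFinM /glaw fineK // fin_num_measure.
by under eq_bigr do rewrite hi; rewrite sumEFin.
Qed.

Lemma glaw_is_law : is_law glaw.
Proof.
split=> [i|]; first by rewrite fine_ge0.
transitivity (\int[nu]_t (1 : R)).
  by rewrite (Rintegral_gidx (fun=> 1)); apply: eq_bigr => i _; rewrite mulr1.
rewrite Rintegral_cst // mul1r.
exact: (congr1 fine (@probability_setT _ _ _ nu)).
Qed.

Hypotheses (fm : finite_mean nu) (nn : on_nonneg nu).

Definition disc_err : R := \int[nu]_t `|t - disc t|.

Lemma disc_integrable :
  nu.-integrable [set: measurableTypeR R] (EFin \o disc).
Proof. exact: gidx_integrable. Qed.

Lemma disc_err_integrable :
  nu.-integrable [set: measurableTypeR R] (EFin \o (fun t : R => `|t - disc t|)).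
Proof.
apply: (@integrable_norm _ _ _ nu _ (fun t : R => t - disc t)).
rewrite (_ : _ \o _ = (fun t : R => t%:E - (disc t)%:E)%E) //.
by apply: integrableB => //; exact: disc_integrable.
Qed.

Lemma disc_err_ge0 : 0 <= disc_err.
Proof. exact: Rintegral_ge0. Qed.

Lemma glaw_trunc_mean (s : R) :
  `|\sum_i glaw i * Num.min (gval i) s - trunc_mean nu s| <= disc_err.
Proof.
have i1 := gidx_integrable (fun i => Num.min (gval i) s).
have i2 := integrable_min fm s.
rewrite -(Rintegral_gidx (fun i => Num.min (gval i) s)) /trunc_mean.
rewrite -RintegralB //.
have i3 : nu.-integrable [set: measurableTypeR R]
    (EFin \o (fun t : R => Num.min (disc t) s - Num.min t s)).
  rewrite (_ : _ \o _ =
    (fun t : R => (Num.min (disc t) s)%:E - (Num.min t s)%:E)%E) //.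
  by apply: integrableB.
apply: (le_trans (le_normr_Rintegral _ i3)) => //.
apply: le_Rintegral => //; first exact: integrable_norm i3.
  exact: disc_err_integrable.
move=> t _; rewrite distrC.
move: (disc t) => u; case: (leP u s); case: (leP t s) => ts us //.
- by rewrite !ger0_norm; lra.
- rewrite [leLHS]ler0_norm ?[leRHS]ler0_norm; lra.
- by rewrite subrr normr0.
Qed.

(** Rounding moves a weight in [[0, M]] by at most the mesh, hence by at most [rho]: the tolerance
    doubles. *)
Lemma glaw_near (a rho : R) : 0 <= a -> 0 < rho -> M%:R^-1 <= rho -> a + rho <= M%:R ->
  tail nu (a - rho) - tail nu (a + rho) <= \sum_(i | `|gval i - a| <= 2 * rho) glaw i.
Proof.
move=> a0 rho0 Mrho aM.
have -> : \sum_(i | `|gval i - a| <= 2 * rho) glaw i =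
    \int[nu]_t ((`|disc t - a| <= 2 * rho)%R%:R : R).
  rewrite (Rintegral_gidx (fun i => (`|gval i - a| <= 2 * rho)%R%:R : R)) big_mkcond /=.
  by apply: eq_bigr => i _; case: ifP; rewrite ?mulr1 ?mulr0.
have iI u : nu.-integrable [set: measurableTypeR R]
    (EFin \o (fun x : R => \1_(`]u, +oo[%classic) x)) by exact: integrable_indic.
have tI u : \int[nu]_x (\1_(`]u, +oo[%classic) x) = tail nu u.
  by rewrite /Rintegral integral_indic // setIT.
rewrite -!tI -RintegralB //; apply: le_Rintegral => //.
- rewrite (_ : _ \o _ = (fun t : R => (\1_(`]a - rho, +oo[%classic) t)%:E -
     (\1_(`]a + rho, +oo[%classic) t)%:E)%E) //.
  by apply: integrableB => //; exact: iI.
- exact: (gidx_integrable (fun i => (`|gval i - a| <= 2 * rho)%R%:R : R)).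
move=> t _; rewrite !indicE.
have inE' u : (t \in `]u, +oo[%classic) = (u < t).
  by apply/idP/idP => [/set_mem /=|h]; [|apply/mem_set => /=]; rewrite in_itv /= andbT.
rewrite !inE'; have [t1|t1] := ltP (a - rho) t; last first.
  by rewrite sub0r (@le_trans _ _ 0) // oppr_le0.
have [t2|t2] := ltP (a + rho) t; first by rewrite subrr.
rewrite subr0; suff -> : `|disc t - a|%R <= 2 * rho by [].
have [t0|t0] := leP 0 t.
  have tM : 0 <= t <= M%:R by rewrite t0 (le_trans t2).
  have := disc_close tM; have := disc_le t0.
  by rewrite ler_norml => *; apply/andP; split; lra.
by rewrite disc_neg // sub0r normrN ger0_norm //; lra.
Qed.

End Grid.

Section Limit.
Variables (R : realType) (nu : probability (measurableTypeR R) R).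
Hypotheses (fm : finite_mean nu) (nn : on_nonneg nu).

(** Dominated convergence: the error never exceeds the weight, which has finite mean. *)
Lemma disc_err_cvg : disc_err m nu @[m --> \oo] --> (0 : R).
Proof.
have i1 m := disc_err_integrable m fm.
have ig : nu.-integrable [set: measurableTypeR R] (EFin \o (fun t : R => `|t|)).
  exact: (@integrable_norm _ _ _ nu _ (fun t : R => t)).
have [||_ _] := dominated_convergence (mu := nu) measurableT (f := cst 0%E)
    (f_ := fun m t => `|t - disc m t|%:E) (fun m => measurable_int _ (i1 m))
    (measurable_cst _) _ ig _.
- apply: (nonneg_ae nn) => t t0 _; apply/fine_cvgP; split; first by near=> n.
  apply/cvgrPdist_le => eps eps0; near=> n => /=; rewrite sub0r normrN normr_id.
  rewrite ger0_norm ?subr_ge0 ?disc_le //.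
  have nt : t <= n.+1%:R.
    near: n; exists (Num.truncn t) => // n /= hn.
    by apply/ltW/(lt_le_trans (truncnS_gt t)); rewrite ler_nat.
  apply: (@le_trans _ _ n.+1%:R^-1); first by apply: disc_close; rewrite t0.
  near: n; exists (Num.truncn eps^-1) => // n /= hn.
  rewrite -(invrK eps) lef_pV2 ?posrE ?invr_gt0 //.
  by apply/ltW/(lt_le_trans (truncnS_gt _)); rewrite ler_nat.
- by apply: aeW => t n _ /=; rewrite lee_fin normr_id disc_err_le.
rewrite integral0 => h; apply: (@cvg_trans _ (fine (\int[nu]_x `|x - disc m x|%:E) @[m --> \oo])) => //.
by apply: fine_cvg.
Unshelve. all: by end_near. Qed.

End Limit.

(** * Means of functions of discretized independent weights *)

Section IidGrid.
Variables (R : realType) (G : graph) (d : measure_display) (Om : measurableType d).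
Variables (P : probability Om R) (w : edge G -> {RV P >-> measurableTypeR R}).
Variables (nu : probability (measurableTypeR R) R) (m : nat).
Hypothesis hiid : iid w nu.

Definition cyl (J : {fset edge G}) (a : edge G -> 'I_(grid m)) : set Om :=
  \bigcap_(e in [set` J]) (w e @^-1` (@gidx R m @^-1` [set a e])).

Lemma cyl_measurable J a : measurable (cyl J a).
Proof.
rewrite /cyl bigcap_fset; apply: bigsetI_measurable => e _.
rewrite -[X in measurable X]setTI; apply: measurable_funP => //.
exact: gidx_measurable.
Qed.

Lemma cyl_prob J a : P (cyl J a) = (\prod_(e <- J) @glaw R m nu (a e))%:E.
Proof.
have [ind law] := hiid.
have mg e : measurable (@gidx R m @^-1` [set a e] : set (measurableTypeR R)).
  exact: gidx_measurable.
rewrite /cyl ind // -prodEFin; apply: eq_bigr => e _.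
by have := law e _ (mg e); rewrite /distribution /pushforward /glaw => ->; rewrite fineK // fin_num_measure.
Qed.

Definition updl (l : seq (edge G)) (v : edge G -> R) (om : Om) : edge G -> R :=
  foldl (fun v e => upd v e (disc m (w e om))) v l.

Lemma updlE l v om f : updl l v om f = if f \in l then disc m (w f om) else v f.
Proof.
elim: l v => [//|e l ih] v /=; rewrite ih inE /upd.
by case: eqP => [->|] /=; case: ifP.
Qed.

Variable F : (edge G -> R) -> R.

(** The cylinder over [J] records the values of the edges already summed. The induction splits on
    the value of the next edge and moves it into [J]; independence enters only once [l] is
    exhausted, through [cyl_prob]. *)
Lemma expect_cyl_EE l : uniq l -> forall J a v, (forall e, e \in l -> e \notin J) ->
  P.-integrable setT (fun om => (\1_(cyl J a) om * F (updl l v om))%:E) /\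
  (\int[P]_om (\1_(cyl J a) om * F (updl l v om))%:E =
  (\prod_(e <- J) @glaw R m nu (a e) * EE (@gval R m) (@glaw R m nu) l F v)%:E)%E.
Proof.
elim: l => [|e l ih] /=.
  move=> _ J a v _; split.
    under eq_fun do rewrite mulrC EFinM.
    by apply: integrableZl => //; apply: integrable_indic; exact: cyl_measurable.
  under eq_integral do rewrite mulrC EFinM.
  rewrite integralZl //; last by apply: integrable_indic; exact: cyl_measurable.
  have -> : (\int[P]_om (\1_(cyl J a) om)%:E = (\prod_(e <- J) @glaw R m nu (a e))%:E)%E.
    rewrite integral_indic //; last exact: cyl_measurable.
    by rewrite setIT; exact: cyl_prob.
  by rewrite -EFinM mulrC.
move=> /andP[el ul] J a v hJ.
have eJ : e \notin J by apply: hJ; rewrite mem_head.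
pose ai i f := if f == e then i else a f.
pose g i om := \1_(cyl (e |` J)%fset (ai i)) om * F (updl l (upd v e (gval R i)) om).
have hl f : f \in l -> f \notin (e |` J)%fset.
  move=> fl; rewrite !inE negb_or hJ ?inE ?fl ?orbT // andbT.
  by apply: contraNneq el => <-.
have hg i := ih ul (e |` J)%fset (ai i) (upd v e (gval R i)) hl.
have E : (fun om => (\1_(cyl J a) om * F (updl l (upd v e (disc m (w e om))) om))%:E)
    = (fun om => \sum_i (g i om)%:E)%E.
  apply/funext => om; rewrite sumEFin; congr EFin.
  rewrite (bigD1 (gidx m (w e om))) //= big1 ?addr0; last first.
    move=> i ii; rewrite /g indicE memNset ?mul0r //= => h.
    have := h e; rewrite /= !inE eqxx /ai eqxx => /(_ isT) hi.
    by rewrite hi eqxx in ii.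
  rewrite /g /disc; congr (_ * _); rewrite !indicE; congr (_%:R); congr nat_of_bool.
  apply/idP/idP => /set_mem h; apply/mem_set => f /=.
    rewrite !inE /ai; case: eqP => [->//|_] /=; exact: h.
  move=> fJ; have := h f; rewrite /= !inE fJ orbT /ai => /(_ isT).
  by case: eqP => // fe; rewrite -fe fJ in eJ.
split.
  rewrite E; apply: integrable_sum => // i _; exact: (hg i).1.
rewrite E integral_sum //; last by move=> i; exact: (hg i).1.
rewrite (eq_bigr _ (fun i _ => (hg i).2)) sumEFin; congr EFin; rewrite mulr_sumr; apply: eq_bigr => i _.
rewrite big_fsetU1 //= {1}/ai eqxx [_ * \prod_(_ <- _) _]mulrC -mulrA; congr (_ * _).
rewrite big_seq [RHS]big_seq; apply: eq_bigr => f fJ; rewrite /ai.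
by case: eqP => // fe; rewrite -fe fJ in eJ.
Qed.

Lemma expect_EE l v : uniq l ->
  P.-integrable setT (fun om => (F (updl l v om))%:E) /\
  \int[P]_om F (updl l v om) = EE (@gval R m) (@glaw R m nu) l F v.
Proof.
move=> ul; pose i0 : 'I_(grid m) := ord0.
have := @expect_cyl_EE l ul fset0 (fun=> i0) v; rewrite big_seq_fset0 mul1r.
have c0 : cyl fset0 (fun=> i0) = setT.
  by apply/seteqP; split => // om _ e /=; rewrite inE.
have E : (fun om => (\1_(cyl fset0 (fun=> i0)) om * F (updl l v om))%:E) =
         (fun om => (F (updl l v om))%:E).
  by apply/funext => om; rewrite c0 indicT mul1r.
rewrite E => -[] // h1 h2; split => //.
by rewrite /Rintegral h2.
Qed.

End IidGrid.

(** * Mean passage times *)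

Section Countability.
Variable G : graph.
Hypotheses (hlf : locally_finite G) (hcount : countably_infinite G).

Lemma countable_edges : exists f : edge G -> nat, injective f.
Proof.
have cV : countable [set: vertex G] by rewrite (eq_countable hcount); exact: countableP.
have cE : countable [set: edge G].
  rewrite (_ : [set: edge G] = \bigcup_(x in [set: vertex G]) incident x).
    by apply: bigcup_countable => // x _; apply: finite_set_countable; exact: hlf.
  apply/seteqP; split => // e _; have [x [y be]] := bnd2 e.
  by exists x => //; rewrite /incident /= be !inE eqxx.
have /countable_injP[f fi] := cE.
by exists f => x y; apply: fi; rewrite inE.
Qed.

Lemma countable_vertices : exists f : vertex G -> nat, injective f.
Proof.
have cV : countable [set: vertex G] by rewrite (eq_countable hcount); exact: countableP.
have /countable_injP[f fi] := cV.
by exists f => x y; apply: fi; rewrite inE.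
Qed.

Lemma countable_walks : exists f : seq (edge G * vertex G) -> nat, injective f.
Proof.
have [fe fei] := countable_edges; have [fv fvi] := countable_vertices.
exists (fun s => choice.pickle (map (fun p => (fe p.1, fv p.2)) s)).
apply: inj_comp; first exact: (pcan_inj choice.pickleK).
by apply: inj_map => -[e v] [e' v'] [/fei -> /fvi ->].
Qed.

Lemma enumerate (T : choiceType) (f : T -> nat) (S : set T) (x0 : T) :
  injective f -> S x0 -> exists g : nat -> T, S = range g.
Proof.
move=> fi Sx0; exists (fun n => xget x0 [set x | S x /\ f x = n]).
apply/seteqP; split => x.
  move=> Sx; exists (f x) => //; case: xgetP => [y -> [_ /fi //]|/(_ x)].
  by case.
by move=> [n _ <-]; case: xgetP => [y -> []|].
Qed.

End Countability.

Section Measurability.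
Variables (R : realType) (G : graph).
Hypotheses (hlf : locally_finite G) (hcount : countably_infinite G).

(** For sets unbounded below both sides take the default value 0, so measurability of the passage
    time needs no case distinction on the sign of the weights. *)
Lemma inf_fine (S : set R) : S !=set0 -> inf S = fine (ereal_inf (EFin @` S)).
Proof.
move=> S0; have [lb|nlb] := pselect (has_lbound S).
  by rewrite ereal_inf_EFin.
rewrite inf_out; last by move=> [_].
case e : (ereal_inf (EFin @` S)) => [r| |//].
  exfalso; apply: nlb; exists r => x Sx; rewrite -lee_fin -e.
  by apply: ereal_inf_lbound; exists x.
exfalso; have [x Sx] := S0.
have : (ereal_inf (EFin @` S) <= x%:E)%E by apply: ereal_inf_lbound; exists x.
by rewrite e.
Qed.

(** There are countably many walks, so the passage time is a countable infimum of finite sums. *)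
Lemma measurable_passage (d : measure_display) (Om : measurableType d)
    (u : edge G -> Om -> R) (A : set (edge G)) x y s0 :
  (forall e, measurable_fun [set: Om] (u e)) -> walk_in A x y s0 ->
  measurable_fun [set: Om] (fun om => passage_in A (u^~ om) x y).
Proof.
move=> mu /walk_in_simple[s1 ss1 _].
have [f fi] := countable_walks hlf hcount.
have [g gE] := @enumerate _ f (simple_in A x y) s1 fi ss1.
have E om : passage_in A (u^~ om) x y =
    fine (einfs (fun n => (cost (u^~ om) (g n))%:E) 0).
  rewrite /passage_in inf_fine; last by exists (cost (u^~ om) s1), s1.
  congr (fine (ereal_inf _)); rewrite gE; apply/seteqP; split => z /=.
    by move=> [_ [_ [n _ <-] <-] <-]; exists n.
  by move=> [n _ <-]; exists (cost (u^~ om) (g n)) => //; exists (g n) => //; exists n.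
rewrite (_ : (fun om => _) = fine \o
    (fun om => einfs (fun n => (cost (u^~ om) (g n))%:E) 0)); last exact/funext.
apply: measurableT_comp => //.
apply: (measurable_fun_einfs (f := fun n om => (cost (u^~ om) (g n))%:E)) => n.
by apply/measurable_EFinP; apply: measurable_sum => p; exact: mu.
Qed.

End Measurability.

Section Expectation.
Variables (R : realType) (G : graph).
Hypotheses (hlf : locally_finite G) (hcount : countably_infinite G).
Variables (d : measure_display) (Om : measurableType d) (P : probability Om R).
Variables (w : edge G -> {RV P >-> measurableTypeR R}).
Variable nu : probability (measurableTypeR R) R.
Hypotheses (hiid : iid w nu) (fm : finite_mean nu) (nn : on_nonneg nu).

Lemma law_integral e (f : measurableTypeR R -> \bar R) :
  measurable_fun setT f -> (forall t, 0 <= f t)%E ->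
  (\int[P]_om f (w e om) = \int[nu]_t f t)%E.
Proof.
move=> mf f0; rewrite -(ge0_integral_distribution (w e) mf f0).
by apply: eq_measure_integral => A mA _; exact: hiid.2.
Qed.

Lemma weight_integrable e : P.-integrable [set: Om] (EFin \o w e).
Proof.
apply/integrableP; split; first by apply/measurable_EFinP; exact: (measurable_funP (w e)).
rewrite (law_integral e (f := fun t => `|t%:E|%E)) //.
  by have /integrableP[_] := fm.
by apply: measurableT_comp => //; exact/measurable_EFinP.
Qed.

Lemma weights_nonneg_ae (Q : Om -> Prop) :
  (forall om, (forall e, 0 <= w e om) -> Q om) -> {ae P, forall om, Q om}.
Proof.
move=> hQ; have [f fi] := countable_edges hlf hcount.
pose N n := [set om | exists e, f e = n /\ w e om < 0].
have : P.-negligible (\bigcup_n N n).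
  apply: negligible_bigcup => n.
  have [[e en]|ne] := pselect (exists e, f e = n); last first.
    by apply: (negligibleS _ (negligible_set0 P)) => om [e [en _]]; apply: ne; exists e.
  exists (w e @^-1` [set x : R | x < 0]); split.
  - by rewrite -[X in measurable X]setTI; apply: measurable_funP => //; exact: neg_measurable.
  - by have := hiid.2 e _ (@neg_measurable R); rewrite neg_null.
  - by move=> om [e' [e'n]]; rewrite -en in e'n; rewrite (fi _ _ e'n).
apply: negligibleS => om /= hom; apply: contrapT => hn; apply: hom; apply: hQ => e.
rewrite leNgt; apply/negP => we; apply: hn; exists (f e) => //.
by exists e.
Qed.

(** Almost surely equal to the weights, but nonnegative at every [om], so that the deterministic
    estimates hold pointwise. *)
Definition wpos (om : Om) (e : edge G) : R := Num.max (w e om) 0.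

Lemma wpos_ge0 om e : 0 <= wpos om e.
Proof. by rewrite le_max lexx orbT. Qed.

Lemma measurable_wpos e : measurable_fun [set: Om] (fun om => wpos om e).
Proof. by apply: measurable_maxr => //; exact: (measurable_funP (w e)). Qed.

Lemma wpos_le om e : wpos om e <= `|w e om|.
Proof. by rewrite ge_max ler_norm normr_ge0. Qed.

Variables (x y : vertex G) (s0 : seq (edge G * vertex G)).

Definition mean_passage (A : set (edge G)) : R :=
  \int[P]_om passage_in A (wpos om) x y.

Lemma passage_integrable A : walk_in A x y s0 ->
  P.-integrable [set: Om] (fun om => (passage_in A (wpos om) x y)%:E).
Proof.
move=> h0; have : P.-integrable [set: Om] (fun om => (\sum_(p <- s0) `|w p.1 om|%:E)%E).
  apply: integrable_sum => // p _.
  exact: (integrable_norm (weight_integrable p.1)).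
apply: le_integrable => //.
  apply/measurable_EFinP; apply: (measurable_passage hlf hcount (u := fun e om => wpos om e) _ h0).
  exact: measurable_wpos.
move=> om _; rewrite sumEFin /= lee_fin.
have w0 := wpos_ge0 om.
rewrite ger0_norm; last exact: passage_in_ge0 w0 h0.
rewrite ger0_norm ?sumr_ge0 //; apply: (le_trans (passage_in_le w0 h0)).
by apply: ler_sum => p _; exact: wpos_le.
Qed.

Lemma expectation_passage : walk_in setT x y s0 ->
  ('E_P[fun om => passage_time (fun e => w e om) x y])%E = (mean_passage setT)%:E.
Proof.
move=> h0; have int1 := passage_integrable h0.
rewrite /mean_passage /Rintegral fineK; last exact: integrable_fin_num.
rewrite expectation.unlock; apply: ae_eq_integral => //.
- apply/measurable_EFinP; under eq_fun do rewrite passage_inT.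
  by apply: (measurable_passage hlf hcount (u := fun e om => w e om) _ h0) => e; exact: (measurable_funP (w e)).
- exact: measurable_int int1.
- apply: weights_nonneg_ae => om w0 _; rewrite passage_inT; congr (_%:E).
  by congr (passage_in _ _ _ _); apply/funext => e; rewrite /wpos max_l.
Qed.

(** The passage time is Lipschitz in each weight. The error grows with the number of edges, so [m]
    has to be chosen after [A]. *)
Lemma mean_passage_EE (A : {fset edge G}) m : walk_in [set` A] x y s0 ->
  `|mean_passage [set` A] - EE (@gval R m) (@glaw R m nu) (enum_fset A)
      (fun v => passage_in [set` A] v x y) (fun=> 0)| <=
  (#|` A|)%:R * disc_err m nu.
Proof.
move=> h0; have uA : uniq (enum_fset A) by exact: fset_uniq.
have [i1 <-] := expect_EE m hiid (fun v => passage_in [set` A] v x y) (fun=> 0) uA.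
have i2 := passage_integrable h0.
rewrite /mean_passage -RintegralB //.
have i3 : P.-integrable [set: Om] (EFin \o (fun om => passage_in [set` A] (wpos om) x y -
    passage_in [set` A] (updl w m (enum_fset A) (fun=> 0) om) x y)).
  rewrite (_ : _ \o _ = (fun om => (passage_in [set` A] (wpos om) x y)%:E -
    (passage_in [set` A] (updl w m (enum_fset A) (fun=> 0) om) x y)%:E)%E) //.
  exact: integrableB.
apply: (le_trans (le_normr_Rintegral _ i3)) => //.
have ie e : P.-integrable [set: Om] (fun om => (`|w e om - disc m (w e om)|)%:E).
  have k1 : measurable_fun setT (fun t : measurableTypeR R => `|t - disc m t|%:E).
    exact: measurable_int (disc_err_integrable m fm).
  apply/integrableP; split.
    exact: (measurableT_comp k1 (measurable_funP (w e))).
  rewrite (law_integral e (f := fun t => `| `|t - disc m t|%:E |%E)) //.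
    by have /integrableP[_] := disc_err_integrable m fm.
  exact: measurableT_comp.
have ee e : \int[P]_om `|w e om - disc m (w e om)| = disc_err m nu.
  rewrite /disc_err /Rintegral.
  rewrite (law_integral e (f := fun t => (`|t - disc m t|)%:E)) //.
  exact: measurable_int (disc_err_integrable m fm).
apply: (@le_trans _ _ (\int[P]_om \sum_(e <- A) `|w e om - disc m (w e om)|)).
  apply: le_Rintegral => //; first exact: integrable_norm i3.
    rewrite (_ : _ \o _ = (fun om => \sum_(e <- A) `|w e om - disc m (w e om)|%:E)%E).
      by apply: integrable_sum => // e _; exact: ie.
    by apply/funext => om /=; rewrite sumEFin.
  move=> om _.
  set v := updl _ _ _ _ _.
  have v0 e : 0 <= v e by rewrite /v updlE; case: ifP => // _; exact: disc_ge0.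
  have w0 := wpos_ge0 om.
  have hA u u' : forall e, [set` A] e -> e \in enum_fset A \/ u e = u' e :> R by move=> e; left.
  have l1 := passage_in_lip v0 h0 (hA (wpos om) v).
  have l2 := passage_in_lip w0 h0 (hA v (wpos om)).
  have hle e : e \in A -> `|wpos om e - v e| <= `|w e om - disc m (w e om)|.
    move=> eA; rewrite /v updlE eA /wpos; have [//|w1] := leP 0 (w e om).
    by rewrite disc_neg // subrr normr0.
  have s1 : \sum_(e <- enum_fset A) `|wpos om e - v e| <=
      \sum_(e <- A) `|w e om - disc m (w e om)|.
    by rewrite big_seq [leRHS]big_seq; apply: ler_sum => e; exact: hle.
  have s2 : \sum_(e <- enum_fset A) `|v e - wpos om e| <=
      \sum_(e <- A) `|w e om - disc m (w e om)|.
    by under eq_bigr do rewrite distrC; exact: s1.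
  rewrite ler_norml; apply/andP; split; lra.
rewrite /Rintegral.
under eq_integral do rewrite -sumEFin.
have ee' e : (\int[P]_om (`|w e om - disc m (w e om)|)%:E)%E = (disc_err m nu)%:E.
  by rewrite -(ee e) /Rintegral fineK //; apply: integrable_fin_num => //; exact: ie.
rewrite integral_sum //.
rewrite (eq_bigr _ (fun e _ => ee' e)) sumEFin /=.
by rewrite big_const_seq count_predT iter_addr_0 mulr_natl.
Qed.

Lemma mean_passage_ge (A : set (edge G)) : walk_in A x y s0 ->
  mean_passage setT <= mean_passage A.
Proof.
move=> h0; have hT : walk_in setT x y s0 by case: h0.
apply: le_Rintegral => //; try exact: passage_integrable.
move=> om _; apply: (passage_in_ge h0) => s [[h1 h2 _] _].
by apply: passage_in_le; [exact: wpos_ge0|].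
Qed.

(** Along finite sets exhausting the edges, each near-optimal walk is eventually available; the
    passage time inside [B] dominates. *)
Lemma mean_passage_approx (B : {fset edge G}) (eps : R) : 0 < eps ->
  walk_in [set` B] x y s0 ->
  exists A : {fset edge G}, (B `<=` A)%fset /\
    mean_passage [set` A] <= mean_passage setT + eps.
Proof.
move=> eps0 h0; have [f fi] := countable_edges hlf hcount.
have finS n : finite_set [set e | (f e < n)%N].
  apply: (finite_preimage (f := f) (B := `I_n)) => //.
  by move=> a b _ _; exact: fi.
pose A n := (B `|` fset_set [set e | (f e < n)%N])%fset.
have hA n : walk_in [set` A n] x y s0.
  have [h1 h2 h3] := h0; split => // e /h3 /= eB; by rewrite /A !inE; rewrite /= in eB; rewrite eB.
have hT : walk_in setT x y s0 by case: h0.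
have iA n := passage_integrable (hA n).
have iB := passage_integrable h0.
have [||_ _] := dominated_convergence (mu := P) measurableT
    (f := fun om => (passage_in setT (wpos om) x y)%:E)
    (f_ := fun n om => (passage_in [set` A n] (wpos om) x y)%:E)
    (fun n => measurable_int _ (iA n)) (measurable_int _ (passage_integrable hT))
    _ iB _.
- apply: aeW => om _; apply/fine_cvgP; split; first by near=> n.
  have w0 := wpos_ge0 om.
  apply/cvgrPdist_le => e e0.
  have [_ [s [[h1 h2 _] us] <-] hs] : exists2 r, [set cost (wpos om) s | s in simple_in setT x y] r &
      r < passage_in setT (wpos om) x y + e.
    apply: inf_adherent => //; split; last by exists 0 => _ [s _ <-]; exact: cost_ge0.
    have [s1 ss1 _] := walk_in_simple hT; by exists (cost (wpos om) s1), s1.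
  pose n0 := (\max_(g <- unzip1 s) f g).+1.
  near=> n; have hn : (n0 <= n)%N by near: n; exists n0.
  rewrite /= distrC ger0_norm; last first.
    rewrite subr_ge0; apply: (passage_in_ge (hA n)) => s' [[k1 k2 _] _].
    exact: passage_in_le.
  rewrite lerBlDl; apply: le_trans (ltW hs); apply: passage_in_le => //; split => // g gs.
  rewrite /A /= !inE; apply/orP; right; rewrite in_fset_set // inE /=.
  apply: leq_trans hn.
  by rewrite ltnS; apply: leq_bigmax_seq.
- apply: aeW => om n _; have w0 := wpos_ge0 om.
  rewrite /= lee_fin ger0_norm; last exact: passage_in_ge0 w0 (hA n).
  apply: (passage_in_ge h0) => s [[k1 k2 k3] _]; apply: passage_in_le => //; split => // g /k3 /=.
  by rewrite /A !inE => ->.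
rewrite /= => hc.
have hfin : (\int[P]_om (passage_in setT (wpos om) x y)%:E)%E \is a fin_num.
  by apply: integrable_fin_num => //; exact: passage_integrable hT.
have hc' : (mean_passage [set` A n]) @[n --> \oo] --> mean_passage setT.
  apply: fine_cvg; rewrite /mean_passage /Rintegral fineK //.
have /cvgrPdist_le/(_ _ eps0)[n _ hn] := hc'.
exists (A n); split; first by apply/fsubsetP => e eB; rewrite /A !inE eB.
have := hn n (leqnn n); rewrite /= distrC ler_norml => /andP[_]; lra.
Unshelve. all: by end_near. Qed.

End Expectation.

(** * Blocks along a geodesic path *)

Section Neighbourhoods.
Variable G : graph.
Hypothesis conn : connected_graph G.

Lemma geodesic_fun (x y : vertex G) : (0 < dist x y)%N ->
  exists (V : nat -> vertex G) (E : nat -> edge G),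
  [/\ V 0%N = x, V (dist x y) = y,
      forall j, (j < dist x y)%N -> bnd (E j) = [fset V j; V j.+1]%fset,
      forall j, (j <= dist x y)%N -> dist x (V j) = j &
      forall a b, (a <= b <= dist x y)%N -> dist (V a) (V b) = (b - a)%N].
Proof.
move=> d0; have [s [ws es _ sz]] := dist_path conn x y.
case: s ws es sz => [|p0 s1]; first by move=> _ _ h; rewrite -h in d0.
set s := p0 :: s1 => ws es sz.
pose V j := nth x (x :: unzip2 s) j; pose E j := nth p0.1 (unzip1 s) j.
have VE j : (j <= size s)%N -> V j = wend x (take j s).
  move=> js; rewrite /V /wend (last_nth x) /unzip2 map_take size_take size_map.
  have -> : (if (j < size s)%N then j else size s) = j.
    by case: ltnP => // h; apply/eqP; rewrite eqn_leq h js.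
  by case: j js => [//|j] js; rewrite -[RHS]/(nth x (take j.+1 (unzip2 s)) j) nth_take.
have step j : (j < size s)%N -> bnd (E j) = [fset V j; V j.+1]%fset.
  move=> js; have hw : is_walk x (take j.+1 s).
    by move: ws; rewrite -{1}(cat_take_drop j.+1 s) is_walk_cat => /andP[].
  rewrite (take_nth p0) // in hw.
  case e : (nth p0 s j) hw => [f v]; rewrite is_walk_rcons => /andP[_ /eqP h].
  rewrite VE ?(ltnW js) // VE // (take_nth p0) // e wend_rcons -h /E /unzip1.
  by rewrite (nth_map p0) // e.
have V0 : V 0%N = x by [].
have Vd : V (dist x y) = y by rewrite -sz VE // take_size.
have adj a b : (a <= b <= dist x y)%N -> (dist (V a) (V b) <= b - a)%N.
  move=> /andP[ab]; rewrite -sz => bs.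
  elim: b ab bs => [|b ih] ab bs.
    by move: ab; rewrite leqn0 => /eqP ->; rewrite distxx.
  have [ab'|ab'] := ltnP b a.
    by rewrite (_ : a = b.+1) ?distxx //; lia.
  have h := ih ab' (ltnW bs); have h2 := dist_edge conn (step b bs).
  by have := dist_triangle conn (V b) (V a) (V b.+1); lia.
exists V, E; split => //.
- by move=> j; rewrite -sz; exact: step.
- move=> j jd; have h1 := @adj 0%N j; have h2 := @adj j (dist x y).
  rewrite V0 in h1; rewrite Vd in h2.
  by have := dist_triangle conn (V j) x y; lia.
- move=> a b ab; have h1 := @adj 0%N a; have h2 := @adj b (dist x y).
  have h3 := @adj a b ab; rewrite V0 in h1; rewrite Vd in h2.
  have := dist_triangle conn (V a) x y; have := dist_triangle conn (V b) (V a) y.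
  by lia.
Qed.

Hypothesis hdeg : bounded_degree G.

Lemma incident_list : exists (D : nat) (inc : vertex G -> seq (edge G)),
  forall v, (size (inc v) <= D)%N /\ forall e, v \in bnd e -> e \in inc v.
Proof.
have [D hD] := hdeg; exists D.
have : forall v, exists l : seq (edge G), (size l <= D)%N /\ forall e, v \in bnd e -> e \in l.
  move=> v; have fin : finite_set (incident v).
    by apply: card_le_finite (hD v) _; exact: finite_II.
  exists (enum_fset (fset_set (incident v))); split.
    exact: geq_card_fset_set (hD v).
  by move=> e ve; rewrite -[e \in _]/(e \in fset_set _) in_fset_set // inE.
by move=> /choice[inc h]; exists inc.
Qed.

Lemma size_flatten_le (T U : Type) (f : T -> seq U) (l : seq T) (D : nat) :
  (forall t, (size (f t) <= D)%N) -> (size (flatten (map f l)) <= size l * D)%N.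
Proof.
move=> h; elim: l => [//|t l ih] /=; rewrite size_cat mulSn leq_add //.
Qed.

Lemma ball_list k : exists N, forall o : vertex G, exists l : seq (vertex G),
  (size l <= N)%N /\ forall v, (dist o v <= k)%N -> v \in l.
Proof.
have [D [inc hinc]] := incident_list.
elim: k => [|k [N ih]].
  exists 1%N => o; exists [:: o]; split => // v.
  by rewrite leqn0 => /eqP /(dist_eq0 conn) ->; rewrite mem_head.
exists (N + N * (D * 2))%N => o; have [l [sl hl]] := ih o.
pose nb u := flatten [seq enum_fset (bnd e) | e <- inc u].
exists (l ++ flatten [seq nb u | u <- l]); split.
  rewrite size_cat leq_add //; apply: (leq_trans (size_flatten_le (D := D * 2) _ _)).
    move=> u; apply: (leq_trans (size_flatten_le (D := 2) _ _)).
      by move=> e; rewrite -(card_bnd e).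
    by rewrite leq_mul2r; case: (hinc u) => ->; rewrite orbT.
  by rewrite leq_mul2r sl orbT.
move=> v dv; have [s [ws es us sz]] := dist_path conn o v.
case/lastP: s ws es us sz => [|s [e v']].
  by move=> _ <- _ _; rewrite mem_cat hl // distxx.
rewrite is_walk_rcons wend_rcons size_rcons /= => /andP[ws /eqP be] ev _ sz; subst v.
rewrite mem_cat; apply/orP; right.
have ul : wend o s \in l by apply: hl; have := dist_le conn ws erefl; lia.
apply/flattenP; exists (nb (wend o s)); first exact: map_f.
apply/flattenP; exists (enum_fset (bnd e)).
  by apply: map_f; apply: (hinc _).2; rewrite be !inE eqxx.
by rewrite -[_ \in _]/(v' \in bnd e) be !inE eqxx orbT.
Qed.

(** The bound [N] is uniform in the centre [o], which makes the gain of a block independent of its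
    position. *)
Lemma edges_near k : exists N, forall o : vertex G, exists Lam : {fset edge G},
  (#|` Lam| <= N)%N /\
  forall f, f \in Lam <-> exists2 v, v \in bnd f & (dist o v <= k)%N.
Proof.
have [D [inc hinc]] := incident_list; have [N hN] := ball_list k.
exists (N * D)%N => o; have [l [sl hl]] := hN o.
exists [fset f in [seq f <- flatten [seq inc u | u <- l] |
  `[< exists2 v, v \in bnd f & (dist o v <= k)%N >]]]%fset; split.
  rewrite card_fseq; apply: (leq_trans (size_undup _)).
  rewrite size_filter; apply: (leq_trans (count_size _ _)).
  apply: (leq_trans (size_flatten_le (D := D) _ _)); first by move=> u; case: (hinc u).
  by rewrite leq_mul2r sl orbT.
move=> f; rewrite !inE mem_filter /=; split => [/andP[/asboolP//]|h].
apply/andP; split; first exact/asboolP.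
have [v vf /hl vl] := h; apply/flattenP; exists (inc v); first exact: map_f.
exact: (hinc v).2.
Qed.

End Neighbourhoods.

Section BlockGain.
Variables (R : realType) (G : graph).
Hypothesis conn : connected_graph G.
Variable R0 : nat.
Hypothesis HB : forall x z y : vertex G, (dist x z + dist z y = dist x y)%N ->
  forall s, is_walk x s -> wend x s = y ->
  exists2 v, v \in x :: unzip2 s & (dist z v <= R0)%N.
Variables (al be : R).
Hypotheses (al0 : 0 <= al) (albe : al < be).
Let be0 : 0 < be. Proof. exact: le_lt_trans albe. Qed.
Variables (L C L' : nat).
Let n := (2 * L + C)%N.
Hypotheses (hL : (2 * R0 < L)%N) (C0 : (0 < C)%N) (hL' : (2 * n + R0 < L')%N).
Hypothesis hdet : forall p : gpath G, self_avoiding p -> plen p = C ->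
  exists q, self_avoiding q /\ is_detour ((be - al) / (2 * be)) p q.
Hypothesis hKL : be * (4 * R0 + 2 * C + 1)%:R <= (be - al) * L%:R.

(** Let [k] count the ridge edges that the detour avoids and [l] its new edges. The detour costs
    [al * (l - k)] more, at most [(be - al) / 2 * k] by the choice of the detour quality, and
    [k > 0] since the edge sets differ. That quality is at most 1/2, so [l <= 2 * k], which bounds
    the detour by [2 * C] edges. *)
Lemma detour_segment (x y : vertex G) (r : nat -> vertex G) (re : nat -> edge G) :
  (forall j, (j < n)%N -> bnd (re j) = [fset r j; r j.+1]%fset) ->
  (dist x (r 0) + n + dist (r n) y = dist x y)%N ->
  exists s', [/\ is_walk (r L) s', wend (r L) s' = r (n - L)%N, (size s' <= 2 * C)%N &
    al * ((size s')%:R - (n - L - L)%:R) < (be - al) *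
    (size [seq f <- unzip1 (rseg r re L (n - L - L)) | f \notin unzip1 s'])%:R].
Proof.
move=> hre hgeo; have nLL : (n - L - L = C)%N by rewrite /n; nlia.
have hn : (2 * L < n)%N by rewrite /n; nlia.
have LCn : (L + C <= n)%N by rewrite /n; nlia.
rewrite nLL; set sg := rseg r re L C.
have wsg : is_walk (r L) sg := rseg_walk hre hgeo hL hn hL' LCn.
have usg : uniq (r L :: unzip2 sg).
  have -> : r L :: unzip2 sg = [seq r k | k <- iota L C.+1].
    by rewrite /unzip2 /sg /rseg -map_comp /= -[L.+1]add1n iotaDl -map_comp.
  rewrite map_inj_in_uniq ?iota_uniq // => a b; rewrite !mem_iota => ha hb.
  by apply: (r_inj conn hre hgeo hL hn hL'); nlia.
have ue := uniq_walk_edges wsg usg.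
have [] := hdet (p := (r L, sg)); first by rewrite self_avoidingE wsg.
  by rewrite plenE // size_rseg.
move=> [v s'] [/andP[/= ws' us'] [_ [/= ev es'] ne hle]].
rewrite /pstart /= in ev; subst v; rewrite /pend /= -!/(wend _ _) rseg_end in es'.
set A := pedges (r L, sg) in ne hle; set B := pedges (r L, s') in ne hle.
have ue' := uniq_walk_edges ws' us'.
have cA : #|` A| = C by rewrite -[LHS]/(plen (r L, sg)) plenE // size_rseg.
have cB : #|` B| = size s' by rewrite -[LHS]/(plen (r L, s')) plenE.
have hk : size [seq f <- unzip1 sg | f \notin unzip1 s'] = #|` (A `\` B)%fset|.
  rewrite -(undup_id (s := [seq f <- _ | _])) ?filter_uniq // -card_fseq; congr #|` _|.
  by apply/fsetP => f; rewrite !inE mem_filter.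
set k := #|` (A `\` B)%fset| in hle hk; set l := #|` (B `\` A)%fset| in hle.
have eA : (C = #|` (A `&` B)%fset| + k)%N by rewrite -cA /k cardfsD subnKC // fsubset_leq_card // fsubsetIl.
have eB : (size s' = #|` (A `&` B)%fset| + l)%N.
  by rewrite -cB /l cardfsD [(A `&` B)%fset]fsetIC subnKC // fsubset_leq_card // fsubsetIl.
have k0 : (0 < k)%N.
  rewrite lt0n; apply/eqP => k0; apply: ne; rewrite k0 mulr0 in hle.
  have l0 : l = 0%N by apply/eqP; rewrite -leqn0 -(ler_nat R).
  have AB : (A `\` B)%fset = fset0 by apply/eqP; rewrite -cardfs_eq0 -/k k0.
  have BA : (B `\` A)%fset = fset0 by apply/eqP; rewrite -cardfs_eq0 -/l l0.
  apply/eqP; rewrite eqEfsubset; move/eqP: AB; move/eqP: BA.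
  by rewrite !fsetD_eq0 => -> ->.
have eps1 : (be - al) / (2 * be) <= 2^-1.
  by rewrite invfM mulrCA ler_piMr // ler_pdivrMr // mul1r gerBl.
have k0' : 0 < k%:R :> R by rewrite ltr0n.
exists s'; split => //.
- by rewrite es'; congr (r _); rewrite /n; nlia.
- have : l%:R <= (2 * k)%:R :> R.
    rewrite natrM; apply: (le_trans hle); rewrite ler_wpM2r ?(ltW k0') //; lra.
  by rewrite ler_nat; nlia.
rewrite hk [in C%:R]eA eB !natrD.
have -> : (#|` (A `&` B)%fset|)%:R + l%:R - ((#|` (A `&` B)%fset|)%:R + k%:R) = l%:R - k%:R :> R.
  by lra.
have h1 : al * (l%:R - k%:R) <= al * ((be - al) / (2 * be) * k%:R).
  by rewrite ler_wpM2l //; rewrite mulrDl mul1r in hle; lra.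
have h2 : al * ((be - al) / (2 * be) * k%:R) <= (be - al) / 2 * k%:R.
  rewrite mulrA ler_wpM2r ?(ltW k0') // invfM mulrCA ler_wpM2l ?subr_ge0 ?(ltW albe) //.
  by rewrite mulrCA ler_piMr // ler_pdivrMr // mul1r ltW.
have h3 : 0 < (be - al) * k%:R by rewrite mulr_gt0 // subr_gt0.
by lra.
Qed.

Variables (x y : vertex G) (A : set (edge G)) (s0 : seq (edge G * vertex G)).
Hypothesis hs0 : walk_in A x y s0.
Variables (k : nat) (val : 'I_k -> R) (p q : 'I_k -> R).
Variables (M th rho kap eta del : R) (N : nat).
Hypotheses (val0 : forall i, 0 <= val i) (valM : forall i, val i <= M) (beM : be <= M).
Hypotheses (lp : is_law p) (lq : is_law q).
Hypotheses (th0 : 0 < th) (thb : th <= be - al) (rho0 : 0 <= rho)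
  (rhoN : 8 * N%:R * rho <= th) (kap0 : 0 <= kap) (kap1 : kap <= 1)
  (eta0 : 0 <= eta) (del0 : 0 <= del).
Hypothesis gap_ge : forall s, 0 <= s -> - eta <= law_gap val p q s.
Hypothesis gap_del : forall s, al + th / 2 <= s <= be + 2 * th -> del <= law_gap val p q s.
Hypotheses (near_al : kap <= \sum_(i | `|val i - al| <= 2 * rho) half_law p q i)
  (near_be : kap <= \sum_(i | `|val i - be| <= 2 * rho) half_law p q i).

Let F := fun v : edge G -> R => passage_in A v x y.
Let D := fun (v : edge G -> R) (e : edge G) => threshold A x y M v e.

Let M0 : 0 <= M. Proof. by apply: le_trans beM; exact: ltW. Qed.

Lemma passage_threshold_ge0 w e : nonneg w -> 0 <= D w e.
Proof. by move=> w0; exact: threshold_ge0 w0 M0 hs0. Qed.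

Lemma passage_threshold w e i : nonneg w ->
  F (upd w e (val i)) = F (upd w e 0) + Num.min (val i) (D w e).
Proof.
by move=> w0; apply: (passage_in_threshold e w0 hs0); rewrite val0 valM.
Qed.

(** The weights of the block other than that of [e] are held within [2 * rho] of the configuration.
    With at most [N] edges and a Lipschitz factor 2, the threshold moves by at most
    [4 * N * rho <= th / 2], so it stays where the gap is at least [del]. *)
Lemma block_gain (r : nat -> vertex G) (re : nat -> edge G) (Lam : {fset edge G}) :
  (forall j, (j < n)%N -> bnd (re j) = [fset r j; r j.+1]%fset) ->
  (dist x (r 0) + n + dist (r n) y = dist x y)%N ->
  (forall f, f \in Lam <-> exists2 v, v \in bnd f & (dist (r 0) v <= L')%N) ->
  (#|` Lam| <= N)%N -> (forall f, f \in Lam -> A f) ->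
  forall w, nonneg w ->
  EE val q (enum_fset Lam) F w + (del / 2 * kap ^+ N - eta * N%:R) <=
  EE val p (enum_fset Lam) F w.
Proof.
move=> hre hgeo hLam cLam LamA w w0.
have hn : (2 * L < n)%N by rewrite /n; nlia.
have hLam' f : reflect (exists2 v, v \in bnd f & (dist (r 0) v <= L')%N) (f \in Lam).
  by apply: (iffP idP) => /hLam.
have [s' [ws' es' sz' hlt]] := detour_segment hre hgeo.
have hKL' : be * (4 * R0 + size s' + 1)%:R <= (be - al) * L%:R.
  by apply: le_trans hKL; rewrite ler_wpM2l ?(ltW be0) // ler_nat; nlia.
have sL : {subset unzip1 s' <= Lam}.
  move=> f fs; apply/hLam; have [a [b bf]] := bnd2 f.
  have af : a \in bnd f by rewrite bf !inE eqxx.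
  exists a => //; have av := bnd_mem ws' fs af.
  have [s1 [s2 [e12 ea]]] := split_at av.
  have ws1 : is_walk (r L) s1 by move: ws'; rewrite e12 is_walk_cat => /andP[].
  have := dist_le conn ws1 ea; have := dist_triangle conn (r L) (r 0%N) a.
  have Ln : (0 <= L <= n)%N by rewrite /n; nlia.
  have := rdist conn hre hgeo hL hn hL' Ln.
  rewrite e12 size_cat in sz' => h1 h2 h3.
  have h4 : (dist (r 0%N) a <= L + size s1)%N by move: h1 h2 h3; nlia.
  by apply: (leq_trans h4); move: hL' sz'; rewrite /n; nlia.
have [e [c [eL hc /andP[hD1 hD2]]]] := block_configuration conn HB hre hgeo hLam' LamA
  hL hn hL' al0 albe hs0 w0 beM (ltW th0) thb hKL' ws' es' sL hlt.
set E := enum_fset Lam; have uE : uniq E by exact: fset_uniq.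
have eE : e \in E by [].
rewrite !(EE_front val _ F w uE eE).
have uel : uniq (e :: rem e E).
  by rewrite /= mem_rem_uniq // inE eqxx /= rem_uniq.
have memE f : f \in rem e E -> f \in Lam /\ f != e.
  by rewrite mem_rem_uniq // inE => /andP[-> fE].
have szl : (size (rem e E)).+1 = #|` Lam|.
  rewrite size_rem // prednK //; last by rewrite -has_predT; apply/hasP; exists e.
have H := EE_block_gain val0 lp lq passage_threshold_ge0 passage_threshold gap_ge
  (e := e) (l := rem e E) (w := w) (c := c) (rho := 2 * rho) (del := del) (kap := kap)
  w0 uel eta0 del0 kap0.
have {}H := H _ _.
(* Since [kap <= 1], raising the exponent to [N] only weakens the gain and makes it independent of
   the block. *)
apply: (@le_trans _ _ (EE val q (e :: rem e E) F w +
   (del / 2 * kap ^+ size (rem e E) - eta * (size (rem e E)).+1%:R))).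
  rewrite lerD2l lerB //.
    rewrite ler_wpM2l ?divr_ge0 // -(@subnKC (size (rem e E)) N); last by nlia.
    by rewrite exprD ler_piMr ?exprn_ge0 // exprn_ile1.
  by rewrite ler_wpM2l // szl ler_nat.
rewrite addrA lerBlDr; apply: H.
  by move=> f /memE[fL _]; case: (hc f) => ->.
move=> w' w'0 near off; apply: gap_del.
have conf0 : forall f, 0 <= conf Lam w c f by exact: (conf_ge0 Lam al0 albe w0 hc).
have hl f : A f -> f = e \/ f \in rem e E \/ conf Lam w c f = w' f.
  move=> _; have [->|fe] := eqVneq f e; first by left.
  right; have [fL|fL] := boolP (f \in Lam).
    by left; rewrite mem_rem_uniq // inE fe.
  right; rewrite /conf (negPf fL) off //.
  by apply: contra fL => /memE[].
have := threshold_lip conf0 w'0 M0 hs0 hl.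
have h1 : \sum_(f <- rem e E) `|w' f - conf Lam w c f| <= N%:R * (2 * rho).
  apply: (@le_trans _ _ (\sum_(f <- rem e E) (2 * rho))).
    rewrite big_seq [leRHS]big_seq; apply: ler_sum => f fl.
    by rewrite /conf (memE f fl).1 near.
  rewrite big_const_seq count_predT iter_addr_0 -[leLHS]mulr_natl ler_wpM2r ?mulr_ge0 //.
  by rewrite ler_nat; nlia.
rewrite ler_norml => /andP[h2 h3].
move: h1 h2 h3 hD1 hD2 rhoN; rewrite /D.
set t2 := threshold _ _ _ _ _ _; set NR := N%:R => h1 h2 h3 hD1 hD2 rhoN'.
have h4 : NR * (2 * rho) * 4 = 8 * NR * rho by ring.
apply/andP; split; lra.
Qed.

End BlockGain.

Lemma EE_perm (R : realType) (G : graph) (k : nat) (val p : 'I_k -> R)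
    (l l' : seq (edge G)) F w : uniq l -> perm_eq l l' ->
  EE val p l F w = EE val p l' F w.
Proof.
elim: l l' w => [|e l ih] l' w; first by move=> _; rewrite perm_sym => /perm_nilP ->.
move=> /= /andP[el ul] ll'; have ul' : uniq l' by rewrite -(perm_uniq ll') /= el.
have el' : e \in l' by rewrite -(perm_mem ll') mem_head.
rewrite (EE_front val p F w ul' el') /=; apply: eq_bigr => i _; congr (_ * _).
apply: ih => //; rewrite -(perm_cons e); apply: (perm_trans ll').
exact: perm_to_rem.
Qed.

Lemma uniq_flatten_disjoint (T : eqType) (I : eqType) (f : I -> seq T) (s : seq I) :
  uniq s -> (forall i, i \in s -> uniq (f i)) ->
  (forall i j t, i \in s -> j \in s -> t \in f i -> t \in f j -> i = j) ->
  uniq (flatten [seq f i | i <- s]).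
Proof.
elim: s => [//|i s ih] /= /andP[is_ us] uf disj.
rewrite cat_uniq uf ?mem_head // ih //=; last 2 first.
- by move=> j js; apply: uf; rewrite inE js orbT.
- by move=> j j' t js js'; apply: disj; rewrite inE ?js ?js' orbT.
rewrite andbT; apply/hasPn => t /flattenP[_ /mapP[j js ->] tj]; apply/negP => /= ti.
have ij : i = j by apply: (disj i j t) => //; rewrite ?mem_head // inE js orbT.
by rewrite ij js in is_.
Qed.

(** * Summing the gains of disjoint blocks *)

Section LinearGap.
Variables (R : realType) (G : graph).
Hypotheses (conn : connected_graph G) (hlf : locally_finite G)
  (hcount : countably_infinite G).
Variable R0 : nat.
Hypothesis HB : forall x z y : vertex G, (dist x z + dist z y = dist x y)%N ->
  forall s, is_walk x s -> wend x s = y ->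
  exists2 v, v \in x :: unzip2 s & (dist z v <= R0)%N.
Variables (nu nu' : probability (measurableTypeR R) R).
Hypotheses (fm : finite_mean nu) (nn : on_nonneg nu).
Hypotheses (fm' : finite_mean nu') (nn' : on_nonneg nu').
Variables (al be th del : R).
Hypotheses (al0 : 0 <= al) (albe : al < be) (th0 : 0 < th) (thb : th <= be - al)
  (del0 : 0 < del).
Hypothesis phi0 : forall s, 0 <= trunc_mean nu s - trunc_mean nu' s.
Hypothesis phi_del : forall s, al + th / 2 <= s <= be + 2 * th ->
  del <= trunc_mean nu s - trunc_mean nu' s.
Variables (L C L' N : nat).
Let n := (2 * L + C)%N.
Hypotheses (hL : (2 * R0 < L)%N) (C0 : (0 < C)%N) (hL' : (2 * n + R0 < L')%N).
Hypothesis hdet : forall p : gpath G, self_avoiding p -> plen p = C ->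
  exists q, self_avoiding q /\ is_detour ((be - al) / (2 * be)) p q.
Hypothesis hKL : be * (4 * R0 + 2 * C + 1)%:R <= (be - al) * L%:R.
Variable LamOf : vertex G -> {fset edge G}.
Hypotheses (cLam : forall o, (#|` LamOf o| <= N)%N)
  (hLam : forall o f, f \in LamOf o <-> exists2 v, v \in bnd f & (dist o v <= L')%N).
Variables (rho kap : R).
Hypotheses (rho0 : 0 < rho) (rhoN : 8 * N%:R * rho <= th) (kap0 : 0 <= kap)
  (kap1 : kap <= 1).
Let sg s := tail nu s + tail nu' s.
Hypotheses (kap_al : kap <= (sg (al - rho) - sg (al + rho)) / 2)
  (kap_be : kap <= (sg (be - rho) - sg (be + rho)) / 2).

(** An edge within [L'] of two block centres would put them at distance at most [2 * L' + 1], so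
    centres this far apart have disjoint blocks. *)
Definition period := (2 * L' + 2)%N.

Section Grids.
Variables (x y : vertex G) (A : {fset edge G}) (s0 : seq (edge G * vertex G)).
Hypothesis hs0 : walk_in [set` A] x y s0.
Variables (V : nat -> vertex G) (E : nat -> edge G).
Hypotheses (hVE : forall j, (j < dist x y)%N -> bnd (E j) = [fset V j; V j.+1]%fset)
  (Vd : V (dist x y) = y)
  (hV : forall j, (j <= dist x y)%N -> dist x (V j) = j)
  (hVV : forall a b, (a <= b <= dist x y)%N -> dist (V a) (V b) = (b - a)%N).
Let mb := (dist x y %/ period)%N.
Let bs := [seq enum_fset (LamOf (V (i * period)%N)) | i <- iota 0 mb].
Hypothesis bsA : forall e, e \in flatten bs -> e \in A.

Lemma blocks_uniq : uniq (flatten bs).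
Proof.
apply: uniq_flatten_disjoint; first exact: iota_uniq.
  by move=> i _; exact: fset_uniq.
have md : (mb * period <= dist x y)%N by exact: leq_trunc_div.
have key i j e : (i < j < mb)%N -> e \in LamOf (V (i * period)%N) ->
    e \in LamOf (V (j * period)%N) -> False.
  move=> /andP[ij jm] /hLam[u ue hu] /hLam[v ve hv].
  have [a [b be']] := bnd2 e.
  have uv : (dist u v <= 1)%N.
    move: ue ve; rewrite be' !inE => /orP[]/eqP -> /orP[]/eqP ->; rewrite ?distxx //.
      exact: dist_edge be'.
    by rewrite dist_sym //; exact: dist_edge be'.
  have h1 : (i.+1 * period <= j * period)%N by rewrite leq_mul2r ij orbT.
  have h2 : (j * period <= mb * period)%N by rewrite leq_mul2r ltnW ?orbT.
  have h3 : (i * period <= j * period <= dist x y)%N.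
    by rewrite leq_mul2r ltnW ?orbT //= (leq_trans h2).
  have h4 := hVV h3.
  have t1 := dist_triangle conn u (V (i * period)%N) (V (j * period)%N).
  have t2 := dist_triangle conn v u (V (j * period)%N).
  have t3 := dist_sym conn v (V (j * period)%N).
  by move: h1 h3 h4 t1 t2 t3 hu hv uv; rewrite /period mulSn; nlia.
move=> i j e; rewrite !mem_iota !add0n => im jm ei ej.
case: (ltngtP i j) => // ij; exfalso.
  by apply: (key i j e) => //; rewrite ij.
by apply: (key j i e) => //; rewrite ij.
Qed.

(** Discretization halves [del], and the passage through the half law halves it again, hence
    [del / 4]. The error [eta] is paid at most [N] times in each block and once for each edge
    outside the blocks. *)
Lemma grid_gap m : let eta := disc_err m nu + disc_err m nu' in
  be + rho <= m.+1%:R -> m.+1%:R^-1 <= rho -> eta <= del / 2 ->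
  EE (@gval R m) (@glaw R m nu') (enum_fset A) (fun v => passage_in [set` A] v x y) (fun=> 0)
    + (del / 4 * kap ^+ N) * mb%:R <=
  EE (@gval R m) (@glaw R m nu) (enum_fset A) (fun v => passage_in [set` A] v x y) (fun=> 0)
    + eta * (N * mb + #|` A|)%:R.
Proof.
move=> eta hM hMi heta.
have eta0 : 0 <= eta by rewrite addr_ge0 // disc_err_ge0.
have lp := glaw_is_law m nu; have lq := glaw_is_law m nu'.
have val0 (i : 'I_(grid m)) : 0 <= gval R i := gval_ge0 R i.
have valM (i : 'I_(grid m)) : gval R i <= m.+1%:R := gval_le R i.
have beM : be <= m.+1%:R by apply: le_trans hM; rewrite lerDl ltW.
have gapE s : trunc_mean nu s - trunc_mean nu' s - eta <=
    law_gap (@gval R m) (@glaw R m nu) (@glaw R m nu') s.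
  have h1 := glaw_trunc_mean m fm s; have h2 := glaw_trunc_mean m fm' s.
  rewrite /law_gap; under eq_bigr do rewrite mulrBl.
  rewrite sumrB; move: h1 h2; rewrite !ler_norml => /andP[a1 a2] /andP[b1 b2].
  by rewrite /eta; lra.
have gap_ge s : 0 <= s -> - eta <= law_gap (@gval R m) (@glaw R m nu) (@glaw R m nu') s.
  by move=> _; have := gapE s; have := phi0 s; lra.
have gap_del s : al + th / 2 <= s <= be + 2 * th ->
    del / 2 <= law_gap (@gval R m) (@glaw R m nu) (@glaw R m nu') s.
  by move=> /phi_del; have := gapE s; lra.
have near a : 0 <= a -> a <= be -> kap <= (sg (a - rho) - sg (a + rho)) / 2 ->
    kap <= \sum_(i | `|gval R i - a| <= 2 * rho) half_law (@glaw R m nu) (@glaw R m nu') i.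
  move=> a0 ab hk; apply: (le_trans hk).
  have aM : a + rho <= m.+1%:R by apply: le_trans hM; rewrite lerD2r.
  have h1 := glaw_near nu a0 rho0 hMi aM; have h2 := glaw_near nu' a0 rho0 hMi aM.
  rewrite /half_law -mulr_suml big_split /= /sg; lra.
have near_al := near al al0 (ltW albe) kap_al.
have near_be := near be (le_trans al0 (ltW albe)) (lexx _) kap_be.
set F := fun v => passage_in [set` A] v x y.
pose rest := [seq e <- enum_fset A | e \notin flatten bs].
have uA : uniq (enum_fset A) by exact: fset_uniq.
have uall : uniq (flatten bs ++ rest).
  rewrite cat_uniq blocks_uniq filter_uniq // andbT /=.
  by apply/hasPn => e; rewrite mem_filter => /andP[].
have permA : perm_eq (enum_fset A) (flatten bs ++ rest).
  apply: uniq_perm => // e; rewrite mem_cat mem_filter.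
  have [eb|eb] /= := boolP (e \in flatten bs); last by [].
  exact: bsA.
rewrite !(EE_perm _ _ _ _ uA permA).
have mbs : size bs = mb by rewrite size_map size_iota.
pose g := del / 2 / 2 * kap ^+ N - eta * N%:R.
have del2 : 0 <= del / 2 by rewrite divr_ge0 // ltW.
have D0 := passage_threshold_ge0 al0 albe hs0 beM.
have FD := passage_threshold hs0 val0 valM.
have w0 : nonneg (fun _ : edge G => 0 : R) by [].
have blocks : forall b, b \in bs -> forall w', nonneg w' ->
    EE (@gval R m) (@glaw R m nu') b F w' + g <= EE (@gval R m) (@glaw R m nu) b F w'.
  move=> b /mapP[i]; rewrite mem_iota add0n => /= im -> w' w'0.
  have hi : (i * period + n <= dist x y)%N.
    have h1 : (i.+1 * period <= mb * period)%N by rewrite leq_mul2r im orbT.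
    have h2 : (mb * period <= dist x y)%N by exact: leq_trunc_div.
    by move: h1 h2 hL'; rewrite /period mulSn; nlia.
  apply: (block_gain conn HB al0 albe hL C0 hL' hdet hKL hs0 val0 valM beM lp lq
    th0 thb (ltW rho0) rhoN kap0 kap1 eta0 del2 gap_ge gap_del near_al near_be
    (r := fun j => V (i * period + j)%N) (re := fun j => E (i * period + j)%N)) => //.
  - by move=> j jn; rewrite hVE ?addnS //; move: jn hi; rewrite -/n; nlia.
  - rewrite addn0 hV; last by move: hi; nlia.
    have hb : (i * period + n <= dist x y <= dist x y)%N by rewrite hi leqnn.
    rewrite -/n; have := hVV hb; rewrite Vd => ->; move: hi; nlia.
  - by move=> f; rewrite addn0; exact: hLam.
  - move=> f fL; apply: bsA; apply/flattenP; exists (enum_fset (LamOf (V (i * period)%N))) => //.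
    by apply/mapP; exists i => //; rewrite mem_iota.
have := EE_blocks val0 lp lq D0 FD gap_ge w0 uall blocks.
rewrite mbs /g => h.
have szr : (size rest)%:R <= (#|` A|)%:R :> R.
  by rewrite ler_nat size_filter count_size.
have hr : eta * (size rest)%:R <= eta * (#|` A|)%:R by rewrite ler_wpM2l.
rewrite natrD natrM mulrDr mulrA.
move: h hr; set X := EE _ _ _ _ _; set Y := EE _ _ _ _ _.
rewrite mulrBl; set kn := kap ^+ N; set a := eta * N%:R * mb%:R.
have -> : del / 2 / 2 * kn * mb%:R = del / 4 * kn * mb%:R.
  by congr (_ * _ * _); rewrite -mulrA -invfM; congr (_ / _); rewrite -natrM.
lra.
Qed.

End Grids.

Variables (d d' : measure_display) (Om : measurableType d) (Om' : measurableType d').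
Variables (P : probability Om R) (P' : probability Om' R).
Variables (w : edge G -> {RV P >-> measurableTypeR R})
  (w' : edge G -> {RV P' >-> measurableTypeR R}).
Hypotheses (hw : iid w nu) (hw' : iid w' nu').

Lemma linear_gap (x y : vertex G) : (0 < dist x y)%N ->
  del / 4 * kap ^+ N * (dist x y %/ period)%:R <=
  mean_passage w x y setT - mean_passage w' x y setT.
Proof.
move=> dxy; set mb := (dist x y %/ period)%N.
have [V [E [V0 Vd hVE hV hVV]]] := geodesic_fun conn dxy.
pose bs := [seq enum_fset (LamOf (V (i * period)%N)) | i <- iota 0 mb].
have [s0 [ws es us sz]] := dist_path conn x y.
pose B := [fset e in flatten bs ++ unzip1 s0]%fset.
have BE e : (e \in B) = (e \in flatten bs ++ unzip1 s0).
  by rewrite /B !inE mem_cat.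
have hB : walk_in [set` B] x y s0.
  by split => // e es'; rewrite /= BE mem_cat es' orbT.
apply/ler_addgt0Pr => eps eps0.
have eps20 : 0 < eps / 2 by rewrite divr_gt0.
(* Only [nu] needs an approximation: for [nu'], the restriction to [A] increases the passage time,
   which is the favourable direction. *)
have [A [BA hA]] := mean_passage_approx hlf hcount hw fm eps20 hB.
have hs0 : walk_in [set` A] x y s0.
  by have [h1 h2 h3] := hB; split => // e /h3; exact: (fsubsetP BA).
have bsA e : e \in flatten bs -> e \in A.
  by move=> eb; apply: (fsubsetP BA); rewrite BE mem_cat eb.
(* Number of errors [eta] to absorb: [N * mb] and one cardinal of [A] from the exchange of laws,
   another cardinal of [A] from discretizing both means. *)
pose X := (N * mb + #|` A| + #|` A|)%N.
pose e1 := Num.min (del / 4) (eps / 4 / X.+1%:R).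
have e10 : 0 < e1 by rewrite lt_min !divr_gt0.
have /cvgrPdist_le/(_ _ e10)[m1 _ hm1] := disc_err_cvg fm nn.
have /cvgrPdist_le/(_ _ e10)[m2 _ hm2] := disc_err_cvg fm' nn'.
pose m := maxn (maxn m1 m2) (maxn (Num.truncn (be + rho)) (Num.truncn rho^-1)).
have err1 : disc_err m nu <= e1.
  have := hm1 m; rewrite /= sub0r normrN ger0_norm ?disc_err_ge0 //; apply.
  by rewrite /m !leq_max leqnn.
have err2 : disc_err m nu' <= e1.
  have := hm2 m; rewrite /= sub0r normrN ger0_norm ?disc_err_ge0 //; apply.
  by rewrite /m !leq_max leqnn orbT.
have hM : be + rho <= m.+1%:R.
  apply/ltW; apply: (lt_le_trans (truncnS_gt _)); rewrite ler_nat ltnS.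
  by rewrite /m !leq_max leqnn !orbT.
have hMi : m.+1%:R^-1 <= rho.
  rewrite -[leRHS]invrK lef_pV2 ?posrE ?invr_gt0 //.
  apply/ltW; apply: (lt_le_trans (truncnS_gt _)); rewrite ler_nat ltnS.
  by rewrite /m !leq_max leqnn !orbT.
have e1d : e1 <= del / 4 by rewrite ge_min lexx.
have e1e : e1 <= eps / 4 / X.+1%:R by rewrite ge_min lexx orbT.
pose eta := disc_err m nu + disc_err m nu'.
have heta : eta <= del / 2 by rewrite /eta; lra.
have H := grid_gap hs0 hVE Vd hV hVV bsA hM hMi heta.
have h1 := mean_passage_EE hlf hcount hw fm m hs0.
have h2 := mean_passage_EE hlf hcount hw' fm' m hs0.
have h3 := mean_passage_ge hlf hcount hw' fm' hs0.
have hX : eta * X%:R <= eps / 2.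
  have : eta <= eps / 2 / X.+1%:R.
    by rewrite /eta; move: e1e err1 err2; set z := X.+1%:R^-1; lra.
  rewrite ler_pdivlMr // => h; apply: le_trans h.
  by rewrite ler_wpM2l ?ler_nat // addr_ge0 // disc_err_ge0.
rewrite -/eta -/mb in H.
move: h1 h2 H hX hA h3; rewrite !ler_norml /X !natrD !mulrDr.
move=> /andP[a1 a2] /andP[b1 b2].
have : (#|` A|)%:R * disc_err m nu + (#|` A|)%:R * disc_err m nu' = eta * (#|` A|)%:R.
  by rewrite -mulrDr mulrC.
lra.
Qed.

End LinearGap.

Lemma leq_divn_double (d m : nat) : (0 < m)%N -> (m <= d)%N ->
  (d <= d %/ m * (2 * m))%N.
Proof.
move=> m0 md; rewrite {1}(divn_eq d m) mulnCA mul2n -addnn leq_add2l.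
by apply/ltnW/(leq_trans (ltn_pmod d m0)); rewrite leq_pmull // divn_gt0.
Qed.

(** The constants are fixed in the order window, [C], [L], [L'], [N], [rho], [kap], each from the
    preceding ones; none depends on the endpoints. *)
Theorem detours_gap (R : realType) (G : graph) :
  connected_graph G -> locally_finite G -> countably_infinite G ->
  bounded_degree G -> quasi_isometric_to_tree R G -> admits_detours G R ->
  forall nu nu' : probability (measurableTypeR R) R,
     on_nonneg nu -> on_nonneg nu' -> finite_mean nu -> finite_mean nu' ->
     strictly_more_variable nu' nu -> liminf_gap_pos G nu nu'.
Proof.
move=> conn hlf hcount hdeg hqi hdet nu nu' nn nn' fm fm' smv.
have [R0 HB] := bottleneck conn hqi.
have [phi0 [s1 s1P]] := gap_pos_exists fm fm' smv.
have phiN s : s <= 0 -> trunc_mean nu s - trunc_mean nu' s = 0.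
  by move=> s0; rewrite !trunc_mean_neg // subrr.
have phiB s : trunc_mean nu s - trunc_mean nu' s <= \int[nu]_t `|t|.
  have [s0|s0] := leP s 0; first by rewrite phiN // Rintegral_ge0.
  have := trunc_mean_le fm s; have := trunc_mean_ge0 fm' nn' (ltW s0); lra.
have [al [be [th [del [/andP[al0 albe] /andP[th0 thb] del0 [sal sbe] win]]]]] :=
  gap_window (fun s t => trunc_meanE fm (s := s) (t := t))
    (fun s t => trunc_meanE fm' (s := s) (t := t)) (tail01 nu) (tail01 nu')
    (fun s t => tailN nu (s := s) (t := t)) (fun s t => tailN nu' (s := s) (t := t))
    phi0 phiN phiB s1P.
have be0 : 0 < be by exact: le_lt_trans albe.
have bal : 0 < be - al by rewrite subr_gt0.
have eps0 : 0 < (be - al) / (2 * be) by rewrite divr_gt0 // mulr_gt0.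
have [C [C0 hC]] := hdet _ eps0.
pose K := be * (4 * R0 + 2 * C + 1)%:R.
pose L := ((Num.truncn (K / (be - al))).+1 + 2 * R0)%N.
have hL : (2 * R0 < L)%N by rewrite /L addSn ltnS leq_addl.
have hKL : K <= (be - al) * L%:R.
  rewrite mulrC -ler_pdivrMr //; apply/ltW/(lt_le_trans (truncnS_gt _)).
  by rewrite ler_nat leq_addr.
pose L' := (2 * (2 * L + C) + R0).+1.
have hL' : (2 * (2 * L + C) + R0 < L')%N by [].
have [N /choice[LamOf hLam]] := edges_near conn hdeg L'.
pose rho := th / (8 * N.+1%:R).
have rho0 : 0 < rho by rewrite divr_gt0 // mulr_gt0.
have rhoN : 8 * N%:R * rho <= th.
  rewrite /rho mulrA ler_pdivrMr ?mulr_gt0 // mulrC ler_wpM2l ?(ltW th0) //.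
  by rewrite ler_wpM2l // ler_nat.
pose sg s := tail nu s + tail nu' s.
pose kap := Num.min 1 (Num.min ((sg (al - rho) - sg (al + rho)) / 2)
  ((sg (be - rho) - sg (be + rho)) / 2)).
have kap0 : 0 < kap.
  by rewrite !lt_min ltr01 !divr_gt0 // subr_gt0; [exact: sbe|exact: sal].
have kap1 : kap <= 1 by rewrite ge_min lexx.
have kal : kap <= (sg (al - rho) - sg (al + rho)) / 2 by rewrite !ge_min lexx orbT.
have kbe : kap <= (sg (be - rho) - sg (be + rho)) / 2 by rewrite !ge_min lexx !orbT.
(* The factor 2 compensates for rounding down the number of blocks, once at least one block fits. *)
pose c := del / 4 * kap ^+ N / (2 * period L')%:R.
have p0 : (0 < period L')%N by rewrite /period addnS.
have c0 : 0 < c by rewrite divr_gt0 // ?ltr0n ?muln_gt0 // mulr_gt0 ?divr_gt0 // exprn_gt0.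
move=> d d' Om Om' P P' w w' hw hw'.
apply: (@lt_le_trans _ _ c%:E); first by rewrite lte_fin.
apply: le_ereal_sup_tmp; eexists; first by exists (period L').
apply/ereal_infP => _ [[x y] /= dxy <-].
have dxy0 : (0 < dist x y)%N by apply: leq_trans dxy.
have [s [ws es us sz]] := dist_path conn x y.
have hT : walk_in setT x y s by [].
rewrite (expectation_passage hlf hcount hw fm nn hT).
rewrite (expectation_passage hlf hcount hw' fm' nn' hT).
rewrite -EFinB -EFinM lee_fin ler_pdivlMr ?ltr0n //.
have := linear_gap conn hlf hcount HB fm nn fm' nn' al0 albe th0 thb del0 phi0 win
  hL C0 hL' hC hKL (fun o => (hLam o).1) (fun o => (hLam o).2) rho0 rhoN (ltW kap0) kap1
  kal kbe hw hw' dxy0.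
apply: le_trans; rewrite /c; have : 0 <= del / 4 * kap ^+ N.
  by rewrite mulr_ge0 ?divr_ge0 ?exprn_ge0 ?(ltW del0) ?(ltW kap0).
move: (del / 4 * kap ^+ N) => a a0.
rewrite mulrAC ler_pdivrMr ?ltr0n ?muln_gt0 ?p0 // -mulrA ler_wpM2l //.
rewrite -natrM ler_nat.
exact: leq_divn_double.
Qed.

(** * Subcriticality for small parameters *)

Section Subcriticality.
Variables (R : realType) (G : graph).
Hypotheses (conn : connected_graph G) (hlf : locally_finite G).
Hypotheses (hcount : countably_infinite G).

Section OpenPaths.
Variables (d : measure_display) (Om : measurableType d) (P : probability Om R).
Variables (op : edge G -> {RV P >-> bool}).

Definition all_open (l : seq (edge G)) : set Om :=
  [set om | forall e, e \in l -> op e om].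

Lemma all_openE l :
  all_open l = \bigcap_(e in [set` [fset e in l]%fset]) op e @^-1` [set true].
Proof.
apply/seteqP; split => om h e /=; first by rewrite inE /=; exact: h.
by move=> el; apply: h; rewrite /= inE.
Qed.

Lemma measurable_all_open l : measurable (all_open l).
Proof.
elim: l => [|e l ih].
  by rewrite (_ : all_open _ = setT) //; apply/seteqP; split.
rewrite (_ : all_open _ = op e @^-1` [set true] `&` all_open l).
  apply: measurableI => //; rewrite -[X in measurable X]setTI.
  exact: (measurable_funP (op e)).
apply/seteqP; split => om.
  move=> h; split; first by apply: h; rewrite mem_head.
  by move=> f fl; apply: h; rewrite inE fl orbT.
by move=> [h1 h2] f; rewrite inE => /orP[/eqP ->|/h2].
Qed.

Lemma measurable_escape good o r :
  measurable [set om | escape_event good (fun e => op e om) o r].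
Proof.
have [f fi] := countable_walks hlf hcount.
pose F n := [set om | exists s, [/\ f s = n, is_walk o s, ~ gball o r (wend o s),
  good (o, s) & all_open (unzip1 s) om]].
rewrite (_ : [set om | _] = \bigcup_n F n).
  apply: bigcup_measurable => n _.
  have [[s [fs ws gs hs]]|no] := pselect (exists s, [/\ f s = n, is_walk o s,
    ~ gball o r (wend o s) & good (o, s)]); last first.
    rewrite (_ : F n = set0) //; apply/seteqP; split => // om [s [h1 h2 h3 h4 _]].
    by apply: no; exists s.
  rewrite (_ : F n = all_open (unzip1 s)); first exact: measurable_all_open.
  apply/seteqP; split => om.
    by move=> [t [ft _ _ _ +]]; rewrite -fs in ft; rewrite (fi _ _ ft).
  by move=> h; exists s.
apply/seteqP; split => om.
  move=> [[x' s] [ws os es gs hs]]; rewrite /pstart /= in os; subst x'.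
  exists (f s) => //; exists s; split => // e es'; apply: hs.
  by rewrite mem_pedges.
move=> [n _ [s [_ ws es gs hs]]]; exists (o, s); split => // e.
by rewrite mem_pedges; exact: hs.
Qed.

Variable p : R.
Hypotheses (p01 : 0 <= p <= 1) (hop : iid op (bernoulli_prob p)).

Lemma prob_all_open l : uniq l -> P (all_open l) = (p ^+ size l)%:E.
Proof.
move=> ul; rewrite all_openE hop.1 //.
under eq_bigr => e _.
  rewrite (_ : P _ = p%:E); first over.
  have := hop.2 e [set true] I; rewrite /distribution /pushforward => ->.
  by rewrite /bernoulli_prob p01 fsbig_set1.
rewrite big_const_seq count_predT.
have -> : size [fset e in l]%fset = size l by rewrite -[LHS]/(#|` _|) card_fseq undup_id.
by elim: (size l) => [|n ih] //=; rewrite ih exprS.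
Qed.

Lemma union_bound (I : eqType) (l : seq I) (F : I -> set Om) (c : R) (S : set Om) :
  measurable S -> (forall i, measurable (F i)) -> (forall i, P (F i) <= c%:E)%E ->
  (forall om, S om -> exists2 i, i \in l & F i om) ->
  (P S <= ((size l)%:R * c)%:E)%E.
Proof.
move=> mS mF hF; elim: l S mS => [|i l ih] S mS hS.
  rewrite (_ : S = set0) ?measure0 ?mul0r //.
  by apply/seteqP; split => // om /hS[i]; rewrite in_nil.
have mi : measurable (S `\` F i) by exact: measurableD.
apply: (@le_trans _ _ (P (F i) + P (S `\` F i)%classic)%E).
  apply: (@le_trans _ _ (P (F i `|` (S `\` F i)))); last exact: measureU2.
  apply: le_measure; rewrite ?inE //; first exact: measurableU.
  by move=> om So; have [|nF] := pselect (F i om); [left|right].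
rewrite /= -natr1 mulrDl mul1r addrC EFinD leeD //.
apply: ih => // om [/hS[j + Fj] nF]; rewrite inE => /orP[/eqP ji|jl]; last by exists j.
by rewrite ji in Fj.
Qed.

End OpenPaths.

Section WalkCount.
Variables (D : nat) (inc : vertex G -> seq (edge G)).
Hypothesis hinc : forall v, (size (inc v) <= D)%N /\ forall e, v \in bnd e -> e \in inc v.

Definition steps (x : vertex G) : seq (edge G * vertex G) :=
  [seq (e, y) | e <- inc x, y <- enum_fset (bnd e)].

Fixpoint walks n x : seq (seq (edge G * vertex G)) :=
  if n is n'.+1 then flatten [seq [seq p :: s | s <- walks n' p.2] | p <- steps x]
  else [:: [::]].

Lemma size_steps x : (size (steps x) <= D * 2)%N.
Proof.
apply: (leq_trans (size_flatten_le (D := 2) _ _)).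
  by move=> e; rewrite size_map -(card_bnd e).
by rewrite leq_mul2r; case: (hinc x) => ->; rewrite orbT.
Qed.

Lemma size_walks n x : (size (walks n x) <= (D * 2) ^ n)%N.
Proof.
elim: n x => [//|n ih] x /=; rewrite expnS.
apply: (leq_trans (size_flatten_le (D := (D * 2) ^ n) _ _)).
  by move=> q; rewrite size_map.
by rewrite leq_mul2r size_steps orbT.
Qed.

Lemma mem_walks x s : is_walk x s -> s \in walks (size s) x.
Proof.
elim: s x => [//|[e y] s ih] x /= /andP[/eqP be /ih h].
apply/flattenP; exists [seq (e, y) :: t | t <- walks (size s) y].
  apply/mapP; exists (e, y) => //; apply/allpairsPdep; exists e, y; split => //.
    by apply: (hinc x).2; rewrite be !inE eqxx.
  by rewrite -[_ \in _]/(y \in bnd e) be !inE eqxx orbT.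
exact: map_f.
Qed.

Variables (d : measure_display) (Om : measurableType d) (P : probability Om R).
Variables (op : edge G -> {RV P >-> bool}) (p : R).
Hypotheses (p01 : 0 <= p <= 1) (hop : iid op (bernoulli_prob p)).

(** After loop erasure, the first [r] steps of an escaping open path have distinct edges, hence are
    open with probability [p ^+ r]. A step chooses an incident edge and one of its two ends, hence
    at most [(D * 2) ^ r] candidates. *)
Lemma prob_escape good o r :
  (P [set om | escape_event good (fun e => op e om) o r] <=
     (((D * 2)%:R * p) ^+ r)%:E)%E.
Proof.
pose F (s : seq (edge G * vertex G)) := if uniq (unzip1 s) && (size s == r)
  then all_open op (unzip1 s) else set0.
have p0 : 0 <= p by case/andP: p01.
apply: (@le_trans _ _ ((size (walks r o))%:R * p ^+ r)%:E); last first.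
  rewrite lee_fin exprMn ler_wpM2r ?exprn_ge0 // -natrX ler_nat.
  exact: size_walks.
apply: (@union_bound _ _ P _ (walks r o) F) => //.
- exact: measurable_escape.
- by move=> s; rewrite /F; case: ifP => // _; exact: measurable_all_open.
- move=> s; rewrite /F; case: ifP => [/andP[us /eqP <-]|_].
    by rewrite (prob_all_open p01 hop us) size_map.
  by rewrite measure0 lee_fin exprn_ge0.
move=> om [[x' s] [ws xo es _ hs]]; rewrite /pstart /= in xo; subst x'.
have [t [wt et ut st]] := loop_erasure ws.
have ue := uniq_walk_edges wt ut.
have rt : (r <= size t)%N.
  rewrite leqNgt; apply/negP => tr; apply: es; rewrite /gball /=.
  by apply: leq_trans (ltnW tr); apply: dist_le => //; rewrite -[RHS]et.
have szt : size (take r t) = r by rewrite size_takel.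
have wtk : is_walk o (take r t).
  by move: wt; rewrite -{1}(cat_take_drop r t) is_walk_cat => /andP[].
exists (take r t).
  by rewrite -{2}szt; exact: mem_walks.
rewrite /F szt eqxx andbT /unzip1 map_take take_uniq // => e /mem_take et'.
by apply: hs; rewrite mem_pedges; exact: (mem_subseq (map_subseq fst st)).
Qed.

End WalkCount.

Hypothesis hdeg : bounded_degree G.

(* At most [(2 D) ^ r] walks of length [r] start at a vertex, hence the bound
   [(2 D p) ^ r <= 2 ^- r] for [p <= 1 / (4 (D + 1))]. *)
Lemma exp_decay_small : exists2 p0 : R, 0 < p0 &
  forall (good : set (gpath G)) p, 0 <= p <= p0 -> 0 <= p <= 1 /\ exp_decay good p.
Proof.
have [D [inc hinc]] := incident_list hdeg.
exists (4 * D.+1%:R)^-1; first by rewrite invr_gt0 mulr_gt0.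
move=> good p /andP[p0 pD].
have D4 : (D * 2)%:R * p <= 2^-1.
  have h : (D * 2)%:R * p <= (D.+1 * 2)%:R * p.
    by rewrite ler_wpM2r // ler_nat leq_mul2r leqnSn orbT.
  apply: (le_trans h); apply: (@le_trans _ _ ((D.+1 * 2)%:R * (4 * D.+1%:R)^-1)).
    by rewrite ler_wpM2l.
  have : (D.+1%:R : R) != 0 by rewrite pnatr_eq0.
  rewrite natrM; move: (D.+1%:R : R) => x x0.
  by rewrite (_ : _ * _ = 2^-1) //; field.
have p1 : p <= 1.
  apply: (le_trans pD); rewrite invf_le1 ?mulr_gt0 //.
  by rewrite -(natrM _ 4) ler1n muln_gt0.
have p01 : 0 <= p <= 1 by rewrite p0.
split => // d Om P op hop.
have ln2 : 0 < ln (2 : R) by rewrite ln_gt0 // ltr1n.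
apply: (@le_lt_trans _ _ (- ln (2 : R))%:E); last by rewrite lte_fin oppr_lt0.
(* The upper limit is an infimum over neighbourhoods of infinity; the set of positive radii is
   enough, since the estimate is uniform there. *)
apply: (@le_trans _ _ (ereal_sup ((fun r : nat => ereal_sup [set (r%:R^-1)%:E *
    lne (P [set om | escape_event good (fun e => op e om) o r]) | o in [set: vertex G]])%E
    @` [set r | (0 < r)%N]))).
  apply: ereal_inf_lbound; exists [set r | (0 < r)%N] => //.
  by exists 1%N.
apply: ge_ereal_sup => _ [r /= r0 <-]; apply: ge_ereal_sup => _ [v _ <-].
have hP := prob_escape hinc p01 hop good v r.
have q0 : 0 < (2^-1 : R) ^+ r by rewrite exprn_gt0.
have hP2 : (P [set om | escape_event good (fun e => op e om) v r] <= ((2^-1) ^+ r)%:E)%E.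
  by apply: (le_trans hP); rewrite lee_fin lerXn2r // nnegrE ?mulr_ge0.
have hl : (lne (P [set om | escape_event good (fun e => op e om) v r]) <=
    (r%:R * - ln (2 : R))%:E)%E.
  have -> : r%:R * - ln (2 : R) = ln ((2^-1) ^+ r).
    by rewrite lnXn // lnV ?posrE // mulr_natl.
  rewrite -lne_EFin // lee_lne ?in_itv /= ?leey ?andbT ?lee_fin ?(ltW q0) //.
apply: (le_trans (lee_wpmul2l _ hl)); first by rewrite lee_fin invr_ge0.
by rewrite -EFinM lee_fin mulrA mulVf ?mul1r // pnatr_eq0 -lt0n.
Qed.

Lemma pc_geo_gt0 : exists2 p0 : R, 0 < p0 & p0 <= pc_geo R G.
Proof.
have [p0 p00 h] := exp_decay_small; exists p0 => //.
apply: ub_le_sup; first by exists 1 => p [/andP[]].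
by apply: h; rewrite lexx ltW.
Qed.

End Subcriticality.

(** * Independent digits of a uniform variable *)

Section Digits.
Variables (R : realType) (k : nat).
Notation K := k.+1.

Definition unif : probability (measurableTypeR R) R := uniform_prob (@ltr01 R).

(** For [x] in [[0, 1[], the integer formed by its first [n] digits in base [K]; [digit j x] is the
    last digit of the prefix of length [j.+1]. *)
Definition prefix_code (n : nat) (x : R) : nat := Num.truncn ((K ^ n)%:R * x).

Definition digit (j : nat) (x : R) : nat := (prefix_code j.+1 x %% K)%N.

Lemma ltn_digit j x : (digit j x < K)%N.
Proof. by rewrite ltn_mod. Qed.

Lemma truncn_divn (x : R) : 0 <= x -> (Num.truncn (K%:R * x) %/ K)%N = Num.truncn x.
Proof.
move=> x0; apply/esym/truncn_def; set m := Num.truncn _.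
have K0 : 0 < (K%:R : R) by [].
have /andP[m1 m2] : m%:R <= K%:R * x < m.+1%:R by rewrite truncn_itv // mulr_ge0.
rewrite -(ler_pM2l K0) -(ltr_pM2l K0) -!natrM; apply/andP; split.
  by apply: le_trans m1; rewrite ler_nat mulnC leq_divM.
by apply: (lt_le_trans m2); rewrite ler_nat mulnC ltn_ceil.
Qed.

Lemma prefix_codeS n x : 0 <= x -> (prefix_code n.+1 x %/ K)%N = prefix_code n x.
Proof.
move=> x0; rewrite /prefix_code expnS natrM -mulrA truncn_divn //.
by rewrite mulr_ge0.
Qed.

Variable A : nat -> pred nat.

(** Here [i] is read as a word of [n] digits in base [K]; the lowest one has index [n.-1]. *)
Fixpoint digits_in n i : bool :=
  if n is n'.+1 then digits_in n' (i %/ K)%N && A n' (i %% K)%N else true.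

Lemma digits_inP n x : 0 <= x ->
  digits_in n (prefix_code n x) <-> forall j, (j < n)%N -> A j (digit j x).
Proof.
move=> x0; elim: n => [//|n ih] /=; rewrite prefix_codeS //; split.
  move=> /andP[/ih h An] j; rewrite ltnS leq_eqVlt => /orP[/eqP ->//|/h//].
move=> h; apply/andP; split; last exact: h.
by apply/ih => j jn; apply: h; exact: ltnW.
Qed.

Lemma sum_divn_modn (f g : nat -> nat) m :
  (\sum_(0 <= i < m * K) f (i %/ K) * g (i %% K) =
   (\sum_(0 <= q < m) f q) * \sum_(0 <= b < K) g b)%N.
Proof.
elim: m => [|m ih]; first by rewrite mul0n big_geq // [X in _ = (X * _)%N]big_geq.
rewrite [in RHS]big_nat_recr //= mulnDl -ih mulSnr.
rewrite (@big_cat_nat _ _ _ (m * K)%N) ?leq_addr //=; congr addn.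
rewrite -{1}[(m * K)%N]add0n big_addn addKn big_distrr /=.
apply: eq_big_nat => b /andP[_ bK].
by rewrite addnC divnMDl // divn_small // addn0 modnMDl modn_small.
Qed.

Lemma sum_digits_in n : (\sum_(0 <= i < K ^ n) digits_in n i =
  \prod_(j < n) \sum_(0 <= b < K) A j b)%N.
Proof.
elim: n => [|n ih]; first by rewrite big_ord0 big_nat1.
rewrite big_ord_recr /= -ih expnSr -sum_divn_modn.
by apply: eq_bigr => i _; rewrite mulnb.
Qed.

Definition cell n i : set (measurableTypeR R) :=
  [set x | i%:R / (K ^ n)%:R <= x < i.+1%:R / (K ^ n)%:R].

Lemma cellE n i : cell n i = `[(i%:R / (K ^ n)%:R), (i.+1%:R / (K ^ n)%:R)[%classic.
Proof. by apply/seteqP; split => x; rewrite /cell /= in_itv. Qed.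

Lemma measurable_cell n i : measurable (cell n i).
Proof. by rewrite cellE; exact: measurable_itv. Qed.

Lemma unif_cell n i : (i < K ^ n)%N -> unif (cell n i) = ((K ^ n)%:R^-1)%:E.
Proof.
move=> iK; have K0 : 0 < ((K ^ n)%:R : R) by rewrite ltr0n expn_gt0.
transitivity (\int[lebesgue_measure]_(x in cell n i) (1%:E : \bar R))%E.
  apply: eq_integral => x; rewrite inE /cell /= /uniform_pdf => /andP[h1 h2].
  have -> : 0 <= x <= 1.
    apply/andP; split; first by apply: le_trans h1; rewrite divr_ge0.
    by apply/ltW/(lt_le_trans h2); rewrite ler_pdivrMr // mul1r ler_nat.
  by rewrite subr0 invr1.
rewrite integral_cst; last exact: measurable_cell.
rewrite mul1e cellE; have := lebesgue_measure_itv `[i%:R / (K ^ n)%:R, (i.+1%:R / (K ^ n)%:R : R)[.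
move=> /= h; apply: (etrans h).
rewrite lte_fin ltr_pM2r ?invr_gt0 // ltr_nat ltnSn.
by rewrite -EFinB -mulrBl -natr1 addrC addKr mul1r.
Qed.

Lemma prefix_code_cell n i x : 0 <= x -> cell n i x <-> prefix_code n x = i.
Proof.
move=> x0; have K0 : 0 < ((K ^ n)%:R : R) by rewrite ltr0n expn_gt0.
rewrite /cell /= ler_pdivrMr // ltr_pdivlMr // mulrC.
split => [/truncn_def//|<-].
by rewrite truncn_itv // mulr_ge0.
Qed.

Lemma unif_out : unif (~` [set x : R | 0 <= x < 1]) = 0%E.
Proof.
have -> : [set x : R | 0 <= x < 1] = cell 0 0.
  by apply/seteqP; split => x; rewrite /cell /= expn0 mul0r divr1.
by rewrite probability_setC ?unif_cell // ?invr1 ?subee //; exact: measurable_cell.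
Qed.

Lemma measurable_digit j (B : set nat) : measurable (digit j @^-1` B : set (measurableTypeR R)).
Proof.
rewrite (_ : digit j @^-1` B = \bigcup_(i in [set i | B (i %% K)%N]) (prefix_code j.+1 @^-1` [set i])).
  apply: bigcup_measurable => i _.
  rewrite (_ : _ @^-1` _ = [set x : R | 0 <= x]
     `&` cell j.+1 i `|` ([set x : R | x < 0] `&` [set x | i = 0%N])).
    apply: measurableU; apply: measurableI.
    - rewrite (_ : [set _ | _] = `[0, +oo[%classic); first exact: measurable_itv.
      by apply/seteqP; split=> x /=; rewrite in_itv /= andbT.
    - exact: measurable_cell.
    - exact: neg_measurable.
    - have [->|i0] := eqVneq i 0%N.
        by rewrite (_ : [set _ | _] = setT) //; apply/seteqP; split.
      by rewrite (_ : [set _ | _] = set0) //; apply/seteqP; split => // x /= /eqP; rewrite (negPf i0).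
  apply/seteqP; split => x /=.
    have [x0|x0] := leP 0 x; first by move=> h; left; split => //; exact/prefix_code_cell.
    move=> h; right; split => //; rewrite -h /prefix_code.
    by apply/eqP; rewrite -leqn0 truncn_le_nat; apply: (le_lt_trans _ ltr01); rewrite mulr_ge0_le0 // ltW.
  move=> [[x0 /(prefix_code_cell _ _ x0)//]|[x0 ->]].
  by apply/eqP; rewrite -leqn0 truncn_le_nat; apply: (le_lt_trans _ ltr01); rewrite mulr_ge0_le0 // ltW.
apply/seteqP; split => x /=; first by move=> h; exists (prefix_code j.+1 x).
by move=> [i Bi e]; rewrite /digit e.
Qed.

(** Up to the null set outside [[0, 1[], the event is the disjoint union of the cells of admissible
    words, each of mass [(K ^ n)%:R^-1]; the number of these words is a product. *)
Lemma unif_digits n : unif [set x | forall j, (j < n)%N -> A j (digit j x)] =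
  (\prod_(j < n) ((\sum_(0 <= b < K) A j b)%N%:R / K%:R))%:E.
Proof.
set S := [set x | _].
have mS : measurable S.
  rewrite (_ : S = \bigcap_(j in `I_n) (digit j @^-1` [set b | A j b])) //.
  by apply: bigcap_measurableType => j _; exact: measurable_digit.
pose T := \big[setU/set0]_(i < K ^ n | digits_in n i) cell n i.
have mT : measurable T by apply: bigsetU_measurable => i _; exact: measurable_cell.
have ST x : 0 <= x < 1 -> S x <-> T x.
  move=> /andP[x0 x1]; rewrite /T -(big_mkord (digits_in n) (cell n)) -bigcup_seq_cond.
  split => [h|[i /= /andP[_ hi] /(prefix_code_cell _ _ x0) e]]; last first.
    by apply/(digits_inP n x0); rewrite e.
  exists (prefix_code n x); last exact/prefix_code_cell.
  apply/andP; split; last by apply/(digits_inP n x0).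
  rewrite mem_index_iota /= /prefix_code truncn_lt_nat; last by rewrite mulr_ge0.
  by rewrite -[ltRHS]mulr1 ltr_pM2l.
have mI : measurable (~` [set x : R | 0 <= x < 1] : set (measurableTypeR R)).
  apply: measurableC; rewrite (_ : [set _ | _] = `[0, 1[%classic); first exact: measurable_itv.
  by apply/seteqP; split=> x /=; rewrite in_itv.
have le U V : measurable U -> measurable V -> (forall x : R, 0 <= x < 1 -> U x -> V x) ->
    (unif U <= unif V)%E.
  move=> mU mV UV; rewrite -[leRHS]adde0 -unif_out.
  apply: (@le_trans _ _ (unif (V `|` ~` [set x : R | 0 <= x < 1]))); last exact: measureU2.
  apply: le_measure; rewrite ?inE //.
    exact: measurableU.
  move=> x Ux; have [x01|] := pselect (0 <= x < 1); last by right.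
  by left; apply: UV.
have -> : unif S = unif T.
  by apply/eqP; rewrite eq_le !le // => x /ST[].
have -> : unif T = (\sum_(i < K ^ n | digits_in n i) unif (cell n i))%E.
  apply: measure_bigsetU_ord_cond => [i _|]; first exact: measurable_cell.
  apply/trivIsetP => i j _ _ ij; apply/seteqP; split => // x [ci cj].
  have x0 : 0 <= x by case/andP: ci => + _; apply: le_trans; rewrite divr_ge0.
  move/(prefix_code_cell _ _ x0): ci; move/(prefix_code_cell _ _ x0): cj => -> e.
  by move: ij; rewrite -val_eqE /= e eqxx.
rewrite (eq_bigr (fun=> ((K ^ n)%:R^-1)%:E)); last by move=> i _; exact: unif_cell.
rewrite sumEFin; congr (_%:E); rewrite big_split /= prodfV -!natr_prod -sum_digits_in.
rewrite prod_nat_const card_ord big_mkcond /= big_mkord natr_sum mulr_suml.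
by apply: eq_bigr => i _; case: digits_in; rewrite ?mul1r ?mul0r.
Qed.

End Digits.

Section DigitWeights.
Variables (R : realType) (k : nat).
Notation K := k.+1.

(** Digits outside [J] are left unconstrained and contribute a factor 1 to the product over all
    positions below [n]. *)
Lemma unif_digits_in (J : seq nat) (B : nat -> set nat) : uniq J ->
  unif R [set x | forall j, j \in J -> B j (digit k j x)] =
  (\prod_(j <- J) ((\sum_(0 <= b < K) `[< B j b >])%N%:R / K%:R))%:E.
Proof.
move=> uJ; pose n := (\max_(j <- J) j).+1.
pose A j : pred nat := fun b => (j \in J) ==> `[< B j b >].
have Jn j : j \in J -> (j < n)%N by move=> jJ; rewrite ltnS leq_bigmax_seq.
have -> : [set x : R | forall j, j \in J -> B j (digit k j x)] =
    [set x | forall j, (j < n)%N -> A j (digit k j x)].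
  apply/seteqP; split => x h j.
    by move=> _; apply/implyP => /h hj; apply/asboolP.
  by move=> jJ; have /implyP/(_ jJ)/asboolP := h j (Jn j jJ).
rewrite unif_digits; congr (_%:E).
transitivity (\prod_(0 <= j < n | j \in J) ((\sum_(0 <= b < K) `[< B j b >])%N%:R / K%:R : R)).
  rewrite [RHS]big_mkcond [RHS]big_mkord; apply: eq_bigr => j _.
  rewrite /A; case: (_ \in J) => //=.
  by rewrite big_const_nat iter_addn_0 subn0 mul1n divff // pnatr_eq0.
rewrite -big_filter; apply: perm_big; apply: uniq_perm => //.
  by rewrite filter_uniq // iota_uniq.
move=> j; rewrite mem_filter mem_index_iota /=.
by case jJ : (j \in J) => //=; rewrite Jn.
Qed.

Lemma unif_digit j (B : set nat) :
  unif R (digit k j @^-1` B) = ((\sum_(0 <= b < K) `[< B b >])%N%:R / K%:R)%:E.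
Proof.
have := @unif_digits_in [:: j] (fun=> B) isT; rewrite big_seq1 => <-.
congr (unif R _); apply/seteqP; split => x /= h; last by apply: h; rewrite mem_head.
by move=> i; rewrite inE => /eqP ->.
Qed.

Lemma digit_integral j (F : nat -> R) :
  (unif R).-integrable [set: measurableTypeR R] (fun x => (F (digit k j x))%:E) /\
  (\int[unif R]_x (F (digit k j x))%:E = (K%:R^-1 * \sum_(b < K) F b)%:E)%E.
Proof.
pose S b : set (measurableTypeR R) := digit k j @^-1` [set b].
have mS b : measurable (S b) by exact: measurable_digit.
have FE x : (F (digit k j x))%:E = (\sum_(b < K) (F b)%:E * (\1_(S b) x)%:E)%E.
  rewrite (bigD1 (Ordinal (ltn_digit k j x))) //= indicE mem_set // mule1 big1 ?adde0 //.
  move=> b; rewrite -val_eqE /= => bd.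
  by rewrite indicE memNset ?mule0 // /S /= => e; rewrite e eqxx in bd.
have iS (b : 'I_K) : (unif R).-integrable [set: measurableTypeR R]
    (fun x => (F b)%:E * (\1_(S b) x)%:E)%E.
  by apply: integrableZl => //; exact: integrable_indic.
have -> : (fun x => (F (digit k j x))%:E) = (fun x => \sum_(b < K) (F b)%:E * (\1_(S b) x)%:E)%E.
  by apply/funext => x; exact: FE.
split; first by apply: integrable_sum => // b _; exact: iS.
rewrite integral_sum // mulr_sumr -sumEFin; apply: eq_bigr => b _.
rewrite integralZl //; last exact: integrable_indic.
rewrite integral_indic // setIT; transitivity ((F b)%:E *
    ((\sum_(0 <= i < K) `[< [set (b : nat)] i >])%N%:R / K%:R)%:E)%E.
  by congr (_ * _)%E; exact: unif_digit.
rewrite -EFinM mulrC; congr (_ * _)%:E.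
rewrite big_mkord (bigD1 b) //= big1 ?addn0; last first.
  by move=> i ib; apply/eqP; rewrite eqb0; apply/asboolP => e; rewrite -val_eqE /= e eqxx in ib.
by rewrite (_ : `[< _ >] = true) ?mul1r //; apply/asboolP.
Qed.

Variable g : nat -> R.

Definition digit_weight_fun (j : nat) (x : measurableTypeR R) : measurableTypeR R :=
  g (digit k j x).

Lemma measurable_digit_weight j : measurable_fun setT (digit_weight_fun j).
Proof. by move=> _ B _; rewrite setTI; exact: (@measurable_digit _ _ j (g @^-1` B)). Qed.

Definition digit_weight j : {RV (unif R) >-> measurableTypeR R} :=
  HB.pack (digit_weight_fun j)
    (isMeasurableFun.Build _ _ _ _ (digit_weight_fun j) (measurable_digit_weight j)).

Definition digit_law : probability (measurableTypeR R) R :=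
  distribution (unif R) (digit_weight 0).

Lemma digit_lawE (B : set R) :
  digit_law B = ((\sum_(0 <= b < K) `[< B (g b) >])%N%:R / K%:R)%:E.
Proof. exact: (unif_digit 0 (g @^-1` B)). Qed.

Lemma digit_law_integral (f : R -> R) :
  measurable_fun [set: measurableTypeR R] (f : measurableTypeR R -> R) ->
  digit_law.-integrable [set: measurableTypeR R] (EFin \o f) /\
  (\int[digit_law]_x (f x)%:E = (K%:R^-1 * \sum_(b < K) f (g b))%:E)%E.
Proof.
move=> mf; have [i1 e1] := digit_integral 0 (f \o g).
have mf' : measurable_fun [set: measurableTypeR R] (fun x : measurableTypeR R => (f x)%:E).
  exact/measurable_EFinP.
split; last by exact: etrans (integral_distribution (X := digit_weight 0) mf' i1) e1.
apply/integrableP; split => //.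
rewrite (ge0_integral_distribution (digit_weight 0) (f := fun x => `|(f x)%:E|%E)) //.
  by have /integrableP[_] := i1.
exact: measurableT_comp.
Qed.

Lemma digit_iid (I : choiceType) (c : I -> nat) : injective c ->
  iid (fun i => digit_weight (c i)) digit_law.
Proof.
move=> ci; split; last first.
  by move=> i A mA; rewrite digit_lawE; exact: (unif_digit (c i) (g @^-1` A)).
move=> J A mA.
(* Constraints are transported from indices to digit positions without an inverse of [c]: by
   injectivity at most one [i] has code [j]. *)
pose B j : set nat := [set b | forall i, i \in J -> c i = j -> A i (g b)].
have uJ : uniq (map c J) by rewrite map_inj_uniq.
have BE i : i \in J -> B (c i) = g @^-1` A i.
  move=> iJ; apply/seteqP; split => b /=; first by apply.
  by move=> h i' _ /ci ->.
transitivity (unif R [set x | forall j, j \in map c J -> B j (digit k j x)]).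
  congr (unif R _); apply/seteqP; split => x /= h.
    by move=> j _ i iJ <-; exact: h.
  by move=> i iJ; apply: (h (c i)) => //; exact: map_f.
rewrite unif_digits_in // big_map -prodEFin big_seq [RHS]big_seq.
apply: eq_bigr => i iJ; rewrite BE //; apply/esym.
exact: (unif_digit (c i) (g @^-1` A i)).
Qed.

End DigitWeights.

(** * Graphs without detours *)

Section NoDetour.
Variables (R : realType) (G : graph) (eps : R).
Hypotheses (conn : connected_graph G) (eps0 : 0 < eps).
Variables (x : vertex G) (s : seq (edge G * vertex G)).
Hypothesis sa : self_avoiding (x, s).
Hypothesis nodet : forall q, self_avoiding q -> ~ is_detour eps (x, s) q.

(** Common edges cancel. The other edges of [p] cost at most [1 + eps] each, those of a competitor
    [q] at least 1 each, and there are too many of the latter because [q] is not a detour. *)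
Lemma no_detour_geodesic (w : edge G -> R) : (forall e, 1 <= w e <= 1 + eps) ->
  passage_time w x (wend x s) = cost w s.
Proof.
move=> w1; have w0 e : 0 <= w e by case/andP: (w1 e) => + _; apply: le_trans.
have /andP[/= ws us] := sa; have wT : walk_in setT x (wend x s) s by [].
rewrite passage_inT; apply/eqP; rewrite eq_le passage_in_le //=.
apply: (passage_in_ge wT) => t [[wt et _] ut].
rewrite -!(path_time_cost w x) //; try exact: uniq_walk_edges us; try exact: uniq_walk_edges ut.
set p : gpath G := (x, s); set q : gpath G := (x, t).
have saq : self_avoiding q by rewrite self_avoidingE wt.
rewrite /path_time; have [->//|qp] := pselect (pedges q = pedges p).
have hlt : (1 + eps) * (#|` (pedges p `\` pedges q)%fset|)%:R <
    (#|` (pedges q `\` pedges p)%fset|)%:R.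
  rewrite ltNge; apply/negP => h; apply: (nodet saq); split => //.
have card (A B : {fset edge G}) : (#|` (A `\` B)%fset|)%:R = \sum_(e <- A | e \notin B) 1 :> R.
  rewrite -big_filter big_const_seq count_predT iter_addr_0; congr (_%:R).
  apply: perm_size; apply: uniq_perm; rewrite ?filter_uniq ?fset_uniq // => e.
  by rewrite mem_filter inE.
rewrite (bigID (fun e => e \in pedges q)) [leRHS](bigID (fun e => e \in pedges p)) /=.
apply: lerD.
  rewrite -big_filter -[leRHS]big_filter le_eqVlt; apply/orP; left; apply/eqP.
  apply: perm_big; apply: uniq_perm; rewrite ?filter_uniq ?fset_uniq //.
  by move=> e; rewrite !mem_filter andbC.
apply: le_trans (_ : (1 + eps) * (#|` (pedges p `\` pedges q)%fset|)%:R <= _).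
  by rewrite card mulr_sumr; apply: ler_sum => e _; rewrite mulr1; case/andP: (w1 e).
apply: (le_trans (ltW hlt)); rewrite card; apply: ler_sum => e _.
by case/andP: (w1 e).
Qed.

(** Optimality for the constant weight 1. *)
Lemma no_detour_dist : dist x (wend x s) = plen (x, s).
Proof.
have /andP[/= ws us] := sa; have ue := uniq_walk_edges ws us.
have [t [wt et ut st]] := dist_path conn x (wend x s).
have h := @no_detour_geodesic (fun=> 1) (fun e => _).
apply/eqP; rewrite eqn_leq dist_le_plen //= plenE // -st.
have c1 (r : seq (edge G * vertex G)) : cost (fun=> 1) r = (size r)%:R :> R.
  by rewrite /cost big_const_seq count_predT iter_addr_0.
rewrite -(ler_nat R) -!c1 -h; last by rewrite lexx lerDl ltW.
by rewrite passage_inT; apply: passage_in_le.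
Qed.

End NoDetour.

(** * Two laws with equal means and small atoms *)

Section TwoLaws.
Variables (R : realType) (k : nat) (eps : R).
Hypothesis eps0 : 0 < eps.
Notation K := k.+2.

Definition evenly_spaced (j : nat) : R := 1 + eps / K.+1%:R * j.+1%:R.

(* The two extreme values are pushed apart by [eps / K.+1], which keeps the mean. *)
Definition spread_out (j : nat) : R :=
  if j == 0%N then 1 else if j == k.+1 then 1 + eps else evenly_spaced j.

Lemma evenly_spaced_gt1 j : 1 < evenly_spaced j.
Proof. by rewrite ltrDl mulr_gt0 // divr_gt0. Qed.

Lemma evenly_spaced_le j : (j < K)%N -> evenly_spaced j <= 1 + eps.
Proof.
move=> jK; rewrite lerD2l mulrAC ler_pdivrMr // ler_wpM2l ?(ltW eps0) // ler_nat.
exact: ltnW.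
Qed.

Lemma evenly_spaced_inj : injective evenly_spaced.
Proof.
move=> i j /addrI /mulfI; rewrite mulf_neq0 ?gt_eqF ?invr_gt0 //.
by move=> /(_ isT)/eqP; rewrite eqr_nat => /eqP[].
Qed.

Lemma spread_out_itv j : (j < K)%N -> 1 <= spread_out j <= 1 + eps.
Proof.
move=> jK; rewrite /spread_out; case: eqP => _; first by rewrite lexx lerDl ltW.
case: eqP => _; first by rewrite lexx lerDl ltW.
by rewrite evenly_spaced_le // (ltW (evenly_spaced_gt1 _)).
Qed.

Lemma sum_spread_out (f : R -> R) :
  \sum_(b < K) f (spread_out b) - \sum_(b < K) f (evenly_spaced b) =
  (f 1 + f (1 + eps)) - (f (evenly_spaced 0) + f (evenly_spaced k.+1)).
Proof.
have E (g : nat -> R) : \sum_(b < K) g b = g 0%N + \sum_(i < k) g i.+1 + g k.+1.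
  by rewrite big_ord_recl big_ord_recr /= addrA.
rewrite (E (f \o spread_out)) (E (f \o evenly_spaced)) /= {1 3}/spread_out /= eqxx.
rewrite (eq_bigr (fun i : 'I_k => f (evenly_spaced i.+1))); last first.
  move=> i _; rewrite /spread_out /= eqSS; case: eqP => // e.
  by have := ltn_ord i; rewrite e ltnn.
lra.
Qed.

Lemma spread_out_mean :
  \sum_(b < K) spread_out b = \sum_(b < K) evenly_spaced b.
Proof.
apply/eqP; rewrite -subr_eq0 (sum_spread_out id) /evenly_spaced.
have : (K.+1%:R : R) != 0 by rewrite pnatr_eq0.
have -> : (K.+1%:R : R) = k.+2%:R + 1 by rewrite natr1.
by move: (k.+2%:R : R) => a a0; apply/eqP; field.
Qed.

(** The extreme evenly spaced values are the mixtures of [1] and [1 + eps] with weights [1 - t], [t]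
    and [t], [1 - t], where [t] is the inverse of [K.+1]. The two concavity inequalities add up to
    the claim. *)
Lemma spread_out_concave (f : R -> R) : concave f ->
  \sum_(b < K) f (spread_out b) <= \sum_(b < K) f (evenly_spaced b).
Proof.
move=> cf; rewrite -subr_le0 sum_spread_out subr_le0.
pose t : R := K.+1%:R^-1; have t0 : 0 <= t by rewrite invr_ge0.
have t1 : t <= 1 by rewrite invf_le1 // ler1n.
have h1 := cf (1 - t) 1 (1 + eps); have h2 := cf t 1 (1 + eps).
have e1 : (1 - t) * 1 + (1 - (1 - t)) * (1 + eps) = evenly_spaced 0.
  by rewrite /evenly_spaced -/t; lra.
have e2 : t * 1 + (1 - t) * (1 + eps) = evenly_spaced k.+1.
  rewrite /evenly_spaced -/t; have : t * K.+1%:R = 1 by rewrite mulVf // pnatr_eq0.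
  have -> : (K.+1%:R : R) = k.+2%:R + 1 by rewrite natr1.
  by move=> /(congr1 (fun z => eps * z)); lra.
by rewrite e1 in h1; rewrite e2 in h2; have := h1 _; have := h2 _; lra.
Qed.

Let nu : probability (measurableTypeR R) R := digit_law k.+1 evenly_spaced.
Let nu' : probability (measurableTypeR R) R := digit_law k.+1 spread_out.

Lemma digit_law_full (g : nat -> R) (A : set R) :
  (forall b, (b < K)%N -> A (g b)) -> digit_law k.+1 g A = 1%E.
Proof.
move=> h; rewrite digit_lawE.
have -> : (\sum_(0 <= b < K) `[< A (g b) >] = \sum_(0 <= b < K) 1)%N.
  by apply: eq_big_nat => b /andP[_ bK]; apply/eqP; rewrite eqb1; apply/asboolP; exact: h.
by rewrite sum_nat_const_nat subn0 muln1 divff // pnatr_eq0.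
Qed.

Lemma digit_law_null (g : nat -> R) (A : set R) :
  (forall b, (b < K)%N -> ~ A (g b)) -> digit_law k.+1 g A = 0%E.
Proof.
move=> h; rewrite digit_lawE big_nat big1 ?mul0r // => b /andP[_ bK].
by apply/eqP; rewrite eqb0; apply/asboolP; exact: h.
Qed.

Lemma digit_law_gt0 (g : nat -> R) (A : set R) b :
  (b < K)%N -> A (g b) -> (0 < digit_law k.+1 g A)%E.
Proof.
move=> bK Ab; rewrite digit_lawE lte_fin divr_gt0 // ltr0n.
rewrite big_mkord (bigD1 (Ordinal bK)) //= (_ : `[< _ >] = true) //.
exact/asboolP.
Qed.

Lemma more_variable_spread : strictly_more_variable nu' nu.
Proof.
split=> [f cf _ i1 i2|h].
  have mf : measurable_fun [set: measurableTypeR R] (f : measurableTypeR R -> R).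
    by apply/measurable_EFinP; exact: measurable_int i1.
  rewrite (digit_law_integral k.+1 evenly_spaced mf).2.
  rewrite (digit_law_integral k.+1 spread_out mf).2 lee_fin.
  by rewrite ler_wpM2l ?invr_ge0 // spread_out_concave.
(* The laws differ at the point 1: it is a value of [spread_out], while all evenly spaced values
   exceed 1. *)
have m1 : measurable ([set 1] : set (measurableTypeR R)) by exact: measurable_set1.
have := @digit_law_gt0 spread_out [set 1] 0 isT erefl.
rewrite -/nu' (h _ m1) /nu digit_law_null ?ltxx // => b _ /= e.
by have := evenly_spaced_gt1 b; rewrite e ltxx.
Qed.

(** Places [nu] in the second case of [exponential_subcritical], where the atom is compared with
    [pc_geo]. *)
Lemma supp_inf_ge1 : 1 <= inf (supp nu).
Proof.
apply: lb_le_inf.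
  exists (evenly_spaced 0) => U _ U0; exact: (@digit_law_gt0 _ _ 0).
move=> t st; rewrite leNgt; apply/negP => t1.
have := st [set y : R | y < 1] (@open_lt _ 1) t1.
rewrite /nu digit_law_null ?ltxx // => b _ /= h.
by have := lt_trans h (evenly_spaced_gt1 b); rewrite ltxx.
Qed.

Lemma atom_le (a : R) : (nu [set a] <= (K%:R^-1)%:E)%E.
Proof.
rewrite /nu digit_lawE lee_fin ler_pdivrMr // mulVf ?pnatr_eq0 // lern1.
rewrite big_mkord; have [[b /asboolP ba]|no] := pselect (exists b : 'I_K, `[< evenly_spaced b = a >]).
  rewrite (bigD1 b) //= big1 ?addn0; first by case: asboolP.
  move=> i ib; apply/eqP; rewrite eqb0; apply/asboolP => /= e.
  by move/eqP: ib; apply; apply: val_inj; apply: evenly_spaced_inj; rewrite e.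
rewrite big1 // => b _; apply/eqP; rewrite eqb0; apply/negP => h.
by apply: no; exists b.
Qed.

End TwoLaws.

Section FailureWithoutDetours.
Variables (R : realType) (G : graph).
Hypotheses (conn : connected_graph G) (hlf : locally_finite G).
Hypotheses (hcount : countably_infinite G) (hdeg : bounded_degree G).

Lemma no_detour_expectation (k : nat) (eps : R) (c : edge G -> nat) (g : nat -> R) x s :
  (forall j, (j < k.+2)%N -> 1 <= g j <= 1 + eps) ->
  self_avoiding (x, s) -> (forall q, self_avoiding q -> ~ is_detour eps (x, s) q) ->
  ('E_(unif R)[fun om => passage_time (fun e => digit_weight k.+1 g (c e) om) x (wend x s)]
   = ((size s)%:R * (k.+2%:R^-1 * \sum_(b < k.+2) g b))%:E)%E.
Proof.
move=> g1 sa nodet; rewrite expectation.unlock.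
transitivity (\int[unif R]_om \sum_(p <- s) (g (digit k.+1 (c p.1) om))%:E)%E.
  apply: eq_integral => om _; rewrite sumEFin; congr (_%:E).
  rewrite (no_detour_geodesic sa nodet) // => e; apply: g1.
  exact: ltn_digit.
rewrite integral_sum //; last by move=> p; exact: (digit_integral k.+1 (c p.1) g).1.
under eq_bigr do rewrite (digit_integral k.+1 (c _) g).2.
by rewrite sumEFin big_const_seq count_predT iter_addr_0 mulr_natl.
Qed.

Theorem vdBK_detours : vdBK R G -> admits_detours G R.
Proof.
move=> vd eps eps0; apply: contrapT => hno.
have path_without C : (0 < C)%N -> exists p : gpath G, [/\ self_avoiding p, plen p = C &
    forall q, self_avoiding q -> ~ is_detour eps p q].
  move=> C0; apply: contrapT => h; apply: hno; exists C; split => // p sp pC.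
  apply: contrapT => h2; apply: h; exists p; split => // q sq dq.
  by apply: h2; exists q.
have [p0 p00 pp] := pc_geo_gt0 R conn hlf hcount hdeg.
(* Then [k.+2] exceeds the inverse of [p0], so every atom of the evenly spaced law is below
   [pc_geo]. *)
pose k := Num.truncn p0^-1.
have Kp : (k.+2%:R : R)^-1 < p0.
  rewrite -[ltRHS]invrK ltf_pV2 ?posrE ?invr_gt0 //.
  by apply: (lt_trans (truncnS_gt _)); rewrite ltr_nat.
have [c ci] := countable_edges hlf hcount.
pose f := evenly_spaced k eps; pose f' := spread_out k eps.
have f1 j : (j < k.+2)%N -> 1 <= f j <= 1 + eps.
  by move=> jk; rewrite evenly_spaced_le // (ltW (evenly_spaced_gt1 _ eps0 _)).
have f1' j := @spread_out_itv R k eps eps0 j.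
have ge0 (g : nat -> R) : (forall j, (j < k.+2)%N -> 1 <= g j <= 1 + eps) ->
    on_nonneg (digit_law k.+1 g).
  move=> h; apply: digit_law_full => b /h/andP[+ _] /=; exact: le_trans.
have fm (g : nat -> R) : finite_mean (digit_law k.+1 g).
  by apply: (digit_law_integral k.+1 g (f := id) _).1; exact: measurable_id.
have := vd (digit_law k.+1 f) (digit_law k.+1 f') (ge0 _ f1) (ge0 _ f1') (fm _) (fm _).
have sub : exponential_subcritical G (digit_law k.+1 f).
  have s1 := @supp_inf_ge1 R k eps eps0; right; split; first exact: lt_le_trans s1.
  apply: (le_lt_trans (@atom_le R k eps eps0 _)); rewrite lte_fin.
  exact: lt_le_trans pp.
move=> /(_ sub (@more_variable_spread R k eps eps0)) gap.
have := gap _ _ _ _ _ _ _ _ (digit_iid k.+1 f ci) (digit_iid k.+1 f' ci).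
apply/negP; rewrite -leNgt; apply: ge_ereal_sup => _ [N _ <-].
(* The ends of this path are at distance [N.+1], so they are admissible in the infimum over
   distances at least [N]; their two means agree, which makes every such infimum at most 0. *)
have [[x s] [sa pC nodet]] := path_without N.+1 isT.
apply: ereal_inf_lbound; exists (x, wend x s) => /=.
  by rewrite (no_detour_dist conn eps0 sa nodet) pC.
rewrite (no_detour_expectation c f1 sa nodet).
rewrite (no_detour_expectation c f1' sa nodet).
by rewrite spread_out_mean // subee // mul0e.
Qed.

End FailureWithoutDetours.

Theorem theorem1p3 (R : realType) (G : graph)
    (hconn : connected_graph G) (hlf : locally_finite G)
    (hcount : countably_infinite G) (hdeg : bounded_degree G)
    (hqi : quasi_isometric_to_tree R G) :
  (vdBK R G <-> admits_detours G R) /\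
  (admits_detours G R ->
   forall nu nu' : probability (measurableTypeR R) R,
     on_nonneg nu -> on_nonneg nu' -> finite_mean nu -> finite_mean nu' ->
     strictly_more_variable nu' nu ->
     liminf_gap_pos G nu nu').
Proof.
have gap := detours_gap hconn hlf hcount hdeg hqi.
split => //; split=> [|det]; first exact: vdBK_detours.
by move=> nu nu' n n' m m' _; exact: gap.
Qed.
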